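(* Let $T>0$ and let $B\in L^\infty(\Gamma,H;\mu)$. There is an $\mathcal{E}^\Gamma$-exceptional set $N\subset F$ (the one fixed in the context) such that for every $z\in F\setminus N$ the following holds for the sample paths of the diffusion $\mathbb{M}$ on $F$: for every $l\in D(A)$, $$\langle l, X_t-X_0\rangle=\int_0^t\langle l,\mathrm{d}\tilde W^z_s\rangle+\int_0^t\langle l,B(X_s)\rangle\,\mathrm{d}s-\int_0^t\langle Al,X_s\rangle\,\mathrm{d}s+\frac12\int_0^t\langle l,\bar A^{*}\nu_\Gamma(X_s)\rangle\,\mathrm{d}L^{\partial\Gamma}_s,\qquad t\in[0,T],\ \tilde P_z\text{-a.s.},$$ and $$\int_0^t\mathbb{I}_{\partial\Gamma}(X_s)\,\mathrm{d}L^{\partial\Gamma}_s=L^{\partial\Gamma}_t,\qquad t\ge0,\ \tilde P_z\text{-a.s.}$$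
   Context: **Basic setting.** $H$ is a separable real Hilbert space with inner product $\langle\cdot,\cdot\rangle$ and norm $|\cdot|$. $A:D(A)\subset H\to H$ is linear and self-adjoint with $\langle Ax,x\rangle\ge\delta|x|^2$ for all $x\in D(A)$ and some $\delta>0$, and $A^{-1}$ is of trace class; $\{e_j\}_{j\in\mathbb{N}}$ is an orthonormal basis of $H$ with $Ae_j=\alpha_je_j$. $\mu$ is the centered Gaussian measure on $H$ with covariance operator $Q=\frac12A^{-1}$. $D$ is the Fréchet derivative, $\partial_j\varphi=\langle D\varphi,e_j\rangle$. $C^1_b(H)$ is the set of all bounded Fréchet differentiable functions $H\to\mathbb{R}$ with bounded Fréchet derivative; for $K\subset H$, $C_b^1(K)$ is the set of restrictions to $K$ of functions in $C_b^1(H)$ (derivatives are those of an extension). $\mathbb{I}_K$ is the indicator function of $K$. **BV functions.** $A_{1/2}(x)=\int_0^x(\log(1+s))^{1/2}\mathrm{d}s$, $x\ge0$, and $L(\log L)^{1/2}(H,\mu)$ is the set of Borel $f:H\to\mathbb{R}$ with $A_{1/2}(|f|)\in L^1(H,\mu)$. For $G=\sum_{j=1}^m g_jl^j$ with $g_j\in C_b^1(H)$, $l^j\in D(A)$, put $D^*G(z)=\sum_j\big(-\langle l^j,Dg_j(z)\rangle+2g_j(z)\langle Al^j,z\rangle\big)$. For $f\in L(\log L)^{1/2}(H,\mu)$ let $V(f)=\sup\int_HD^*G\,f\,\mathrm{d}\mu$ over all such $G$ with $|G|\le1$; $BV(H,H)$ is the set of such $f$ with $V(f)<\infty$. **The set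 $\Gamma$.** $\Gamma\subset H$ is closed, convex and bounded with $\mathbb{I}_\Gamma\in BV(H,H)$; $F:=\operatorname{supp}(\mathbb{I}_\Gamma\,\mathrm{d}\mu)$. There are a unique finite positive measure $\|\partial\Gamma\|$ on $\Gamma$, supported by $\partial\Gamma$, and a Borel map $\eta_\Gamma:H\to H$ (unique $\|\partial\Gamma\|$-a.e.) with $|\eta_\Gamma|=1$ $\|\partial\Gamma\|$-a.e., $\|\partial\Gamma\|(\Gamma)=V(\mathbb{I}_\Gamma)$ and $\int_\Gamma D^*G\,\mathrm{d}\mu=-\int_{\partial\Gamma}\langle G,\eta_\Gamma\rangle\,\mathrm{d}\|\partial\Gamma\|$ for all $G=\sum_{j=1}^m g_jl^j$ with $m\in\mathbb{N}$, $g_j\in C_b^1(H)$, $l^j\in D(A)$. Put $\nu_\Gamma:=-\eta_\Gamma$. **The matrix $\breve A$.** $\breve A$ is a map from $\Gamma$ to the bounded linear operators on $H$, with entries $\breve a_{ij}:\Gamma\to\mathbb{R}$ determined by $\breve A(\cdot)e_j=\sum_{i\ge1}\breve a_{ij}(\cdot)e_i$, such that: $\sup_{x\in\Gamma}\sum_{i,j}|\breve a_{ij}(x)|^2<\infty$; $\breve a_{ij}=-\breve a_{ji}$ for all $i,j$; $\breve a_{ij}\in C_b^1(\Gamma)$ for all $i,j$; and, with $\beta^\mu_{e_i}:=-2\langle Ae_i,\cdot\rangle$, $\mu\text{-}\operatorname{ess\,sup}_{x\in\Gamma}\sum_{j\ge1}\big(\sum_{i\ge1}\big|\frac{\breve a_{ij}(x)}2\beta^\mu_{e_i}(x)+\frac{\partial_i\breve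 a_{ij}(x)}2\big|\big)^2<\infty$. Put $\beta^{\mu,\breve A}:=\sum_{j\ge1}\sum_{i\ge1}\big(\frac{\breve a_{ij}}2\beta^\mu_{e_i}+\frac{\partial_i\breve a_{ij}}2\big)e_j\in L^\infty(\Gamma,H;\mu)$, $\bar A:=\breve A+\mathrm{Id}$, $\bar A^*:=\breve A^*+\mathrm{Id}$ (transposes), $\bar A^*\nu_\Gamma(x):=\bar A^*(x)(\nu_\Gamma(x))$. **Dirichlet forms and diffusion.** $(\mathcal{E}^\Gamma,D(\mathcal{E}^\Gamma))$ is the closure in $L^2(F;\mu)$ of $\frac12\int_\Gamma\langle Du,Dv\rangle\mathrm{d}\mu$, $u,v\in C_b^1(F)$; $(\mathcal{E},D(\mathcal{E}))$ is the closure of $\mathcal{E}^{\Gamma,\bar A}(u,v)=\frac12\int_\Gamma\langle\bar A(Du),Dv\rangle\mathrm{d}\mu$, $u,v\in C_b^1(F)$. Both are quasi-regular local Dirichlet forms with the same exceptional sets and the same smooth measures. $\mathbb{M}=(\Omega,\mathcal{M},(\mathcal{M}_t)_{t\ge0},(X_t)_{t\ge0},(P_z)_{z\in F})$ is the diffusion with infinite life time associated with $(\mathcal{E},D(\mathcal{E}))$. The measure $\|\partial\Gamma\|$ is $\mathcal{E}$-smooth and $(L^{\partial\Gamma}_t)_{t\ge0}$ is the positive continuous additive functional of $\mathbb{M}$ associated to it by the Revuz correspondence: $\lim_{t\searrow0}\frac1t\int_FE_x\big[\int_0^tf(X_s)\mathrm{d}L^{\partial\Gamma}_s\big]\mathbb{I}_\Gamma(x)\mu(\mathrm{d}x)=\int_Ff\,\mathrm{d}\|\partial\Gamma\|$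 for all positive Borel $f$. **Girsanov transformation.** For $k\ge1$ put $W^z_k(t):=\langle e_k,X_t-z\rangle-\int_0^t\langle e_k,\beta^{\mu,\breve A}(X_s)\rangle\mathrm{d}s+\int_0^t\langle Ae_k,X_s\rangle\mathrm{d}s-\frac12\int_0^t\langle e_k,\bar A^*\nu_\Gamma(X_s)\rangle\mathrm{d}L^{\partial\Gamma}_s$. There is an $\mathcal{E}^\Gamma$-exceptional set $N\subset F$ such that for all $z\in F\setminus N$: under $P_z$, the $W^z_k$, $k\ge1$, are independent real $(\mathcal{M}_t)$-Brownian motions, i.e. $W^z=(W^z_ke_k)_{k\ge1}$ is an $\mathcal{M}_t$-cylindrical Wiener process; $P_z$-a.s. $\int_0^T|B(X_s)|^2\mathrm{d}s\le T\,\|\,|B|\,\|^2_{L^\infty(\Gamma;\mu)}$; and $Z^z_t:=\sum_{k\ge1}\int_0^t\langle e_k,(B-\beta^{\mu,\breve A})(X_s)\rangle\mathrm{d}W^z_k(s)$ converges uniformly on $[0,T]$ $P_z$-a.s. with $\langle Z^z\rangle_t=\int_0^t|(B-\beta^{\mu,\breve A})(X_s)|^2\mathrm{d}s$. For $z\in F\setminus N$ let $\mathrm{d}\tilde P_z:=e^{Z^z_T-\frac12\langle Z^z\rangle_T}\mathrm{d}P_z$ on $(\Omega,\mathcal{M})$, a probability measure, and $\tilde W^z_k(t):=W^z_k(t)-\int_0^t\langle e_k,(B-\beta^{\mu,\breve A})(X_s)\rangle\mathrm{d}s$, $t\in[0,T]$; under $\tilde P_z$, $\tilde W^z=(\tilde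 W^z_ke_k)_{k\ge1}$ is an $\mathcal{M}_t$-cylindrical Wiener process on $[0,T]$, and $\int_0^t\langle l,\mathrm{d}\tilde W^z_s\rangle=\sum_k\langle l,e_k\rangle\tilde W^z_k(t)$. *)

(* Defs.v *)
From HB Require Import structures.
From mathcomp Require Import all_boot all_order all_algebra.
From mathcomp Require Import all_classical all_reals all_analysis.
From mathcomp Require Import measurable_realfun ess_sup_inf.

Set Implicit Arguments.
Unset Strict Implicit.
Unset Printing Implicit Defensive.

Import Order.TTheory GRing.Theory Num.Theory.
Import numFieldNormedType.Exports.

Local Open Scope classical_set_scope.
Local Open Scope ring_scope.

Definition borel (H : ptopologicalType) := g_sigma_algebraType (@open H).

Section Hilbert.
Context {R : realType} {H : completeNormedModType R}.
Implicit Types (ip : H -> H -> R) (e : nat -> H).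

Record inner_product ip : Prop := {
  ip_sym : forall x y, ip x y = ip y x ;
  ip_lin : forall (a : R) x y z, ip (a *: x + y) z = a * ip x z + ip y z ;
  ip_norm : forall x, ip x x = `|x| ^+ 2 }.

Definition orthonormal_basis ip e : Prop :=
  (forall i j, ip (e i) (e j) = (i == j)%:R) /\
  (forall x, (fun n => \sum_(i < n) ip x (e i) *: e i) @ \oo --> x).

(* The last field says that the graph of the adjoint of A is the graph of A. *)
Record self_adjoint ip (DA : set H) (A : H -> H) : Prop := {
  sa_zero : DA 0 ;
  sa_lin : forall (a : R) x y, DA x -> DA y ->
    DA (a *: x + y) /\ A (a *: x + y) = a *: A x + A y ;
  sa_dense : closure DA = setT ;
  sa_adj : forall y z,
    (forall x, DA x -> ip (A x) y = ip x z) <-> (DA y /\ A y = z) }.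

Definition inverse_operator (DA : set H) (A S : H -> H) : Prop :=
  (forall y, DA (S y) /\ A (S y) = y) /\ (forall x, DA x -> S (A x) = x).

(* Nuclear representation; on a Hilbert space nuclear = trace class. *)
Definition trace_class ip (S : H -> H) : Prop :=
  exists a b : nat -> H,
    (\sum_(n <oo) (`|a n| * `|b n|)%:E < +oo)%E /\
    forall x, (fun m => \sum_(n < m) ip x (a n) *: b n) @ \oo --> S x.

(* N(0, S), through its Fourier transform
   int exp (i <l, x>) mu (dx) = exp (- <S l, l> / 2). *)
Definition centered_gaussian ip (S : H -> H) (mu : probability (borel H) R) :=
  forall l : H,
    (\int[mu]_x (cos (ip l x))%:E = (expR (- (ip (S l) l / 2)))%:E)%E /\
    (\int[mu]_x (sin (ip l x))%:E = 0)%E.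

Definition Cb1 (u : H -> R) : Prop :=
  [/\ exists M : R, forall x, `|u x| <= M,
      forall x, differentiable u x &
      exists M : R, forall x h, `|'d u x h| <= M * `|h| ].

(* D u (x) as an element of H (Riesz). *)
Definition grad ip (u : H -> R) (x : H) : H :=
  xget 0 [set g | forall h, 'd u x h = ip g h].

Definition partial ip e (i : nat) (u : H -> R) (x : H) : R :=
  ip (grad ip u x) (e i).

Definition Cb1_extension (K : set H) (u v : H -> R) : Prop :=
  Cb1 v /\ forall x, K x -> v x = u x.

Definition vfield m (g : 'I_m -> H -> R) (l : 'I_m -> H) (z : H) : H :=
  \sum_(j < m) g j z *: l j.

Definition Dstar ip (A : H -> H) m (g : 'I_m -> H -> R) (l : 'I_m -> H)
    (z : H) : R :=
  \sum_(j < m) (- ip (l j) (grad ip (g j) z) + 2 * g j z * ip (A (l j)) z).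

Definition A_half (x : R) : R :=
  \int[lebesgue_measure]_(s in `[0, x]) Num.sqrt (ln (1 + s)).

Definition LlogL_half (mu : probability (borel H) R) (f : H -> R) : Prop :=
  measurable_fun [set: borel H] f /\
  mu.-integrable [set: borel H] (fun x => (A_half `|f x|)%:E).

Definition variation ip (DA : set H) (A : H -> H)
    (mu : probability (borel H) R) (f : H -> R) : \bar R :=
  ereal_sup [set v | exists m (g : 'I_m -> H -> R) (l : 'I_m -> H),
    [/\ forall j, Cb1 (g j), forall j, DA (l j),
        forall z, `|vfield g l z| <= 1 &
        v = (\int[mu]_z (Dstar ip A g l z * f z)%:E)%E] ].

Definition BV ip (DA : set H) (A : H -> H) (mu : probability (borel H) R)
    (f : H -> R) : Prop :=
  LlogL_half mu f /\ (variation ip DA A mu f < +oo)%E.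

Definition convex_subset (G : set H) : Prop :=
  forall x y (t : R), G x -> G y -> 0 <= t <= 1 -> G (t *: x + (1 - t) *: y).

Definition boundary (G : set H) : set H := closure G `\` interior G.

Definition supp (mu : probability (borel H) R) (G : set H) : set H :=
  [set x | forall U : set H, open U -> U x -> (0 < mu (U `&` G))%E].

(* dG is || d Gamma || and eta is eta_Gamma. *)
Record boundary_measure ip (DA : set H) (A : H -> H)
    (mu : probability (borel H) R) (G : set H)
    (dG : {finite_measure set (borel H) -> \bar R}) (eta : H -> H) : Prop := {
  bm_supp : dG (~` boundary G) = 0%E ;
  bm_meas : measurable_fun [set: borel H] (eta : borel H -> borel H) ;
  bm_unit : {ae dG, forall x, `|eta x| = 1} ;
  bm_mass : dG G = variation ip DA A mu (\1_G) ;
  bm_ibp : forall m (g : 'I_m -> H -> R) (l : 'I_m -> H),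
    (forall j, Cb1 (g j)) -> (forall j, DA (l j)) ->
    \int[mu]_(z in G) Dstar ip A g l z =
    - \int[dG]_(z in boundary G) ip (vfield g l z) (eta z) }.

Definition Linfty_norm (mu : probability (borel H) R) (G : set H)
    (f : H -> H) : \bar R :=
  ess_sup mu (fun x => (`|f x| * \1_G x)%:E).

Definition Linfty (mu : probability (borel H) R) (G : set H) (f : H -> H) :=
  measurable_fun [set: borel H] (f : borel H -> borel H) /\
  (Linfty_norm mu G f < +oo)%E.

Definition bounded_operator (S : H -> H) : Prop :=
  (forall (a : R) x y, S (a *: x + y) = a *: S x + S y) /\
  exists M : R, forall x, `|S x| <= M * `|x|.

Definition adjoint ip (S : H -> H) (y : H) : H :=
  xget 0 [set z | forall x, ip (S x) y = ip x z].

(* a_ij, from Ab(x) e_j = sum_i a_ij(x) e_i. *)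
Definition entry ip e (Ab : H -> H -> H) (i j : nat) (x : H) : R :=
  ip (Ab x (e j)) (e i).

(* a_ij/2 * beta_{e_i} + (d_i a_ij)/2; ext i j is the extension of a_ij to H
   used to differentiate a_ij. *)
Definition drift_entry ip (A : H -> H) e (Ab : H -> H -> H)
    (ext : nat -> nat -> H -> R) (i j : nat) (x : H) : R :=
  entry ip e Ab i j x / 2 * (- 2 * ip (A (e i)) x)
  + partial ip e i (ext i j) x / 2.

Record breve_matrix ip (A : H -> H) e (mu : probability (borel H) R)
    (G : set H) (Ab : H -> H -> H) (ext : nat -> nat -> H -> R) : Prop := {
  bA_op : forall x, G x -> bounded_operator (Ab x) ;
  bA_HS : (ereal_sup [set (\sum_(i <oo) \sum_(j <oo)
             (entry ip e Ab i j x ^+ 2)%:E)%E | x in G] < +oo)%E ;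
  bA_anti : forall i j x, G x -> entry ip e Ab i j x = - entry ip e Ab j i x ;
  bA_Cb1 : forall i j, Cb1_extension G (entry ip e Ab i j) (ext i j) ;
  bA_drift : (ess_sup mu (fun x =>
      (\sum_(j <oo) (\sum_(i <oo) `|drift_entry ip A e Ab ext i j x|%:E) ^+ 2)
      * (\1_G x)%:E) < +oo)%E }.

Definition is_drift ip (A : H -> H) e (mu : probability (borel H) R)
    (G : set H) (Ab : H -> H -> H) (ext : nat -> nat -> H -> R)
    (beta : H -> H) : Prop :=
  measurable_fun [set: borel H] (beta : borel H -> borel H) /\
  {ae mu, forall x, G x ->
    (fun n => \sum_(j < n)
       limn (series (fun i => drift_entry ip A e Ab ext i j x)) *: e j)
    @ \oo --> beta x}.

(* (Ab + Id)^* nu with nu = - eta. *)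
Definition Abar_star_nu ip (Ab : H -> H -> H) (eta : H -> H) (x : H) : H :=
  adjoint ip (Ab x) (- eta x) + - eta x.

Definition form_Gamma ip (mu : probability (borel H) R) (G : set H)
    (u v : H -> R) : R :=
  1 / 2 * \int[mu]_(x in G) ip (grad ip u x) (grad ip v x).

Definition form_Abar ip (mu : probability (borel H) R) (G : set H)
    (Ab : H -> H -> H) (u v : H -> R) : R :=
  1 / 2 * \int[mu]_(x in G)
    ip (Ab x (grad ip u x) + grad ip u x) (grad ip v x).

(* Forms are given on C^1_b(H); their closures are taken in L^2(F; mu), whose
   elements are represented by Borel functions on H. *)
Section Form.
Variables (mu : probability (borel H) R) (F : set H).
Variable E0 : (H -> R) -> (H -> R) -> R.

Definition L2 (f : H -> R) : Prop :=
  measurable_fun [set: borel H] f /\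
  (\int[mu]_(x in F) (f x ^+ 2)%:E < +oo)%E.

Definition L2dot (f g : H -> R) : R := \int[mu]_(x in F) (f x * g x).

Definition L2_cvg (un : nat -> H -> R) (u : H -> R) : Prop :=
  (fun n => \int[mu]_(x in F) ((un n x - u x) ^+ 2)%:E)%E @ \oo --> 0%E.

Definition form_Cauchy (un : nat -> H -> R) : Prop :=
  forall eps : R, 0 < eps -> exists N : nat, forall n m : nat,
    (N <= n)%N -> (N <= m)%N -> E0 (un n \- un m) (un n \- un m) < eps.

Definition closable : Prop := forall un : nat -> H -> R,
  (forall n, Cb1 (un n)) -> form_Cauchy un -> L2_cvg un (fun=> 0) ->
  (fun n => E0 (un n) (un n)) @ \oo --> (0 : R).

Definition approximates (un : nat -> H -> R) (u : H -> R) : Prop :=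
  [/\ forall n, Cb1 (un n), form_Cauchy un & L2_cvg un u].

(* The domain D(E) of the closure, and the relation E(u, v) = a. *)
Definition dom (u : H -> R) : Prop :=
  L2 u /\ exists un, approximates un u.

Definition form_val (u v : H -> R) (a : R) : Prop :=
  [/\ dom u, dom v & exists un vn, [/\ approximates un u, approximates vn v &
    (fun n => E0 (un n) (vn n)) @ \oo --> a] ].

(* E-nests, E-exceptional sets, E-quasi-continuity (Ma-Roeckner); density is
   with respect to E_1(w, w)^(1/2). *)
Definition nest (Fk : nat -> set H) : Prop :=
  [/\ forall k, closed (Fk k) /\ Fk k `<=` F,
      forall k, Fk k `<=` Fk k.+1 &
      forall u, dom u -> forall eps : R, 0 < eps ->
        exists k v, [/\ dom v,
          {ae mu, forall x, (F `\` Fk k) x -> v x = 0} &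
          exists2 a, form_val (u \- v) (u \- v) a &
                     a + L2dot (u \- v) (u \- v) < eps] ].

Definition exceptional (N : set H) : Prop :=
  exists2 Fk, nest Fk & N `<=` F `\` \bigcup_k Fk k.

Definition quasi_continuous (f : H -> R) : Prop :=
  exists2 Fk, nest Fk & forall k, {within Fk k, continuous f}.

(* g = G_alpha f, i.e. E_alpha(g, v) = (f, v) for all v in D(E). *)
Definition form_resolvent (alpha : R) (f g : H -> R) : Prop :=
  dom g /\ forall v, dom v -> form_val g v (L2dot f v - alpha * L2dot g v).

(* T is the strongly continuous contraction semigroup of the form: its
   resolvent int_0^oo exp(- alpha t) T_t dt (in the weak sense) is G_alpha. *)
Record form_semigroup (T : R -> (H -> R) -> H -> R) : Prop := {
  fs_L2 : forall t f, 0 <= t -> L2 f -> L2 (T t f) ;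
  fs_lin : forall t (a : R) f g, 0 <= t -> L2 f -> L2 g ->
    {ae mu, forall x, F x ->
      T t (fun y => a * f y + g y) x = a * T t f x + T t g x} ;
  fs_contr : forall t f, 0 <= t -> L2 f ->
    L2dot (T t f) (T t f) <= L2dot f f ;
  fs_zero : forall f, L2 f -> {ae mu, forall x, F x -> T 0 f x = f x} ;
  fs_add : forall s t f, 0 <= s -> 0 <= t -> L2 f ->
    {ae mu, forall x, F x -> T (s + t) f x = T s (T t f) x} ;
  fs_cont : forall f, L2 f ->
    (fun t => L2dot (T t f \- f) (T t f \- f)) @ 0^'+ --> (0 : R) ;
  fs_res : forall alpha f, 0 < alpha -> L2 f ->
    exists2 g, form_resolvent alpha f g & forall h, L2 h ->
      L2dot g h = \int[lebesgue_measure]_(t in `[0, +oo[)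
                    (expR (- alpha * t) * L2dot (T t f) h) }.

End Form.
End Hilbert.

(* The measure dg of a nondecreasing right-continuous g on [0, +oo[ (no mass
   on ]-oo, 0]); the zero measure if g is not such a function. *)
Definition stieltjes {R : realType} (g : R -> R) :
    {measure set (measurableTypeR R) -> \bar R} :=
  match pselect (exists c : cumulative R R,
                   forall t : R, c t = g (Num.max t 0)) with
  | left h => lebesgue_stieltjes_measure (projT1 (cid h))
  | right _ => mzero
  end.

Section Process.
Context {R : realType} {H : completeNormedModType R}.
Context {d : measure_display} {W : measurableType d}.
Implicit Types (F : set H) (Mf : R -> set (set W)) (X : R -> W -> H).
Implicit Types (th : R -> W -> W) (P : H -> probability W R).

Record filtration Mf : Prop := {
  fl_sigma : forall t, 0 <= t -> sigma_algebra setT (Mf t) ;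
  fl_sub : forall t, 0 <= t -> Mf t `<=` measurable ;
  fl_incr : forall s t, 0 <= s -> s <= t -> Mf s `<=` Mf t ;
  fl_right : forall t, 0 <= t ->
    \bigcap_(s in [set s | t < s]) Mf s `<=` Mf t }.

Definition stopping_time Mf (tau : W -> \bar R) : Prop :=
  (forall w, (0 <= tau w)%E) /\
  forall t, 0 <= t -> Mf t [set w | (tau w <= t%:E)%E].

Definition stopped_sigma Mf (tau : W -> \bar R) : set (set W) :=
  [set C | measurable C /\
    forall t, 0 <= t -> Mf t (C `&` [set w | (tau w <= t%:E)%E])].

Definition universally_measurable F (f : H -> \bar R) : Prop :=
  forall m : probability (borel H) R, m F = 1%E ->
    exists2 g : borel H -> \bar R, measurable_fun [set: borel H] g &
      {ae m, forall x, F x -> f x = g x}.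

Definition adapted Mf d' (V : measurableType d') (t : R) (f : W -> V) : Prop :=
  forall B : set V, measurable B -> Mf t (f @^-1` B).

Definition natural_sigma X (J : set R) : set (set W) :=
  <<s [set S | exists s (B : set (borel H)),
         [/\ J s, measurable B & S = X s @^-1` B] ]>>.

(* The completion of sigma(X_s, s in J) with respect to the measures
   P_m = int P_z m(dz), m running over the probabilities on F. *)
Definition completed_sigma F X P (J : set R) : set (set W) :=
  [set S | measurable S /\
    forall m : probability (borel H) R, m F = 1%E ->
      exists S' Z, [/\ natural_sigma X J S',
        natural_sigma X `[0, +oo[ Z,
        (\int[m]_(z in F) P z Z = 0)%E &
        (S `\` S') `|` (S' `\` S) `<=` Z] ].

(* A strong Markov process with continuous paths and infinite life time on F;
   no cemetery is needed. The strong Markov property holds for every initial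
   law as soon as it holds for every P_z. *)
Record diffusion F Mf X th P : Prop := {
  df_filt : filtration Mf ;
  df_state : forall t w, 0 <= t -> F (X t w) ;
  df_adapted : forall t, 0 <= t -> adapted Mf t (X t : W -> borel H) ;
  df_shift : forall s t w, 0 <= s -> 0 <= t -> X s (th t w) = X (s + t) w ;
  df_umeas : forall S, measurable S ->
    universally_measurable F (fun z => P z S) ;
  df_meas : forall S, natural_sigma X `[0, +oo[ S ->
    measurable_fun (F : set (borel H)) (fun z : borel H => P z S) ;
  df_normal : forall z, F z -> {ae P z, forall w, X 0 w = z} ;
  df_right : forall t w, 0 <= t -> (fun s => X s w) @ t^'+ --> X t w ;
  df_markov : forall z (tau : W -> \bar R) C t (B : set (borel H)),
    F z -> stopping_time Mf tau -> stopped_sigma Mf tau C -> 0 <= t ->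
    measurable B ->
    (P z (C `&` [set w | tau w < +oo]
            `&` [set w | B (X (fine (tau w) + t)%R w)]) =
     \int[P z]_(w in C `&` [set w | tau w < +oo])
        P (X (fine (tau w)) w) (X t @^-1` B))%E ;
  df_cont : forall z, F z ->
    {ae P z, forall w, {within `[0, +oo[, continuous (fun t => X t w)}} }.

(* P_t f (z) = E_z[f(X_t)] *)
Definition transition X P (t : R) (f : H -> R) (z : H) : R :=
  \int[P z]_w f (X t w).

(* (Proper) association with the closure of E0: E_.[f(X_t)] is an
   E-quasi-continuous version of T_t f. *)
Definition associated (mu : probability (borel H) R) F
    (E0 : (H -> R) -> (H -> R) -> R) X P : Prop :=
  exists2 T, form_semigroup mu F E0 T &
    forall (t : R) (f : H -> R), 0 < t -> measurable_fun [set: borel H] f ->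
      (exists M : R, forall x, `|f x| <= M) ->
      quasi_continuous mu F E0 (transition X P t f) /\
      {ae mu, forall x, F x -> transition X P t f x = T t f x}.

(* Positive continuous additive functionals; Lam is the defining set and N0
   the exceptional set. *)
Definition pcaf (mu : probability (borel H) R) F
    (E0 : (H -> R) -> (H -> R) -> R) X th P (L : R -> W -> R) : Prop :=
  (forall t (B : set R), 0 <= t -> measurable B ->
     completed_sigma F X P `[0, t] (L t @^-1` B)) /\
  exists (N0 : set H) (Lam : set W),
    [/\ exceptional mu F E0 N0,
        completed_sigma F X P `[0, +oo[ Lam,
        forall z, (F `\` N0) z -> P z Lam = 1%E,
        forall t, 0 <= t -> th t @` Lam `<=` Lam &
        forall w, Lam w ->
          [/\ L 0 w = 0, forall t, 0 <= t -> 0 <= L t w,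
              {within `[0, +oo[, continuous (fun t => L t w)} &
              forall s t, 0 <= s -> 0 <= t ->
                L (t + s) w = L t w + L s (th t w)] ].

Definition revuz (mu : probability (borel H) R) F (G : set H) X P
    (L : R -> W -> R) (dG : {finite_measure set (borel H) -> \bar R}) : Prop :=
  forall f : H -> R, measurable_fun [set: borel H] f -> (forall x, 0 <= f x) ->
  ((fun t : R => (t^-1)%:E * \int[mu]_(x in F)
      ((\int[P x]_w
          \int[stieltjes (fun s => L s w)]_(s in `[0%R, t]) (f (X s w))%:E)
       * (\1_G x)%:E))
   @ 0^'+ --> \int[dG]_(x in F) (f x)%:E)%E.

(* Ws is an Mf-cylindrical Wiener process on the time interval J under Q: up to
   indistinguishability it is a family of Mf-adapted processes V_k with
   continuous paths, V_k(0) = 0, whose increments over [s, t] are jointly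
   independent of Mf_s and i.i.d. N(0, t - s). *)
Definition cylindrical_wiener (Q : probability W R) Mf (J : set R)
    (Ws : nat -> R -> W -> R) : Prop :=
  exists V : nat -> R -> W -> R,
  [/\ forall k t, J t -> adapted Mf t (V k t),
      {ae Q, forall w, forall k,
         V k 0 w = 0 /\ {within J, continuous (fun t => V k t w)}},
      forall s t n C (B : nat -> set R),
        J s -> J t -> s < t -> Mf s C -> (forall k, measurable (B k)) ->
        (Q (C `&` \bigcap_(k in [set k | (k < n)%N])
                    [set w | B k (V k t w - V k s w)%R]) =
         Q C * \prod_(k < n) normal_prob 0%R (Num.sqrt (t - s)%R) (B k))%E &
      {ae Q, forall w, forall k t, J t -> Ws k t w = V k t w} ].

(* phi = sum_(j < m) xi_j 1_]tau_j, tau_(j+1)], xi_j bounded and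
   Mf_(tau_j)-measurable. *)
Record simple_process := SimpleProcess {
  sp_size : nat ;
  sp_time : nat -> R ;
  sp_coef : nat -> W -> R }.

Definition simple_wf Mf (p : simple_process) : Prop :=
  [/\ 0 <= sp_time p 0, forall j, sp_time p j <= sp_time p j.+1,
      forall j, exists M : R, forall w, `|sp_coef p j w| <= M &
      forall j, adapted Mf (sp_time p j)
                  (sp_coef p j) ].

Definition simple_val (p : simple_process) (s : R) (w : W) : R :=
  \sum_(j < sp_size p)
    sp_coef p j w * (sp_time p j < s <= sp_time p j.+1)%R%:R.

Definition simple_int (p : simple_process) (V : R -> W -> R) (t : R) (w : W) :=
  \sum_(j < sp_size p) sp_coef p j w *
    (V (Num.min t (sp_time p j.+1)) w - V (Num.min t (sp_time p j)) w).

(* I is the Ito integral int_0^. phi dV on [0, T] (V a Brownian motion). *)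
Definition ito_integral (Q : probability W R) Mf (T : R)
    (phi : R -> W -> R) (V I : R -> W -> R) : Prop :=
  {ae Q, forall w, {within `[0, T], continuous (fun t => I t w)}} /\
  exists p : nat -> simple_process,
    [/\ forall n, simple_wf Mf (p n),
        (fun n => \int[Q]_w \int[lebesgue_measure]_(s in `[0%R, T])
           ((simple_val (p n) s w - phi s w) ^+ 2)%:E)%E @ \oo --> 0%E &
        forall t, 0 <= t <= T ->
          (fun n => \int[Q]_w ((simple_int (p n) V t w - I t w) ^+ 2)%:E)%E
          @ \oo --> 0%E ].

(* sum_k I_k = S uniformly on [0, T], Q-a.s. *)
Definition uniform_series (Q : probability W R) (T : R)
    (I : nat -> R -> W -> R) (S : R -> W -> R) : Prop :=
  {ae Q, forall w, forall eps : R, 0 < eps ->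
    \forall n \near \oo, forall t, 0 <= t <= T ->
      `|\sum_(k < n) I k t w - S t w| < eps}.

(* <S>_t = qv_t on [0, T]: limit in probability of the sums of squared
   increments along partitions whose mesh tends to 0. *)
Definition quadratic_variation (Q : probability W R) (T : R)
    (S qv : R -> W -> R) : Prop :=
  forall (t : R) (m : nat -> nat) (tau : nat -> nat -> R),
    0 <= t <= T ->
    (forall n, [/\ tau n 0 = 0, tau n (m n) = t &
                   forall j, tau n j <= tau n j.+1]) ->
    (forall eps : R, 0 < eps -> \forall n \near \oo,
       forall j, (j < m n)%N -> tau n j.+1 - tau n j < eps) ->
    forall eps : R, 0 < eps ->
      (fun n => Q [set w | eps <
         `|\sum_(j < m n) (S (tau n j.+1) w - S (tau n j) w) ^+ 2 - qv t w|])
      @ \oo --> 0%E.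

(* W^z_k(t); bnu stands for Abar^* nu_Gamma. *)
Definition noise (ip : H -> H -> R) (A : H -> H) (e : nat -> H)
    (beta bnu : H -> H) X (L : R -> W -> R) (z : H) (k : nat) (t : R) (w : W)
    : R :=
  ip (e k) (X t w - z)
  - \int[lebesgue_measure]_(s in `[0, t]) ip (e k) (beta (X s w))
  + \int[lebesgue_measure]_(s in `[0, t]) ip (A (e k)) (X s w)
  - 1 / 2 * \int[stieltjes (fun s => L s w)]_(s in `[0, t])
              ip (e k) (bnu (X s w)).

(* W~^z_k(t) *)
Definition shifted_noise (ip : H -> H -> R) (A : H -> H) (e : nat -> H)
    (beta B bnu : H -> H) X (L : R -> W -> R) (z : H) (k : nat) (t : R) (w : W)
    : R :=
  noise ip A e beta bnu X L z k t w
  - \int[lebesgue_measure]_(s in `[0, t]) ip (e k) (B (X s w) - beta (X s w)).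

Definition energy (beta B : H -> H) X (t : R) (w : W) : R :=
  \int[lebesgue_measure]_(s in `[0, t]) `|B (X s w) - beta (X s w)| ^+ 2.

(* The Girsanov transformation from a starting point z: Z is Z^z and Pt is
   P~_z. *)
Record girsanov (mu : probability (borel H) R) (G : set H)
    (ip : H -> H -> R) (A : H -> H) (e : nat -> H) (beta B bnu : H -> H)
    Mf X (L : R -> W -> R) (T : R) (z : H) (Pz : probability W R)
    (Z : R -> W -> R) (Pt : probability W R) : Prop := {
  gi_wiener :
    cylindrical_wiener Pz Mf `[0, +oo[ (noise ip A e beta bnu X L z) ;
  gi_bound : {ae Pz, forall w,
    (\int[lebesgue_measure]_(s in `[0%R, T]) (`|B (X s w)| ^+ 2)%:E
     <= T%:E * Linfty_norm mu G B ^+ 2)%E} ;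
  gi_meas : forall t, 0 <= t <= T -> measurable_fun setT (Z t) ;
  gi_Z : exists2 I : nat -> R -> W -> R,
    forall k, ito_integral Pz Mf T
      (fun s w => ip (e k) (B (X s w) - beta (X s w)))
      (noise ip A e beta bnu X L z k) (I k) &
    uniform_series Pz T I Z ;
  gi_qv : quadratic_variation Pz T Z (energy beta B X) ;
  gi_density : forall S, measurable S ->
    Pt S = (\int[Pz]_(w in S)
              (expR (Z T w - 1 / 2 * energy beta B X T w))%:E)%E ;
  gi_tilde : cylindrical_wiener Pt Mf `[0, T]
    (shifted_noise ip A e beta B bnu X L z) }.

End Process.

(* Main.v *)
(* The Ito integral is recovered coordinatewise: off an exceptional set the
   coordinate equations defining the shifted noises are summed against <l, e_k>,
   and the series converges uniformly because a path stays in the bounded set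
   Gamma, B is square integrable along it, and the reflection field is bounded
   for the measure dL. The last point, and the second assertion, say that dL
   charges no time at which the path is in S, the complement of the set of
   boundary points where |eta| = 1.

   This holds almost surely off an exceptional set. Let A_t be the dL-mass of the
   times s <= t with X_s in S. Since the antisymmetric part of the form does not
   see constants, mu restricted to F is invariant, so the truncation Y of A
   satisfies E_mu[Y_t] <= 2^k E_mu[Y_(t/2^k)], and the Revuz formula with
   ||d Gamma||(S) = 0 makes the right-hand side vanish as k tends to infinity.
   Hence mu-almost every starting point is good. After a short time the probability
   of being bad is a quasi-continuous function of the starting point that vanishes
   almost everywhere, hence off an exceptional set. Nests of the two forms are compared
   through a capacity, which only depends on the common diagonal of the forms. *)

Require Import Defs.
From HB Require Import structures.
From mathcomp Require Import all_boot all_order all_algebra.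
From mathcomp Require Import all_classical all_reals all_analysis.
From mathcomp Require Import measurable_realfun ess_sup_inf giry.
From mathcomp Require Import ring lra.

Set Implicit Arguments.
Unset Strict Implicit.
Unset Printing Implicit Defensive.

Import Order.TTheory GRing.Theory Num.Theory.
Import numFieldNormedType.Exports.

Local Open Scope classical_set_scope.
Local Open Scope ring_scope.

(** Two gaps in regularity shape the proof. The core [Cb1] is not stable under truncation, so the
    unit contraction of Dirichlet form theory is replaced by the C^{1,1} cutoff [chi], whose
    Lipschitz derivative lets it act on form Cauchy sequences; squared norms are compared by
    inequalities with a free weight [l] instead of through square roots. On the probabilistic side,
    [z |-> P z S] is Borel only for events of the natural filtration, while the local time is
    measurable only for a completion of it. Hence the Markov property is needed for all natural
    events, the laws [P z] are mixed over [mu] on [F] into one measure [q], and the occupation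
    functional is replaced by a measurable minorant that agrees with it outside a [q]-null set.
    Finally, nothing bounds [beta] along a path: the pathwise integrability of [B - beta] is read
    off from the existence of the Ito integrals. *)

(** * A cutoff with Lipschitz derivative *)

Section Cutoff.
Context {R : realType}.
Implicit Types x y s : R.

(* A C^{1,1} cutoff: 0 on ]-oo, 0] and 1 on [1, +oo[. *)
Definition chi s : R :=
  2 * (Num.max s 0 ^+ 2 - 2 * Num.max (s - 2^-1) 0 ^+ 2 + Num.max (s - 1) 0 ^+ 2).

Definition dchi s : R :=
  4 * (Num.max s 0 - 2 * Num.max (s - 2^-1) 0 + Num.max (s - 1) 0).

(** The square of the positive part is the building block of [chi]: its derivative is 2-Lipschitz.
    The constants 8 and 16 below are 2 (1 + 2 + 1) and 4 (1 + 2 + 1), from the coefficients of the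
    three translates. *)
Lemma sqr_max_taylor x y :
  `|Num.max y 0 ^+ 2 - Num.max x 0 ^+ 2 - 2 * Num.max x 0 * (y - x)| <= (y - x) ^+ 2.
Proof.
have s0 := sqr_ge0 (y - x); have sx := sqr_ge0 x; have sy := sqr_ge0 y.
rewrite ler_norml; case: (ltP x 0) => hx; case: (ltP y 0) => hy; apply/andP; split; nra.
Qed.

Lemma chi_taylor x y : `|chi y - chi x - dchi x * (y - x)| <= 8 * (y - x) ^+ 2.
Proof.
have h0 := sqr_max_taylor x y.
have := sqr_max_taylor (x - 2^-1) (y - 2^-1); have := sqr_max_taylor (x - 1) (y - 1).
have -> : y - 1 - (x - 1) = y - x by ring.
have -> : y - 2^-1 - (x - 2^-1) = y - x by ring.
rewrite /chi /dchi; move: h0; rewrite !ler_norml => /andP[? ?] /andP[? ?] /andP[? ?].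
by apply/andP; split; lra.
Qed.

Lemma max_lip x y : `|Num.max x 0 - Num.max y 0| <= `|x - y|.
Proof.
rewrite ler_norml; have := ler_norm (x - y); have := ler_norm (y - x).
by rewrite distrC; case: (ltP x 0); case: (ltP y 0) => *; apply/andP; split; lra.
Qed.

Lemma dchi_lip x y : `|dchi x - dchi y| <= 16 * `|x - y|.
Proof.
have h0 := max_lip x y.
have := max_lip (x - 2^-1) (y - 2^-1); have := max_lip (x - 1) (y - 1).
have -> : x - 1 - (y - 1) = x - y by ring.
have -> : x - 2^-1 - (y - 2^-1) = x - y by ring.
rewrite /dchi; move: h0; set d := `|x - y|; rewrite !ler_norml => /andP[? ?] /andP[? ?] /andP[? ?].
by apply/andP; split; lra.
Qed.

Lemma dchi_bound x : `|dchi x| <= 2.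
Proof.
rewrite /dchi ler_norml.
by case: (ltP x 0); case: (ltP (x - 2^-1) 0); case: (ltP (x - 1) 0) => *; apply/andP; split; lra.
Qed.

Lemma chi_ge0 x : 0 <= chi x.
Proof.
rewrite /chi.
by case: (ltP x 0); case: (ltP (x - 2^-1) 0); case: (ltP (x - 1) 0) => *; nra.
Qed.

Lemma chi0 : chi 0 = 0.
Proof.
rewrite /chi.
by case: (ltP (0 : R) 0); case: (ltP (0 - 2^-1 : R) 0); case: (ltP (0 - 1 : R) 0) => *; nra.
Qed.

Lemma chi1 x : 1 <= x -> chi x = 1.
Proof.
rewrite /chi.
by case: (ltP x 0); case: (ltP (x - 2^-1) 0); case: (ltP (x - 1) 0) => *; nra.
Qed.

Lemma chi_incr x y : x <= y -> 0 <= chi y - chi x <= 2 * (y - x).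
Proof.
rewrite /chi => xy; case: (ltP x 0); case: (ltP (x - 2^-1) 0); case: (ltP (x - 1) 0);
 case: (ltP y 0); case: (ltP (y - 2^-1) 0); case: (ltP (y - 1) 0) => *;
  first [by exfalso; lra | apply/andP; split; nra].
Qed.

Lemma chi_lip x y : `|chi x - chi y| <= 2 * `|x - y|.
Proof.
wlog xy : x y / x <= y.
  by move=> h; have [/h //|/ltW/h] := leP x y; rewrite distrC (distrC y).
rewrite distrC (distrC x); have /andP[h1 h2] := chi_incr xy.
by rewrite (ger0_norm h1) ger0_norm ?subr_ge0.
Qed.

Lemma chi_bound x : `|chi x| <= 2 * `|x|.
Proof. by have := chi_lip x 0; rewrite chi0 !subr0. Qed.

End Cutoff.

(** * Hilbert space preliminaries *)

Lemma norm_cauchy_cvgn {R : realType} {V : completeNormedModType R} (u : nat -> V) :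
  (forall eps, 0 < eps -> exists N, forall n, (N <= n)%N -> `|u n - u N| < eps) ->
  cvgn u.
Proof.
move=> h; apply/cauchy_cvgP/cauchy_exP => eps e0.
have [N hN] := h _ e0; exists (u N); exists N => // n /= Nn.
by rewrite -ball_normE /ball_ /= distrC; exact: hN.
Qed.

Section InnerProduct.
Context {R : realType} {H : completeNormedModType R} {ip : H -> H -> R}.
Hypothesis hip : inner_product ip.

Lemma ipC x y : ip x y = ip y x.
Proof. exact: (ip_sym hip). Qed.

Lemma ipE x : ip x x = `|x| ^+ 2.
Proof. exact: (ip_norm hip). Qed.

Lemma ip0l y : ip 0 y = 0.
Proof.
by have := ip_lin hip 1 0 0 y; rewrite scale1r addr0 mul1r; lra.
Qed.

Lemma ipDl x y z : ip (x + y) z = ip x z + ip y z.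
Proof. by have := ip_lin hip 1 x y z; rewrite scale1r mul1r. Qed.

Lemma ipZl (a : R) x z : ip (a *: x) z = a * ip x z.
Proof. by have := ip_lin hip a x 0 z; rewrite addr0 ip0l addr0. Qed.

Lemma ipNl x z : ip (- x) z = - ip x z.
Proof. by rewrite -scaleN1r ipZl mulN1r. Qed.

Lemma ipBl x y z : ip (x - y) z = ip x z - ip y z.
Proof. by rewrite ipDl ipNl. Qed.

Lemma ip0r y : ip y 0 = 0. Proof. by rewrite ipC ip0l. Qed.

Lemma ipDr x y z : ip z (x + y) = ip z x + ip z y.
Proof. by rewrite ipC ipDl !(ipC z). Qed.

Lemma ipZr (a : R) x z : ip z (a *: x) = a * ip z x.
Proof. by rewrite ipC ipZl (ipC z). Qed.

Lemma ipNr x z : ip z (- x) = - ip z x.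
Proof. by rewrite ipC ipNl (ipC z). Qed.

Lemma ipBr x y z : ip z (x - y) = ip z x - ip z y.
Proof. by rewrite ipDr ipNr. Qed.

Lemma ip_suml I r (P : pred I) (F : I -> H) z :
  ip (\sum_(i <- r | P i) F i) z = \sum_(i <- r | P i) ip (F i) z.
Proof.
by elim/big_rec2: _ => [|i _ y _ <-]; rewrite ?ip0l ?ipDl.
Qed.

Lemma ip_sumr I r (P : pred I) (F : I -> H) z :
  ip z (\sum_(i <- r | P i) F i) = \sum_(i <- r | P i) ip z (F i).
Proof. by rewrite ipC ip_suml; apply: eq_bigr => i _; rewrite ipC. Qed.

Lemma ip_eq x y : (forall z, ip x z = ip y z) -> x = y.
Proof.
move=> h; apply/eqP; rewrite -subr_eq0 -normr_eq0 -sqrf_eq0 -ipE.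
by rewrite ipBl h subrr.
Qed.

Lemma cauchy_schwarz x y : `|ip x y| <= `|x| * `|y|.
Proof.
have [->|y0] := eqVneq y 0; first by rewrite ip0r !normr0 mulr0.
have ny : 0 < `|y| by rewrite normr_gt0.
have : 0 <= ip (`|y| ^+ 2 *: x - ip x y *: y) (`|y| ^+ 2 *: x - ip x y *: y).
  by rewrite ipE sqr_ge0.
rewrite !ipBl !ipBr !ipZl !ipZr !ipE (ipC y x) => h.
have : 0 <= `|y| ^+ 2 * ((`|x| * `|y|) ^+ 2 - ip x y ^+ 2).
  by rewrite (le_trans h) // le_eqVlt; apply/orP; left; apply/eqP; ring.
rewrite pmulr_rge0 ?exprn_gt0 // subr_ge0 -(real_normK (num_real (ip x y))).
by rewrite ler_pXn2r // nnegrE // mulr_ge0.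
Qed.

Lemma ip_cvg_to (T : Type) (F : set_system T) (FF : Filter F) (u : T -> H) x y :
  u @ F --> x -> (fun t => ip (u t) y) @ F --> ip x y.
Proof.
move=> /cvgrPdist_lt ux; apply/cvgrPdist_lt => eps e0.
have y1 : 0 < `|y| + 1 by rewrite ltr_wpDl.
have := ux (eps / (`|y| + 1)) (divr_gt0 e0 y1); apply: filterS => t ht.
rewrite -ipBl (le_lt_trans (cauchy_schwarz _ _)) //.
rewrite (@le_lt_trans _ _ (`|x - u t| * (`|y| + 1))) //.
  by rewrite ler_wpM2l // lerDl.
by rewrite -ltr_pdivlMr.
Qed.

Lemma ip_continuous y : continuous (fun x => ip x y).
Proof. by move=> x; apply: ip_cvg_to; apply: cvg_id. Qed.

Section Basis.
Context {e : nat -> H}.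
Hypothesis he : orthonormal_basis ip e.

Definition trunc (n : nat) (x : H) : H := \sum_(i < n) ip x (e i) *: e i.

Lemma ip_basis i j : ip (e i) (e j) = (i == j)%:R.
Proof. exact: he.1. Qed.

Lemma cvg_trunc x : trunc ^~ x @ \oo --> x.
Proof. exact: he.2. Qed.

Lemma ip_trunc n x y : ip (trunc n x) y = \sum_(i < n) ip x (e i) * ip y (e i).
Proof. by rewrite ip_suml; apply: eq_bigr => i _; rewrite ipZl (ipC (e i)). Qed.

Lemma norm_trunc n (c : nat -> R) :
  `|\sum_(i < n) c i *: e i| ^+ 2 = \sum_(i < n) c i ^+ 2.
Proof.
rewrite -ipE ip_suml; apply: eq_bigr => i _; rewrite ip_sumr (bigD1 i) //=.
rewrite big1 ?addr0 => [|j ji]; rewrite ipZl ipZr ip_basis.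
  by rewrite eqxx mulr1 expr2.
by rewrite eq_sym (negPf ji : (j == i :> nat) = false) !mulr0.
Qed.

Lemma parseval x y :
  (fun n => \sum_(i < n) ip x (e i) * ip y (e i)) @ \oo --> ip x y.
Proof.
under eq_fun do rewrite -ip_trunc.
by apply: ip_cvg_to; exact: cvg_trunc.
Qed.

Lemma parseval_norm x : (fun n => \sum_(i < n) ip x (e i) ^+ 2) @ \oo --> `|x| ^+ 2.
Proof.
rewrite -ipE; under eq_fun do under eq_bigr do rewrite expr2.
exact: parseval.
Qed.

Lemma norm_basis i : `|e i| = 1.
Proof.
have /eqP := ipE (e i); rewrite ip_basis eqxx eq_sym sqrf_eq1.
by case/orP => /eqP // h; have := normr_ge0 (e i); rewrite h; lra.
Qed.

(** The candidate is the sum of [f (e i) *: e i]. On its partial sums [f] takes the value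
    [|g n| ^+ 2], so the bound on [f] gives [|g n| <= M]. *)
Lemma riesz (f : {linear H -> R}) (M : R) : (forall x, `|f x| <= M * `|x|) ->
  exists g, forall x, f x = ip g x.
Proof.
move=> fM.
pose c i := f (e i); pose g n := \sum_(i < n) c i *: e i.
have fg n : f (g n) = `|g n| ^+ 2.
  rewrite norm_trunc linear_sum; apply: eq_bigr => i _.
  by rewrite linearZ /= -/(c i) expr2.
have M0 : 0 <= M.
  by have := fM (e 0%N); rewrite norm_basis mulr1; apply: le_trans.
have gM n : `|g n| ^+ 2 <= M ^+ 2.
  rewrite ler_pXn2r ?nnegrE //.
  have [->|gn0] := eqVneq (g n) 0; first by rewrite normr0.
  rewrite -(@ler_pM2r _ `|g n|) ?normr_gt0 // -expr2 -fg.
  by rewrite (le_trans _ (fM (g n))) // ler_norm.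
pose s n := \sum_(i < n) c i ^+ 2.
have sE n : s n = `|g n| ^+ 2 by rewrite norm_trunc.
have snd : nondecreasing_seq s.
  by apply/nondecreasing_seqP => n; rewrite /s big_ord_recr /= lerDl sqr_ge0.
have scvg : cvgn s.
  apply: nondecreasing_is_cvgn => //; exists (M ^+ 2) => _ [n _ <-].
  by rewrite sE.
(* Squared increments of [g] are increments of the bounded monotone sequence [s]; this makes [g]
   Cauchy. *)
have gB n k : `|g (n + k)%N - g n| ^+ 2 = s (n + k)%N - s n.
  have -> : g (n + k)%N - g n = \sum_(i < n + k) (if (i < n)%N then 0 else c i) *: e i.
    rewrite /g big_split_ord [in RHS]big_split_ord /=.
    rewrite [in LHS]addrAC subrr add0r [X in _ = X + _]big1 ?add0r.
      by apply: eq_bigr => i _; rewrite ltnNge leq_addr.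
    by move=> i _; rewrite ltn_ord scale0r.
  rewrite (norm_trunc (n + k) (fun i => if (i < n)%N then 0 else c i)).
  rewrite /s !big_split_ord /= [RHS]addrAC subrr add0r [X in X + _ = _]big1 ?add0r.
    by apply: eq_bigr => i _; rewrite ltnNge leq_addr.
  by move=> i _; rewrite ltn_ord expr0n.
have gcvg : cvgn g.
  apply: norm_cauchy_cvgn => eps e0.
  have e2 : 0 < eps ^+ 2 by rewrite exprn_gt0.
  have /cvgrPdist_lt /(_ (eps ^+ 2 / 4)) := scvg.
  case; first by rewrite divr_gt0.
  move=> N _ hN; exists N => k Nk.
  rewrite -(@ltr_pXn2r _ 2) ?nnegrE ?(ltW e0) ?normr_ge0 //.
  rewrite -(subnKC Nk) gB subnKC //.
  have := hN k Nk; have := hN N (leqnn _) => /= h1 h2.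
  have : `|s k - s N| < eps ^+ 2.
    have -> : s k - s N = (limn s - s N) - (limn s - s k) by ring.
    by rewrite (le_lt_trans (ler_normB _ _)) //; lra.
  exact: le_lt_trans (ler_norm _).
exists (limn g); move=> x.
have h1 : (fun n => ip (g n) x) @ \oo --> ip (limn g) x by exact: ip_cvg_to.
have gx n : ip (g n) x = f (trunc n x).
  rewrite ip_suml linear_sum; apply: eq_bigr => i _.
  by rewrite ipZl linearZ /= (ipC (e i)) mulrC.
have h2 : (fun n => ip (g n) x) @ \oo --> f x.
  under eq_fun do rewrite gx.
  apply/cvgrPdist_lt => eps e0.
  have M1 : 0 < M + 1 by rewrite ltr_wpDl.
  have /cvgrPdist_lt /(_ (eps / (M + 1)) (divr_gt0 e0 M1)) := @cvg_trunc x.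
  apply: filterS => n hn; rewrite -linearB (le_lt_trans (fM _)) //.
  rewrite (@le_lt_trans _ _ ((M + 1) * `|x - trunc n x|)) //.
    by rewrite ler_wpM2r // lerDl.
  by rewrite mulrC -ltr_pdivlMr.
exact: (cvg_unique _ h2 h1).
Qed.

End Basis.
End InnerProduct.

Arguments cvg_trunc {R H ip e} he x : rename.
Arguments parseval {R H ip} hip {e} he x y : rename.
Arguments parseval_norm {R H ip} hip {e} he x : rename.

(** * Calculus and measurability of gradients *)

Section Gradient.
Context {R : realType} {H : completeNormedModType R} {ip : H -> H -> R} {e : nat -> H}.
Hypotheses (hip : inner_product ip) (he : orthonormal_basis ip e).
Implicit Types u v : H -> R.

Lemma Cb1_diff u x : Cb1 u -> differentiable u x. Proof. by case. Qed.

Lemma Cb1_continuous u : Cb1 u -> continuous u.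
Proof. by case=> _ du _ x; exact: differentiable_continuous. Qed.

Lemma gradE u (x h : H) : Cb1 u -> 'd u x h = ip (grad ip u x) h.
Proof.
case=> _ du [M hM].
have [g hg] := riesz hip he (hM x).
have : [set g | forall h, 'd u x h = ip g h] (grad ip u x) by apply: (@xgetPex _ 0); exists g.
exact.
Qed.

Lemma grad_unique u x g : (forall h : H, 'd u x h = ip g h) -> grad ip u x = g.
Proof.
move=> hg; apply: (ip_eq hip) => z; rewrite -hg.
have : [set g | forall h, 'd u x h = ip g h] (grad ip u x) by apply: (@xgetPex _ 0); exists g.
by move=> /(_ z) <-.
Qed.

(** The bound on the differential is tested on the gradient itself, then divided by its norm. *)
Lemma grad_bound u : Cb1 u -> exists2 M, 0 <= M & forall x, `|grad ip u x| <= M.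
Proof.
move=> hu; have [_ du [M hM]] := hu.
have hg x : `|grad ip u x| ^+ 2 <= M * `|grad ip u x|.
  by rewrite -(ipE hip) -gradE // (le_trans _ (hM x _)) // ler_norm.
have hgM x : `|grad ip u x| <= Num.max M 0.
  have [->|g0] := eqVneq (grad ip u x) 0; first by rewrite normr0 le_max lexx orbT.
  have := hg x; rewrite expr2 ler_pM2r ?normr_gt0 // => h.
  by rewrite le_max h.
by exists (Num.max M 0) => //; rewrite le_max lexx orbT.
Qed.

Lemma Cb1_cst (c : R) : Cb1 (fun _ : H => c).
Proof.
split; first by exists `|c|.
  by move=> x; exact: differentiable_cst.
by exists 0 => x h; rewrite (diff_cst c x) mul0r normr0.
Qed.

Lemma grad_cst (c : R) x : grad ip (fun _ : H => c) x = 0.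
Proof. by apply: grad_unique => h; rewrite (diff_cst c x) (ip0l hip). Qed.

Lemma Cb1D u v : Cb1 u -> Cb1 v -> Cb1 (fun x => u x + v x).
Proof.
move=> [[M1 h1] du [M2 h2]] [[N1 k1] dv [N2 k2]]; split.
- exists (M1 + N1) => x; by rewrite (le_trans (ler_normD _ _)) // lerD.
- by move=> x; exact: differentiableD.
- exists (M2 + N2) => x h; rewrite (diffD (du x) (dv x)) /=.
  by rewrite (le_trans (ler_normD _ _)) // mulrDl lerD.
Qed.

Lemma gradD u v x : Cb1 u -> Cb1 v ->
  grad ip (fun x => u x + v x) x = grad ip u x + grad ip v x.
Proof.
move=> hu hv; apply: grad_unique => h; rewrite (ipDl hip).
have E := diffD (Cb1_diff x hu) (Cb1_diff x hv).
apply: (etrans (congr1 (fun F : H -> R => F h) E)).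
exact: (f_equal2 (fun a b : R => a + b) (gradE x h hu) (gradE x h hv)).
Qed.

Lemma Cb1M u v : Cb1 u -> Cb1 v -> Cb1 (fun x => u x * v x).
Proof.
move=> [[M1 h1] du [M2 h2]] [[N1 k1] dv [N2 k2]].
have du' x : differentiable u x by []. have dv' x : differentiable v x by [].
split.
- exists (M1 * N1) => x; by rewrite normrM ler_pM.
- by move=> x; exact: differentiableM.
- exists (M1 * N2 + N1 * M2) => x h; rewrite (diffM (du x) (dv x)) /=.
  rewrite (le_trans (ler_normD _ _)) // mulrDl lerD // normrM -mulrA ler_pM //.
Qed.

Lemma gradM u v x : Cb1 u -> Cb1 v ->
  grad ip (fun x => u x * v x) x = u x *: grad ip v x + v x *: grad ip u x.
Proof.
move=> hu hv; apply: grad_unique => h.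
move: (gradE x h hu) (gradE x h hv) => /=.
move: (grad ip u x) (grad ip v x) => gu gv hgu hgv.
rewrite (ipDl hip) !(ipZl hip).
have E := diffM (Cb1_diff x hu) (Cb1_diff x hv).
apply: (etrans (congr1 (fun F : H -> R => F h) E)).
exact: (f_equal2 (fun a b : R => u x * a + v x * b) hgv hgu).
Qed.

Lemma Cb1Z (c : R) u : Cb1 u -> Cb1 (fun x => c * u x).
Proof. by move=> hu; exact: (Cb1M (Cb1_cst c)). Qed.

Lemma gradZ (c : R) u x : Cb1 u -> grad ip (fun x => c * u x) x = c *: grad ip u x.
Proof.
by move=> hu; rewrite (gradM x (Cb1_cst c) hu) grad_cst scaler0 addr0.
Qed.

Lemma Cb1B u v : Cb1 u -> Cb1 v -> Cb1 (fun x => u x - v x).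
Proof.
move=> hu hv; under eq_fun do rewrite -(mulN1r (v _)).
exact: (Cb1D hu (Cb1Z (-1) hv)).
Qed.

Lemma gradB u v x : Cb1 u -> Cb1 v ->
  grad ip (fun x => u x - v x) x = grad ip u x - grad ip v x.
Proof.
move=> hu hv; under eq_fun do rewrite -(mulN1r (v _)).
by rewrite (gradD x hu (Cb1Z (-1) hv)) (gradZ (-1) x hv) scaleN1r.
Qed.

Lemma Cb1_sum (I : Type) (r : seq I) (F : I -> H -> R) :
  (forall i, Cb1 (F i)) -> Cb1 (fun x => \sum_(i <- r) F i x).
Proof.
move=> h; elim: r => [|i r ih].
  by under eq_fun do rewrite big_nil; exact: (Cb1_cst 0).
by under eq_fun do rewrite big_cons; exact: (Cb1D (h i) ih).
Qed.

Lemma is_derive_taylor (f : R -> R) (x l C : R) :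
  (forall y, `|f y - f x - l * (y - x)| <= C * (y - x) ^+ 2) -> is_derive x 1 f l.
Proof.
move=> h.
suff hc : h^-1 *: ((f \o shift x) (h *: 1) - f x) @[h --> 0^'] --> l.
  by apply: DeriveDef; [apply/cvg_ex; exists l | exact/cvg_lim].
apply/cvgrPdist_lt => eps e0.
have C1 : 0 < `|C| + 1 by rewrite ltr_wpDl.
near=> t.
have t0 : t != 0 by near: t; exact: nbhs_dnbhs_neq.
have te : `|t| < eps / (`|C| + 1).
  by near: t; apply: dnbhs0_lt; rewrite divr_gt0.
rewrite /= /shift /= [_ *: 1]mulr1 distrC.
have := h (t + x); rewrite addrK => ht.
rewrite -(@ltr_pM2r _ `|t|) ?normr_gt0 // -normrM mulrBl.
rewrite [_ *: _]mulrC -mulrA mulVf // mulr1 (le_lt_trans ht) //.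
rewrite -real_normK ?num_real // expr2 mulrA ltr_pM2r ?normr_gt0 //.
rewrite ltr_pdivlMr // in te.
rewrite (le_lt_trans _ te) // [leRHS]mulrC ler_wpM2r //.
by rewrite (le_trans (ler_norm C)) // lerDl.
Unshelve. all: by end_near. Qed.

Lemma diff_chi (s : R) : differentiable (chi : R -> R) s /\ forall t, 'd (chi : R -> R) s t = dchi s * t.
Proof.
have [d1 d2] := is_derive_taylor (chi_taylor s).
have ds : differentiable (chi : R -> R) s by exact/derivable1_diffP.
split=> // t.
have -> : t = t *: (1 : R) by rewrite /GRing.scale /= mulr1.
by rewrite linearZ /= -deriveE // d2 /GRing.scale /= mulr1 mulrC.
Qed.

Lemma Cb1_chi u : Cb1 u -> Cb1 (fun x => chi (u x)).
Proof.
move=> [[M1 h1] du [M2 h2]]; split.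
- exists (2 * M1) => x; by rewrite (le_trans (chi_bound _)) // ler_pM2l.
- by move=> x; apply: (differentiable_comp (du x)); exact: (diff_chi _).1.
- exists (2 * M2) => x h.
  rewrite (diff_comp (du x) (diff_chi (u x)).1) /= (diff_chi (u x)).2 normrM -mulrA.
  by rewrite ler_pM // dchi_bound.
Qed.

Lemma grad_chi u x : Cb1 u ->
  grad ip (fun x => chi (u x)) x = dchi (u x) *: grad ip u x.
Proof.
move=> hu; apply: grad_unique => h; rewrite (ipZl hip).
have E := diff_comp (Cb1_diff x hu) (diff_chi (u x)).1.
apply: (etrans (congr1 (fun F : H -> R => F h) E)).
apply: (etrans ((diff_chi (u x)).2 _)).
exact: (congr1 (fun a : R => dchi (u x) * a) (gradE x h hu)).
Qed.

Lemma measurable_continuous (f : H -> R) : continuous f ->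
  measurable_fun [set: borel H] f.
Proof.
move=> /continuousP cf; apply: (measurability _ (RGenOpens.measurableE R)).
move=> _ [_ [a [b ->] <-]]; rewrite setTI; apply: sub_sigma_algebra.
exact/cf/interval_open.
Qed.

(** [Cb1] does not ask the derivative to be continuous, so measurability of the gradient has to come
    from these continuous difference quotients. *)
Lemma diff_quotient_cvg u (x h : H) : Cb1 u ->
  (fun n => n.+1%:R * (u (n.+1%:R^-1 *: h + x) - u x)) @ \oo --> ip (grad ip u x) h.
Proof.
move=> hu; rewrite -gradE // -deriveE; last exact: Cb1_diff.
have hd : h0^-1 *: ((u \o shift x) (h0 *: h) - u x) @[h0 --> 0^'] --> 'D_h u x.
  by apply: diff_derivable; exact: Cb1_diff.
have hs : (fun n => n.+1%:R^-1 : R) @ \oo --> 0^'.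
  move=> A; rewrite /nbhs /= /dnbhs /within /= => hA.
  have [N _ hN] := cvg_harmonic hA; exists N => // n Nn; apply: (hN n Nn).
  by rewrite /= invr_eq0.
have := cvg_comp _ _ hs hd.
apply: cvg_trans; apply: near_eq_cvg; apply: nearW => n.
by rewrite /= invrK.
Qed.

Lemma measurable_Cb1 u : Cb1 u -> measurable_fun [set: borel H] u.
Proof. by move=> hu; apply: measurable_continuous; exact: Cb1_continuous. Qed.

Lemma measurable_partial u (h : H) : Cb1 u ->
  measurable_fun [set: borel H] (fun x => ip (grad ip u x) h).
Proof.
move=> hu.
apply: (@measurable_fun_cvg _ (borel H) _ setT
  (fun n (x : H) => n.+1%:R * (u (n.+1%:R^-1 *: h + x) - u x))).
  move=> n; apply: measurable_continuous => x.
  apply: cvgM; first exact: cvg_cst.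
  apply: cvgB; last exact: Cb1_continuous.
  apply: (@cvg_comp _ _ _ (fun x => n.+1%:R^-1 *: h + x) u _
    (nbhs (n.+1%:R^-1 *: h + x))); last exact: Cb1_continuous.
  by apply: cvgD; [exact: cvg_cst | exact: cvg_id].
by move=> x _; exact: (@diff_quotient_cvg u x h hu).
Qed.

Lemma measurable_grad_ip u v : Cb1 u -> Cb1 v ->
  measurable_fun [set: borel H] (fun x => ip (grad ip u x) (grad ip v x)).
Proof.
move=> hu hv; apply: (@measurable_fun_cvg _ (borel H) _ setT
  (fun n x => \sum_(i < n) ip (grad ip u x) (e i) * ip (grad ip v x) (e i))).
  move=> n; apply: measurable_sum => i.
  apply: measurable_funM; exact: measurable_partial.
by move=> x _; exact: (parseval hip he).
Qed.

End Gradient.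

(** * Quadratic forms and their closures *)

Section BoundedIntegrals.
Context {d : measure_display} {T : measurableType d} {R : realType}.
Variable mu : {finite_measure set T -> \bar R}.

Definition bounded_mfun (f : T -> R) : Prop :=
  measurable_fun [set: T] f /\ exists M : R, forall x, `|f x| <= M.

Lemma bmfun_integrable D f : measurable D -> bounded_mfun f ->
  mu.-integrable D (EFin \o f).
Proof.
move=> mD [mf [M hM]]; apply: measurable_bounded_integrable => //.
- by rewrite ltey_eq fin_num_measure.
- exact: measurable_funS mf.
- exists M; split; first exact: num_real.
  by move=> x Mx y _ /=; rewrite (le_trans (hM y)) // ltW.
Qed.

Lemma bmfun_cst (c : R) : bounded_mfun (fun=> c).
Proof. by split; [exact: measurable_cst | exists `|c|]. Qed.

Lemma bmfunD f g : bounded_mfun f -> bounded_mfun g -> bounded_mfun (fun x => f x + g x).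
Proof.
move=> [mf [M hM]] [mg [N hN]]; split; first exact: measurable_funD.
by exists (M + N) => x; rewrite (le_trans (ler_normD _ _)) // lerD.
Qed.

Lemma bmfunM f g : bounded_mfun f -> bounded_mfun g -> bounded_mfun (fun x => f x * g x).
Proof.
move=> [mf [M hM]] [mg [N hN]]; split; first exact: measurable_funM.
by exists (M * N) => x; rewrite normrM ler_pM.
Qed.

Lemma bmfunZ (c : R) f : bounded_mfun f -> bounded_mfun (fun x => c * f x).
Proof. exact: bmfunM (bmfun_cst c). Qed.

Lemma bmfunX2 f : bounded_mfun f -> bounded_mfun (fun x => f x ^+ 2).
Proof. by move=> hf; under eq_fun do rewrite expr2; exact: bmfunM. Qed.

Lemma le_bmfun D f g : measurable D -> bounded_mfun f -> bounded_mfun g ->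
  (forall x, D x -> f x <= g x) ->
  \int[mu]_(x in D) f x <= \int[mu]_(x in D) g x.
Proof. by move=> mD hf hg h; apply: le_Rintegral => //; exact: bmfun_integrable. Qed.

Lemma Rintegral_bmfunD D f g : measurable D -> bounded_mfun f -> bounded_mfun g ->
  \int[mu]_(x in D) (f x + g x) = \int[mu]_(x in D) f x + \int[mu]_(x in D) g x.
Proof. by move=> mD hf hg; rewrite RintegralD //; exact: bmfun_integrable. Qed.

Lemma Rintegral_bmfunZ D (c : R) f : measurable D -> bounded_mfun f ->
  \int[mu]_(x in D) (c * f x) = c * \int[mu]_(x in D) f x.
Proof. by move=> mD hf; rewrite RintegralZl //; exact: bmfun_integrable. Qed.

Lemma Rintegral_lin2 D (a b : R) f g h : measurable D ->
  bounded_mfun f -> bounded_mfun g -> bounded_mfun h ->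
  (forall x, D x -> h x <= a * f x + b * g x) ->
  \int[mu]_(x in D) h x <= a * \int[mu]_(x in D) f x + b * \int[mu]_(x in D) g x.
Proof.
move=> mD hf hg hh hle.
rewrite -!Rintegral_bmfunZ // -Rintegral_bmfunD //; [|exact: bmfunZ|exact: bmfunZ].
apply: le_bmfun => //; apply: bmfunD; exact: bmfunZ.
Qed.

(** Meant for [F] inside [G]: the forms integrate over [G], the L2 norms over its support [F], and
    the difference is a null set. *)
Lemma Rintegral_subset_null (A B : set T) f : measurable A -> measurable B -> A `<=` B ->
  mu (B `\` A) = 0%E -> bounded_mfun f ->
  \int[mu]_(x in B) f x = \int[mu]_(x in A) f x.
Proof.
move=> mA mB AB m0 hf; congr fine.
have mBA : measurable (B `\` A) by exact: measurableD.
rewrite (negligible_integral mBA mB _ m0); last exact: bmfun_integrable.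
by rewrite setDD; congr (integral _ _ _); apply/seteqP; split=> [x []|x Ax] //; split=> //; exact: AB.
Qed.

End BoundedIntegrals.

Section NormSquare.
Context {R : realType} {V : normedModType R}.

(** The free weight is what makes squared norms continuous: as [l] tends to 0 the factor of the main
    term tends to 1, while the other term can still be made small. *)
Lemma sqrD_split (x y l : R) : 0 < l -> (x + y) ^+ 2 <= (1 + l) * x ^+ 2 + (1 + l^-1) * y ^+ 2.
Proof.
move=> l0; have h := sqr_ge0 (l * x - y).
have : 0 <= l^-1 * (l * x - y) ^+ 2 by rewrite mulr_ge0 // invr_ge0 ltW.
have -> : l^-1 * (l * x - y) ^+ 2 = l * x ^+ 2 - 2 * x * y + l^-1 * y ^+ 2.
  by field; rewrite gt_eqF.
by lra.
Qed.

Lemma normsq_split (a b : V) (l : R) : 0 < l ->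
  `|a| ^+ 2 <= (1 + l) * `|b| ^+ 2 + (1 + l^-1) * `|a - b| ^+ 2.
Proof.
move=> l0; apply: le_trans (sqrD_split _ _ l0).
rewrite ler_pXn2r ?nnegrE ?addr_ge0 //.
by rewrite -[X in `|X| <= _](subrKC b) ler_normD.
Qed.

Lemma normsqD2 (a b : V) : `|a + b| ^+ 2 <= 2 * `|a| ^+ 2 + 2 * `|b| ^+ 2.
Proof.
have := normsq_split (a + b) a ltr01; rewrite invr1.
by have -> : a + b - a = b by rewrite addrC addKr.
Qed.

Lemma normsqZ (c : R) (a : V) : `|c *: a| ^+ 2 = c ^+ 2 * `|a| ^+ 2.
Proof. by rewrite normrZ exprMn real_normK // num_real. Qed.

Lemma ler_sqr_norm (x M : R) : `|x| <= M -> x ^+ 2 <= M ^+ 2.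
Proof.
move=> h; have M0 : 0 <= M by apply: le_trans h.
by rewrite -(real_normK (num_real x)) ler_pXn2r ?nnegrE.
Qed.

End NormSquare.

Definition l2sq {R : realType} {H : completeNormedModType R}
    (mu : probability (borel H) R) (F : set H) (u : H -> R) : R :=
  \int[mu]_(x in F) (u x ^+ 2).

(* Everything that the capacity argument uses about the quadratic form. *)
Record energy_form {R : realType} {H : completeNormedModType R}
    (mu : probability (borel H) R) (F : set H)
    (E : (H -> R) -> (H -> R) -> R) : Prop := {
  en_cst : forall c : R, E (fun=> c) (fun=> c) = 0 ;
  en_ge0 : forall u, Cb1 u -> 0 <= E u u ;
  en_split : forall u v (l : R), Cb1 u -> Cb1 v -> 0 < l ->
    E u u <= (1 + l) * E v v + (1 + l^-1) * E (u \- v) (u \- v) ;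
  en_D : forall u v, Cb1 u -> Cb1 v ->
    E (u \+ v) (u \+ v) <= 2 * E u u + 2 * E v v ;
  en_B : forall u v, Cb1 u -> Cb1 v ->
    E (u \- v) (u \- v) <= 2 * E u u + 2 * E v v ;
  en_M : forall g, Cb1 g -> exists2 C, 0 <= C & forall v, Cb1 v ->
    E (fun x => g x * v x) (fun x => g x * v x) <= C * (E v v + l2sq mu F v) ;
  en_chi : forall u, Cb1 u -> E (fun x => chi (u x)) (fun x => chi (u x)) <= 4 * E u u ;
  en_chi_lip : forall w, Cb1 w -> exists2 C, 0 <= C & forall u v, Cb1 u -> Cb1 v ->
    E (fun x => chi (u x) - chi (v x)) (fun x => chi (u x) - chi (v x)) <=
      8 * E (u \- v) (u \- v) + 64 * E (v \- w) (v \- w) + C * l2sq mu F (u \- v) }.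

(** * Energy estimates from the rules of a derivation *)

Section Energy.
Context {R : realType} {H : completeNormedModType R} {ip : H -> H -> R}.
Hypothesis hip : inner_product ip.
Variables (mu : probability (borel H) R) (F G : set H).
Hypotheses (mF : measurable (F : set (borel H))) (mG : measurable (G : set (borel H))).
Hypotheses (FG : F `<=` G) (GF0 : mu (G `\` F) = 0%E).
Variable Dg : (H -> R) -> H -> H.
Hypothesis DgD : forall u v x, Cb1 u -> Cb1 v ->
  Dg (fun x => u x + v x) x = Dg u x + Dg v x.
Hypothesis DgB : forall u v x, Cb1 u -> Cb1 v ->
  Dg (fun x => u x - v x) x = Dg u x - Dg v x.
Hypothesis DgM : forall u v x, Cb1 u -> Cb1 v ->
  Dg (fun x => u x * v x) x = u x *: Dg v x + v x *: Dg u x.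
Hypothesis Dgchi : forall u x, Cb1 u -> Dg (fun x => chi (u x)) x = dchi (u x) *: Dg u x.
Hypothesis Dgcst : forall (c : R) x, Dg (fun=> c) x = 0.
Hypothesis Dgbound : forall u, Cb1 u -> exists2 M, 0 <= M & forall x, `|Dg u x| <= M.
Hypothesis Dgmeas : forall u v, Cb1 u -> Cb1 v ->
  measurable_fun [set: borel H] (fun x => ip (Dg u x) (Dg v x)).

Lemma bmfun_Dg u v : Cb1 u -> Cb1 v ->
  @bounded_mfun _ (borel H) R (fun x => ip (Dg u x) (Dg v x)).
Proof.
move=> hu hv; split; first exact: Dgmeas.
have [M M0 hM] := Dgbound hu; have [N N0 hN] := Dgbound hv.
exists (M * N) => x; rewrite (le_trans (cauchy_schwarz hip _ _)) //.
by rewrite ler_pM.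
Qed.

Lemma bmfun_Dg2 u : Cb1 u -> @bounded_mfun _ (borel H) R (fun x => `|Dg u x| ^+ 2).
Proof. by move=> hu; under eq_fun do rewrite -(ipE hip); exact: bmfun_Dg. Qed.

Lemma bmfun_Cb1 u : Cb1 u -> @bounded_mfun _ (borel H) R u.
Proof. by move=> hu; split; [exact: measurable_Cb1 | case: hu]. Qed.

Let E (u v : H -> R) : R := 1 / 2 * \int[mu]_(x in G) ip (Dg u x) (Dg v x).

Lemma energyE u : Cb1 u -> E u u = 1 / 2 * \int[mu]_(x in F) `|Dg u x| ^+ 2.
Proof.
move=> hu; rewrite /E; congr (_ * _).
rewrite (Rintegral_subset_null mF mG FG GF0 (bmfun_Dg hu hu)).
by apply: eq_Rintegral => x _; rewrite (ipE hip).
Qed.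

(** Every estimate is a pointwise inequality between squared gradients, integrated over [F]. The
    factor 4 for the cutoff is the square of the bound 2 on [dchi]. *)
Lemma energy_form_Dg : energy_form mu F E.
Proof.
have hF := @le_bmfun _ _ R mu F _ _ mF.
split.
- move=> c; rewrite (energyE (Cb1_cst c)); under eq_Rintegral do rewrite Dgcst normr0 expr0n.
  by rewrite Rintegral_cst // mul0r mulr0.
- move=> u hu; rewrite energyE //; apply: mulr_ge0; first by rewrite divr_ge0.
  by apply: Rintegral_ge0 => x _; exact: sqr_ge0.
- move=> u v l hu hv l0; have huv : Cb1 (u \- v) by exact: Cb1B.
  rewrite (energyE hu) (energyE hv) (energyE huv).
  rewrite (mulrCA (1 + l)) (mulrCA (1 + l^-1)) -mulrDr ler_pM2l //.
  apply: Rintegral_lin2 => //; [exact: bmfun_Dg2..|].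
  by move=> x _; rewrite [Dg (u \- v) x]DgB //; exact: normsq_split.
- move=> u v hu hv; have huv : Cb1 (u \+ v) by exact: Cb1D.
  rewrite (energyE hu) (energyE hv) (energyE huv).
  rewrite !(mulrCA 2) -mulrDr ler_pM2l //.
  apply: Rintegral_lin2 => //; [exact: bmfun_Dg2..|].
  by move=> x _; rewrite [Dg (u \+ v) x]DgD //; exact: normsqD2.
- move=> u v hu hv; have huv : Cb1 (u \- v) by exact: Cb1B.
  rewrite (energyE hu) (energyE hv) (energyE huv).
  rewrite !(mulrCA 2) -mulrDr ler_pM2l //.
  apply: Rintegral_lin2 => //; [exact: bmfun_Dg2..|].
  move=> x _; rewrite [Dg (u \- v) x]DgB //.
  by have := normsqD2 (Dg u x) (- Dg v x); rewrite normrN.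
- move=> g hg; have [[M hM] _ _] := hg; have [N N0 hN] := Dgbound hg.
  exists (2 * M ^+ 2 + N ^+ 2); first by have := sqr_ge0 M; have := sqr_ge0 N; lra.
  move=> v hv; have hgv : Cb1 (fun x => g x * v x) by exact: Cb1M.
  rewrite (energyE hv) (energyE hgv).
  have : \int[mu]_(x in F) (`|Dg (fun x => g x * v x) x| ^+ 2) <=
      (2 * M ^+ 2) * \int[mu]_(x in F) `|Dg v x| ^+ 2 + (2 * N ^+ 2) * l2sq mu F v.
    apply: Rintegral_lin2 => //; [exact: bmfun_Dg2.. | exact/bmfunX2/bmfun_Cb1 | exact: bmfun_Dg2|].
    move=> x _; rewrite DgM //; apply: le_trans (normsqD2 _ _) _.
    rewrite -(mulrA 2 (M ^+ 2)) -(mulrA 2 (N ^+ 2)) -!mulrDr ler_pM2l // !normsqZ; apply: lerD.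
      by rewrite ler_wpM2r ?sqr_ge0 // ler_sqr_norm.
    by rewrite mulrC ler_wpM2r ?sqr_ge0 // ler_sqr_norm // normr_id.
  set a := \int[mu]_(x in F) _; set b := \int[mu]_(x in F) _.
  have b0 : 0 <= b by apply: Rintegral_ge0 => x _; exact: sqr_ge0.
  have c0 : 0 <= l2sq mu F v by apply: Rintegral_ge0 => x _; exact: sqr_ge0.
  have := sqr_ge0 M; have := sqr_ge0 N; nra.
- move=> u hu; have hcu : Cb1 (fun x => chi (u x)) by exact: Cb1_chi.
  rewrite (energyE hu) (energyE hcu) mulrCA ler_pM2l // -Rintegral_bmfunZ //; last exact: bmfun_Dg2.
  apply: hF; [exact: bmfun_Dg2|exact/bmfunZ/bmfun_Dg2|move=> x _].
  rewrite Dgchi // normsqZ ler_wpM2r ?sqr_ge0 //.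
  by rewrite (le_trans (ler_sqr_norm (dchi_bound _))) // -natrX.
- move=> w hw; have [N N0 hN] := Dgbound hw.
  exists (512 * N ^+ 2); first by have := sqr_ge0 N; lra.
  move=> u v hu hv.
  have huv : Cb1 (u \- v) by exact: Cb1B.
  have hvw : Cb1 (v \- w) by exact: Cb1B.
  have hcuv : Cb1 (fun x => chi (u x) - chi (v x)) by apply: (Cb1B (Cb1_chi hu) (Cb1_chi hv)).
  rewrite (energyE huv) (energyE hvw) (energyE hcuv).
  have h : \int[mu]_(x in F) (`|Dg (fun x => chi (u x) - chi (v x)) x| ^+ 2) <=
      1 * \int[mu]_(x in F) (8 * `|Dg (u \- v) x| ^+ 2 + 64 * `|Dg (v \- w) x| ^+ 2)
      + (1024 * N ^+ 2) * l2sq mu F (u \- v).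
    apply: Rintegral_lin2 => //.
    + by apply: bmfunD; apply/bmfunZ/bmfun_Dg2.
    + exact/bmfunX2/bmfun_Cb1.
    + exact: bmfun_Dg2.
    move=> x _; rewrite (DgB x (Cb1_chi hu) (Cb1_chi hv)) !Dgchi //.
    rewrite [Dg (u \- v) x]DgB // [Dg (v \- w) x]DgB //= mul1r.
    move: (hN x); move: (Dg u x) (Dg v x) (Dg w x) (u x) (v x) => a b c s t hc.
    (* The difference of the derivatives is Lipschitz in [s - t], but the gradient [b] of [v] has no
       bound uniform along a sequence. Only the fixed bounded gradient [c] of [w] is paired with
       [s - t]; the rest, [b - c], is paired with the bound 4. This yields 8 = 2 * 4, 64 = 4 * 16
       and 1024 = 4 * 256, the last one halved by the factor 1/2 of the form. *)
    have -> : dchi s *: a - dchi t *: b =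
        dchi s *: (a - b) + ((dchi s - dchi t) *: (b - c) + (dchi s - dchi t) *: c).
      by rewrite -scalerDr subrK scalerBr scalerBl addrA subrK.
    apply: le_trans (normsqD2 _ _) _.
    have h1 := normsqD2 ((dchi s - dchi t) *: (b - c)) ((dchi s - dchi t) *: c).
    rewrite !normsqZ in h1 *.
    have h2 : dchi s ^+ 2 * `|a - b| ^+ 2 <= 2 ^+ 2 * `|a - b| ^+ 2.
      by rewrite ler_wpM2r ?sqr_ge0 // ler_sqr_norm // dchi_bound.
    have h3 : (dchi s - dchi t) ^+ 2 * `|b - c| ^+ 2 <= 4 ^+ 2 * `|b - c| ^+ 2.
      rewrite ler_wpM2r ?sqr_ge0 // ler_sqr_norm // (le_trans (ler_normB _ _)) //.
      by have := dchi_bound s; have := dchi_bound t; lra.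
    have h4 : (dchi s - dchi t) ^+ 2 * `|c| ^+ 2 <= 16 ^+ 2 * (s - t) ^+ 2 * N ^+ 2.
      rewrite ler_pM ?sqr_ge0 //; last by rewrite ler_sqr_norm // normr_id.
      rewrite (le_trans (ler_sqr_norm (dchi_lip _ _))) //.
      by rewrite exprMn real_normK // num_real.
    by lra.
  move: h; rewrite mul1r Rintegral_bmfunD // ?Rintegral_bmfunZ //; do ?exact: bmfun_Dg2; do ?exact/bmfunZ/bmfun_Dg2.
  by lra.
Qed.

End Energy.

(** * Limits of squared norms *)

Section RealLimits.
Context {R : realType}.

(** Here [a] and [b] stand for squared norms and [d] for the squared norm of the difference. The
    weight [l] is chosen small against the bound [M], and only afterwards [del] is chosen small
    against [1 + l^-1]. *)
Lemma split_close (M eps : R) : 0 <= M -> 0 < eps -> exists2 del, 0 < del &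
  forall a b d : R, 0 <= b -> b <= M -> 0 <= d -> d < del ->
    (forall l, 0 < l -> a <= (1 + l) * b + (1 + l^-1) * d) -> a < b + eps.
Proof.
move=> M0 e0; pose l := eps / (2 * (M + 1)).
have l0 : 0 < l by rewrite divr_gt0 //; lra.
have il0 : 0 < 1 + l^-1 by rewrite addr_gt0 // invr_gt0.
exists (eps / 2 / (1 + l^-1)); first by rewrite !divr_gt0.
move=> a b d b0 bM d0; rewrite ltr_pdivlMr // => dl /(_ l l0) h.
have : l * b <= eps / 2.
  have -> : eps / 2 = l * (M + 1) by rewrite /l; field; lra.
  by rewrite ler_wpM2l //; lra.
by rewrite mulrC in dl; lra.
Qed.

Lemma split_cvg (a d : nat -> R) (A : R) : (forall n, 0 <= a n) -> 0 <= A ->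
  (forall n, 0 <= d n) -> d @ \oo --> 0 ->
  (forall n l, 0 < l -> a n <= (1 + l) * A + (1 + l^-1) * d n) ->
  (forall n l, 0 < l -> A <= (1 + l) * a n + (1 + l^-1) * d n) ->
  a @ \oo --> A.
Proof.
move=> a0 A0 d0 /cvgrPdist_lt dc h1 h2; apply/cvgrPdist_lt => eps e0.
have [d1 d10 hd1] := split_close A0 e0.
have B0 : 0 <= A + 1 by lra.
have [d2 d20 hd2] := split_close B0 e0.
have [d3 d30 hd3] := split_close A0 ltr01.
have m0 : 0 < Num.min d1 (Num.min d2 d3) by rewrite !lt_min d10 d20 d30.
have := dc _ m0; apply: filterS => n; rewrite sub0r normrN ger0_norm // !lt_min.
move=> /andP[dn1 /andP[dn2 dn3]].
have u1 := hd1 _ _ _ A0 (lexx _) (d0 n) dn1 (h1 n).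
have u3 := hd3 _ _ _ A0 (lexx _) (d0 n) dn3 (h1 n).
have u2 := hd2 _ _ _ (a0 n) (ltW u3) (d0 n) dn2 (h2 n).
by rewrite ltr_norml; lra.
Qed.

(** Weight 1 against one fixed index bounds the sequence; with this bound [split_close] applies in
    both directions. *)
Lemma split_cauchy (a : nat -> R) (d : nat -> nat -> R) : (forall n, 0 <= a n) ->
  (forall n m, 0 <= d n m) ->
  (forall eps, 0 < eps -> exists N, forall n m, (N <= n)%N -> (N <= m)%N -> d n m < eps) ->
  (forall n m l, 0 < l -> a n <= (1 + l) * a m + (1 + l^-1) * d n m) ->
  cvgn a.
Proof.
move=> a0 d0 dc h.
have [N1 hN1] := dc 1 ltr01.
pose M := 2 * a N1 + 2.
have aM n : (N1 <= n)%N -> a n <= M.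
  move=> Nn; have := h n N1 1 ltr01; rewrite invr1.
  by have := hN1 n N1 Nn (leqnn _); have := d0 n N1; rewrite /M; lra.
have M0 : 0 <= M by rewrite /M; have := a0 N1; lra.
apply: norm_cauchy_cvgn => eps e0.
have [del del0 hdel] := split_close M0 e0.
have [N2 hN2] := dc _ del0.
pose N := maxn N1 N2; exists N => n Nn.
have N1N : (N1 <= N)%N by rewrite leq_maxl.
have N2N : (N2 <= N)%N by rewrite leq_maxr.
have u1 := hdel _ _ _ (a0 N) (aM _ N1N) (d0 _ _) (hN2 n N (leq_trans N2N Nn) N2N) (h n N).
have u2 := hdel _ _ _ (a0 n) (aM _ (leq_trans N1N Nn)) (d0 _ _)
  (hN2 N n N2N (leq_trans N2N Nn)) (h N n).
by rewrite ltr_norml; lra.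
Qed.

End RealLimits.

Section L2norm.
Context {d : measure_display} {T : measurableType d} {R : realType}.
Variables (mu : {measure set T -> \bar R}) (F : set T).
Hypothesis mF : measurable F.
Implicit Types f g h : T -> R.

Definition n2 f : \bar R := (\int[mu]_(x in F) (f x ^+ 2)%:E)%E.

Lemma n2_ge0 f : (0 <= n2 f)%E.
Proof. by apply: integral_ge0 => x _; rewrite lee_fin sqr_ge0. Qed.

Lemma measurable_sqr f : measurable_fun [set: T] f ->
  measurable_fun F (fun x => (f x ^+ 2)%:E).
Proof.
move=> mf; apply: measurable_funTS; apply/measurable_EFinP.
exact: measurable_funX.
Qed.

Lemma n2_lin2 (a b : R) f g h : 0 <= a -> 0 <= b ->
  measurable_fun [set: T] f -> measurable_fun [set: T] g -> measurable_fun [set: T] h ->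
  (forall x, F x -> h x ^+ 2 <= a * f x ^+ 2 + b * g x ^+ 2) ->
  (n2 h <= a%:E * n2 f + b%:E * n2 g)%E.
Proof.
move=> a0 b0 mf mg mh hle.
rewrite /n2 -!ge0_integralZl_EFin //; try (by move=> x _; rewrite lee_fin sqr_ge0);
  try exact: measurable_sqr.
rewrite -ge0_integralD //; first last.
- by apply: measurable_funeM; exact: measurable_sqr.
- by move=> x _; rewrite -EFinM lee_fin mulr_ge0 // sqr_ge0.
- by apply: measurable_funeM; exact: measurable_sqr.
- by move=> x _; rewrite -EFinM lee_fin mulr_ge0 // sqr_ge0.
apply: ge0_le_integral => //.
- by move=> x _; rewrite lee_fin sqr_ge0.
- exact: measurable_sqr.
- by apply: emeasurable_funD; apply: measurable_funeM; exact: measurable_sqr.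
Qed.

Lemma n2_split f g (l : R) : 0 < l -> measurable_fun [set: T] f -> measurable_fun [set: T] g ->
  (n2 f <= (1 + l)%:E * n2 g + (1 + l^-1)%:E * n2 (f \- g)%R)%E.
Proof.
move=> l0 mf mg; have il0 : 0 < l^-1 by rewrite invr_gt0.
apply: n2_lin2 => //; [lra|lra|exact: measurable_funB|].
move=> x _ /=; have -> : f x ^+ 2 = (g x + (f x - g x)) ^+ 2 by rewrite subrKC.
exact: sqrD_split.
Qed.

Lemma n2_le (a : R) f h : 0 <= a -> measurable_fun [set: T] f -> measurable_fun [set: T] h ->
  (forall x, F x -> h x ^+ 2 <= a * f x ^+ 2) -> (n2 h <= a%:E * n2 f)%E.
Proof.
move=> a0 mf mh hle.
have := @n2_lin2 a 0 f f h a0 (lexx _) mf mf mh; rewrite mul0e adde0; apply.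
by move=> x Fx; rewrite mul0r addr0 hle.
Qed.

Lemma n2_sub_cvg0 (un vn : nat -> T -> R) (u v : T -> R) :
  measurable_fun [set: T] u -> measurable_fun [set: T] v ->
  (forall n, measurable_fun [set: T] (un n)) -> (forall n, measurable_fun [set: T] (vn n)) ->
  (fun n => n2 (fun x => un n x - u x)) @ \oo --> 0%E ->
  (fun n => n2 (fun x => vn n x - v x)) @ \oo --> 0%E ->
  (fun n => n2 (fun x => (un n x + vn n x) - (u x + v x))) @ \oo --> 0%E.
Proof.
move=> mu' mv mun mvn cu cv.
have h0 : (fun n => 2%:E * n2 (fun x => un n x - u x)%R + 2%:E * n2 (fun x => vn n x - v x)%R)%E
    @ \oo --> 0%E.
  rewrite -[X in _ --> X](_ : 2%:E * 0 + 2%:E * 0 = 0)%E; last by rewrite !mule0 adde0.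
  by apply: cvgeD; [rewrite !mule0|exact: cvgeZl|exact: cvgeZl].
apply: squeeze_cvge (cvg_cst 0%E) h0; apply: nearW => n; rewrite n2_ge0 /=.
apply: n2_lin2 => //; [exact: measurable_funB..|by apply: measurable_funB; exact: measurable_funD|].
move=> x _; rewrite opprD addrACA.
by have := sqrD_split (un n x - u x) (vn n x - v x) ltr01; rewrite invr1.
Qed.

Lemma n2_le_cvg0 (a : R) (fn hn : nat -> T -> R) : 0 <= a ->
  (forall n, measurable_fun [set: T] (fn n)) -> (forall n, measurable_fun [set: T] (hn n)) ->
  (forall n x, F x -> hn n x ^+ 2 <= a * fn n x ^+ 2) ->
  (fun n => n2 (fn n)) @ \oo --> 0%E -> (fun n => n2 (hn n)) @ \oo --> 0%E.
Proof.
move=> a0 mf mh h c.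
have h0 : (fun n => a%:E * n2 (fn n))%E @ \oo --> 0%E.
  by rewrite -[X in _ --> X](mule0 a%:E); exact: cvgeZl.
apply: squeeze_cvge (cvg_cst 0%E) h0; apply: nearW => n; rewrite n2_ge0 /=.
exact: (n2_le a0 (mf n) (mh n) (h n)).
Qed.

End L2norm.

(** * Operations on approximating sequences *)

Section Approximation.
Context {R : realType} {H : completeNormedModType R}.
Variables (mu : probability (borel H) R) (F : set H).
Hypothesis mF : measurable (F : set (borel H)).
Variable E : (H -> R) -> (H -> R) -> R.
Hypothesis hE : energy_form mu F E.
Implicit Types (u v w g : H -> R) (un vn : nat -> H -> R).

Let N2 (u : H -> R) : \bar R := @n2 _ (borel H) R mu F u.

Lemma n2_Cb1 u : Cb1 u -> N2 u = (l2sq mu F u)%:E.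
Proof.
move=> hu; rewrite /l2sq /Rintegral fineK //.
by apply: integrable_fin_num => //; apply: (bmfun_integrable mu mF); apply: bmfunX2; exact: bmfun_Cb1.
Qed.

Lemma l2sq_ge0 u : 0 <= l2sq mu F u.
Proof. by apply: Rintegral_ge0 => x _; exact: sqr_ge0. Qed.

Lemma l2sqD u v : Cb1 u -> Cb1 v ->
  l2sq mu F (u \+ v) <= 2 * l2sq mu F u + 2 * l2sq mu F v.
Proof.
move=> hu hv; apply: (@Rintegral_lin2 _ (borel H)) => //.
- exact/bmfunX2/bmfun_Cb1.
- exact/bmfunX2/bmfun_Cb1.
- by apply/bmfunX2/bmfun_Cb1; exact: Cb1D.
- by move=> x _; have := sqrD_split (u x) (v x) ltr01; rewrite invr1.
Qed.

(** [approximates] says nothing on the measurability of [u], which the integral inequalities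
    require. *)
Definition app un u := approximates mu F E un u /\ measurable_fun [set: borel H] u.

Lemma app_Cb1 un u n : app un u -> Cb1 (un n). Proof. by case=> [[]]. Qed.

Lemma app_mfun un u n : app un u -> measurable_fun [set: borel H] (un n).
Proof. by move=> /app_Cb1 h; exact: measurable_Cb1. Qed.

Lemma app_n2 un u : app un u -> (fun n => N2 (fun x => un n x - u x)) @ \oo --> 0%E.
Proof. by case=> [[]]. Qed.

Lemma app_cauchy un u : app un u -> form_Cauchy E un.
Proof. by case=> [[]]. Qed.

Lemma app_E_cvg un u : app un u -> cvgn (fun n => E (un n) (un n)).
Proof.
move=> h; apply: (@split_cauchy _ _ (fun n m => E (un n \- un m) (un n \- un m))).
- by move=> n; apply: (en_ge0 hE); exact: (app_Cb1 _ h).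
- move=> n m; apply: (en_ge0 hE); apply: Cb1B; exact: (app_Cb1 _ h).
- exact: (app_cauchy h).
- by move=> n m l l0; apply: (en_split hE) => //; exact: (app_Cb1 _ h).
Qed.

(** Convergence of the extended real distances to 0 makes one of them finite, and the approximants
    are bounded. *)
Lemma app_n2_lty un u : app un u -> (N2 u < +oo)%E.
Proof.
move=> h; have := app_n2 h; move=> /fine_cvgP[[N _ hN] _].
have := hN N (leqnn N); rewrite /= => fN.
apply: (@le_lt_trans _ _ (2%:E * N2 (un N) + 2%:E * N2 (fun x => un N x - u x)%R)%E).
  apply: n2_lin2 => //.
  - exact: (app_mfun _ h).
  - by apply: measurable_funB; [exact: (app_mfun _ h)|exact: h.2].
  - exact: h.2.
  - move=> x _; have := sqrD_split (un N x) (- (un N x - u x)) ltr01; rewrite invr1 sqrrN.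
    by have -> : un N x - (un N x - u x) = u x by rewrite opprB addrC subrK.
rewrite (n2_Cb1 (app_Cb1 _ h)).
by rewrite -(fineK fN) -!EFinM -EFinD ltry.
Qed.

Lemma app_n2B_lty un u n : app un u -> (N2 (fun x => un n x - u x)%R < +oo)%E.
Proof.
move=> h; apply: (@le_lt_trans _ _ (2%:E * N2 (un n) + 2%:E * N2 u)%E).
  apply: n2_lin2 => //.
  - exact: (app_mfun _ h).
  - exact: h.2.
  - by apply: measurable_funB; [exact: (app_mfun _ h)|exact: h.2].
  - by move=> x _; have := sqrD_split (un n x) (- u x) ltr01; rewrite invr1 sqrrN.
have fu : N2 u \is a fin_num by rewrite ge0_fin_numE ?n2_ge0 //; exact: (app_n2_lty h).
rewrite (n2_Cb1 (app_Cb1 _ h)).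
by rewrite -(fineK fu) -!EFinM -EFinD ltry.
Qed.

Lemma app_n2_fin un u : app un u -> N2 u \is a fin_num.
Proof. by move=> h; rewrite ge0_fin_numE ?n2_ge0 //; exact: (app_n2_lty h). Qed.

Lemma app_l2sq_cvg un u : app un u ->
  (fun n => l2sq mu F (un n)) @ \oo --> fine (N2 u).
Proof.
move=> h; pose d n := fine (N2 (fun x => un n x - u x)).
have fd n : N2 (fun x => un n x - u x) \is a fin_num.
  by rewrite ge0_fin_numE ?n2_ge0 //; exact: (app_n2B_lty _ h).
have fu := app_n2_fin h.
apply: (@split_cvg _ _ d).
- by move=> n; exact: l2sq_ge0.
- by rewrite fine_ge0 // n2_ge0.
- by move=> n; rewrite fine_ge0 // n2_ge0.
- exact: (fine_cvg (app_n2 h)).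
- move=> n l l0; rewrite -lee_fin -(n2_Cb1 (app_Cb1 n h)).
  rewrite EFinD !EFinM !fineK //; apply: n2_split => //; [exact: (app_mfun _ h)|exact: h.2].
- move=> n l l0; rewrite -lee_fin EFinD !EFinM -(n2_Cb1 (app_Cb1 n h)).
  rewrite !fineK //.
  have il0 : 0 < l^-1 by rewrite invr_gt0.
  apply: n2_lin2 => //; [lra|lra|exact: (app_mfun _ h)| |exact: h.2|].
    by apply: measurable_funB; [exact: (app_mfun _ h)|exact: h.2].
  move=> x _; have := sqrD_split (un n x) (- (un n x - u x)) l0; rewrite sqrrN.
  by have -> : un n x - (un n x - u x) = u x by rewrite opprB addrC subrK.
Qed.

Lemma app_l2sq_cauchy un u (eps : R) : app un u -> 0 < eps ->
  exists N, forall n m, (N <= n)%N -> (N <= m)%N -> l2sq mu F (un n \- un m) < eps.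
Proof.
move=> hu e0; have e40 : 0 < eps / 4 by rewrite divr_gt0.
have /fine_cvgP[_ /cvgrPdist_lt /(_ _ e40)[N _ h]] := app_n2 hu.
exists N => n m nN mN; have := h n nN; have := h m mN.
rewrite /= !sub0r !normrN !ger0_norm ?fine_ge0 ?n2_ge0 // => hm hn.
have fd k : N2 (fun x => un k x - u x) \is a fin_num.
  by rewrite ge0_fin_numE ?n2_ge0 //; exact: (app_n2B_lty _ hu).
have hun k := app_Cb1 k hu.
apply: (@le_lt_trans _ _ (2 * fine (N2 (fun x => un n x - u x)) + 2 * fine (N2 (fun x => un m x - u x)))); last by rewrite /N2; lra.
rewrite -lee_fin -(n2_Cb1 (Cb1B (hun n) (hun m))).
rewrite EFinD !EFinM !fineK //; apply: n2_lin2 => //.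
- by apply: measurable_funB; [exact: (app_mfun _ hu)|exact: hu.2].
- by apply: measurable_funB; [exact: (app_mfun _ hu)|exact: hu.2].
- by apply: measurable_funB; exact: (app_mfun _ hu).
- move=> x _ /=; have := sqrD_split (un n x - u x) (- (un m x - u x)) ltr01; rewrite invr1 sqrrN.
  by have -> : un n x - u x - (un m x - u x) = un n x - un m x by ring.
Qed.

Lemma app_sub un u vn v : app un u -> app vn v ->
  app (fun n => un n \- vn n) (u \- v).
Proof.
move=> hu hv; have hun n := app_Cb1 n hu; have hvn n := app_Cb1 n hv.
split; last by apply: measurable_funB; [exact: hu.2|exact: hv.2].
split.
- by move=> n; exact: Cb1B.
- move=> eps e0; have e4 : 0 < eps / 4 by rewrite divr_gt0.
  have [N1 h1] := app_cauchy hu e4; have [N2' h2] := app_cauchy hv e4.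
  exists (maxn N1 N2') => n m; rewrite !geq_max => /andP[n1 n2] /andP[m1 m2].
  have -> : ((un n \- vn n) \- (un m \- vn m)) = ((un n \- un m) \- (vn n \- vn m)).
    by apply/funext => x /=; ring.
  apply: le_lt_trans (en_B hE (Cb1B (hun n) (hun m)) (Cb1B (hvn n) (hvn m))) _.
  by have := h1 _ _ n1 m1; have := h2 _ _ n2 m2; lra.
- have c := n2_sub_cvg0 (mu := mu) mF hu.2 (measurable_funN hv.2).
  have := c un (fun n x => - vn n x) (fun n => app_mfun n hu) _ (app_n2 hu).
  rewrite /L2_cvg /n2; apply.
    by move=> n; apply: (measurable_funN (app_mfun n hv)).
  have := app_n2 hv; rewrite /N2 /n2; apply: cvg_trans; apply: near_eq_cvg; apply: nearW => n.
  by apply: eq_integral => x _ /=; congr (_%:E); ring.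
Qed.

Lemma app_const g : Cb1 g -> app (fun=> g) g.
Proof.
move=> hg; split; last exact: measurable_Cb1.
split=> //.
- move=> eps e0; exists 0%N => n m _ _.
  have -> : (g \- g) = (fun=> 0) by apply/funext => x /=; rewrite subrr.
  by rewrite (en_cst hE).
- rewrite /L2_cvg.
  have -> : (fun _ : nat => (\int[mu]_(x in F) ((g x - g x) ^+ 2)%:E)%E) = cst 0%E.
    by apply/funext => n; apply: integral0_eq => x _; rewrite subrr expr0n.
  exact: cvg_cst.
Qed.

Lemma measurable_chi : measurable_fun [set: R] (chi : R -> R).
Proof.
apply: continuous_measurable_fun => x; apply: differentiable_continuous.
exact: (diff_chi x).1.
Qed.

Lemma app_chi un u : app un u ->
  app (fun n x => chi (un n x)) (fun x => chi (u x)).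
Proof.
move=> hu; have hun n := app_Cb1 n hu.
split; last by apply: (measurableT_comp measurable_chi); exact: hu.2.
split.
- by move=> n; exact: (Cb1_chi (hun n)).
(* The coefficients 8 and 64 of [en_chi_lip] use up 72/100 of [eps]; the L2 term takes at most a
   quarter more. *)
- move=> eps e0; have e4 : 0 < eps / 100 by lra.
  have [N1 h1] := app_cauchy hu e4.
  have [C C0 hC] := en_chi_lip hE (hun N1).
  pose e5 := eps / (16 * (C + 1)).
  have e50 : 0 < e5 by rewrite divr_gt0 //; lra.
  have [N2' h2] := app_l2sq_cauchy hu e50.
  exists (maxn N1 N2') => n m; rewrite !geq_max => /andP[n1 n2] /andP[m1 m2].
  apply: le_lt_trans (hC _ _ (hun n) (hun m)) _.
  have := h1 _ _ n1 m1; have := h1 _ _ m1 (leqnn _).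
  have := h2 _ _ n2 m2.
  have hCe : C * e5 <= eps / 4.
    rewrite /e5; have -> : C * (eps / (16 * (C + 1))) = eps / 16 * (C / (C + 1)) by field; lra.
    have : eps / 16 * (C / (C + 1)) <= eps / 16 by rewrite ler_piMr ?ler_pdivrMr; lra.
    by lra.
  by move=> /ltW /(ler_wpM2l C0); lra.
- apply: (@n2_le_cvg0 _ (borel H) R mu F mF 4 _ _ _ _ _ _ (app_n2 hu)) => //.
  + by move=> n; apply: measurable_funB; [exact: (app_mfun _ hu)|exact: hu.2].
  + move=> n; apply: measurable_funB.
      exact: (measurable_Cb1 (Cb1_chi (hun n))).
    by apply: (measurableT_comp measurable_chi); exact: hu.2.
  + move=> n x _; rewrite (le_trans (ler_sqr_norm (chi_lip _ _))) //.
    by rewrite exprMn real_normK ?num_real // -natrX.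
Qed.

Lemma app_mul g un u : Cb1 g -> app un u ->
  app (fun n x => g x * un n x) (fun x => g x * u x).
Proof.
move=> hg hu; have hun n := app_Cb1 n hu; have [[M hM] _ _] := hg.
split; last by apply: measurable_funM; [exact: measurable_Cb1|exact: hu.2].
split.
- by move=> n; exact: (Cb1M hg (hun n)).
- move=> eps e0; have [C C0 hC] := en_M hE hg.
  pose e5 := eps / (16 * (C + 1)).
  have e50 : 0 < e5 by rewrite divr_gt0 //; lra.
  have [N1 h1] := app_cauchy hu e50.
  have [N2' h2] := app_l2sq_cauchy hu e50.
  exists (maxn N1 N2') => n m; rewrite !geq_max => /andP[n1 n2] /andP[m1 m2].
  have -> : (fun x => g x * un n x) \- (fun x => g x * un m x) = (fun x => g x * (un n \- un m) x).
    by apply/funext => x /=; rewrite mulrBr.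
  apply: le_lt_trans (hC _ (Cb1B (hun n) (hun m))) _.
  have := h1 _ _ n1 m1.
  have := h2 _ _ n2 m2.
  have hCe : C * (2 * e5) <= eps / 8.
    rewrite /e5; have -> : C * (2 * (eps / (16 * (C + 1)))) = eps / 8 * (C / (C + 1)) by field; lra.
    rewrite ler_piMr ?ler_pdivrMr; lra.
  move=> a b; have : C * (E (un n \- un m) (un n \- un m) + l2sq mu F (un n \- un m)) <= C * (2 * e5).
    by rewrite ler_wpM2l //; lra.
  by lra.
- apply: (@n2_le_cvg0 _ (borel H) R mu F mF (M ^+ 2) _ _ _ _ _ _ (app_n2 hu)).
  + exact: sqr_ge0.
  + by move=> n; apply: measurable_funB; [exact: (app_mfun _ hu)|exact: hu.2].
  + move=> n; apply: measurable_funB.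
      exact: (measurable_Cb1 (Cb1M hg (hun n))).
    by apply: measurable_funM; [exact: measurable_Cb1|exact: hu.2].
  + move=> n x _; rewrite -mulrBr exprMn ler_wpM2r ?sqr_ge0 //.
    exact: ler_sqr_norm.
Qed.

End Approximation.

Section AlmostEverywhere.
Context {d : measure_display} {T : measurableType d} {R : realType}.
Variable mu : {measure set T -> \bar R}.

Lemma ae_imp (P Q : T -> Prop) : (forall x, P x -> Q x) ->
  {ae mu, forall x, P x} -> {ae mu, forall x, Q x}.
Proof. by move=> PQ; apply: filterS. Qed.

Lemma ae_imp2 (P1 P2 Q : T -> Prop) : (forall x, P1 x -> P2 x -> Q x) ->
  {ae mu, forall x, P1 x} -> {ae mu, forall x, P2 x} -> {ae mu, forall x, Q x}.
Proof. by move=> PQ; apply: filterS2. Qed.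

Lemma ae_all (P : nat -> T -> Prop) : (forall n, {ae mu, forall x, P n x}) ->
  {ae mu, forall x, forall n, P n x}.
Proof. exact: ae_foralln. Qed.

Lemma ae_null (A : set T) : measurable A -> mu A = 0%E -> {ae mu, forall x, ~ A x}.
Proof. by move=> mA A0; exists A; split=> // x /contrapT. Qed.

End AlmostEverywhere.

(** * Completeness of L2 with a rate *)

Section L2Complete.
Context {R : realType}.

Lemma geometric_half_sum n : \sum_(i < n) (2^-1 : R) ^+ i <= 2.
Proof.
suff -> : \sum_(i < n) (2^-1 : R) ^+ i = 2 - 2 * 2^-1 ^+ n.
  by rewrite gerBl mulr_ge0 // exprn_ge0.
elim: n => [|n ih]; first by rewrite big_ord0 expr0; lra.
by rewrite big_ord_recr /= ih exprS; lra.
Qed.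

Lemma fast_cvgn (a : nat -> R) (K : R) : 0 <= K ->
  (forall n, `|a n.+1 - a n| <= K * 2^-1 ^+ n) -> cvgn a.
Proof.
move=> K0 h.
have key N k : `|a (N + k)%N - a N| <= 2 * K * 2^-1 ^+ N - 2 * K * 2^-1 ^+ (N + k).
  elim: k => [|k ih]; first by rewrite addn0 !subrr normr0.
  rewrite addnS -[a _.+1](subrK (a (N + k)%N)) -addrA (le_trans (ler_normD _ _)) //.
  by have := h (N + k)%N; rewrite exprS; lra.
apply: norm_cauchy_cvgn => eps e0.
have q0 : 0 < eps / (2 * K + 1) by rewrite divr_gt0 //; lra.
have q1 : `|2^-1 : R| < 1 by rewrite ger0_norm; lra.
have /cvgrPdist_lt /(_ _ q0)[N _ hN] := cvg_geometric 1 q1.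
exists N => n Nn; have := hN N (leqnn N); rewrite /= /geometric /= mul1r sub0r normrN.
rewrite ger0_norm ?exprn_ge0 // ltr_pdivlMr; last by lra.
have := key N (n - N)%N; rewrite subnKC // => h1 h2.
have h3 : 0 <= (2^-1 : R) ^+ n by rewrite exprn_ge0.
have h4 : 0 <= (2^-1 : R) ^+ N by rewrite exprn_ge0.
by have := mulr_ge0 K0 h3; lra.
Qed.

Context {d : measure_display} {T : measurableType d}.
Variables (mu : {measure set T -> \bar R}) (F : set T).
Hypothesis mF : measurable F.

Lemma fatou_bound (f : nat -> T -> \bar R) (g : T -> \bar R) (b : \bar R) :
  (forall n, measurable_fun F (f n)) -> (forall n x, F x -> 0 <= f n x)%E ->
  (forall x, F x -> f ^~ x @ \oo --> g x) ->
  (forall n, (\int[mu]_(x in F) f n x <= b)%E) -> (\int[mu]_(x in F) g x <= b)%E.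
Proof.
move=> mf f0 fg hb.
have -> : (\int[mu]_(x in F) g x = \int[mu]_(x in F) limn_einf (f ^~ x))%E.
  apply: eq_integral => x; rewrite inE => Fx.
  by have [-> _] := cvg_limn_einf_sup (fg x Fx).
apply: le_trans (fatou mu mF mf f0) _.
rewrite limn_einf_lim; apply: lime_le; first exact: is_cvg_einfs.
apply: nearW => n; apply: le_trans (hb n).
by apply: ereal_inf_lbound; exists n => //=.
Qed.

(** The rate 8^-n leaves room for weights 4^n: the weighted squared increments have integrals of
    order 2^-n, so their sum is finite almost everywhere, and there the increments are of order
    2^-n. *)
Lemma L2_complete (g : nat -> T -> R) (C : R) :
  (forall n, measurable_fun [set: T] (g n)) ->
  (forall n m, (n <= m)%N -> (n2 mu F (fun x => g m x - g n x)%R <= (C * (2^-1 ^+ 3) ^+ n)%:E)%E) ->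
  exists2 W : T -> R, measurable_fun [set: T] W &
    forall n, (n2 mu F (fun x => g n x - W x)%R <= (C * (2^-1 ^+ 3) ^+ n)%:E)%E.
Proof.
move=> mg hg.
have C0 : 0 <= C.
  have := le_trans (n2_ge0 _ _ _) (hg 0%N 0%N (leqnn _)).
  by rewrite lee_fin expr0 mulr1.
pose f n x := ((2 ^+ 2) ^+ n * (g n.+1 x - g n x) ^+ 2)%:E : \bar R.
have mdn n : measurable_fun [set: T] (fun x => g n.+1 x - g n x) by exact: measurable_funB.
have mf n : measurable_fun [set: T] (f n).
  by apply/measurable_EFinP; apply: measurable_funM => //; exact: measurable_funX.
have f0 n x : (0 <= f n x)%E by rewrite lee_fin mulr_ge0 // ?sqr_ge0 // exprn_ge0.
pose S x := (\sum_(n <oo) f n x)%E.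
have mS : measurable_fun [set: T] S.
  by apply: ge0_emeasurable_sum.
have S0 x : (0 <= S x)%E by apply: nneseries_ge0.
have iS : (\int[mu]_(x in F) S x < +oo)%E.
  rewrite integral_nneseries //; last by move=> n; exact: measurable_funTS.
  apply: (@le_lt_trans _ _ (\sum_(n <oo) ((2 * C) / (2 ^ n.+1)%:R)%:E)%E).
    apply: lee_nneseries => [n _ _|n _]; first by apply: integral_ge0 => x _; exact: f0.
    rewrite /f; under eq_integral do rewrite EFinM.
    rewrite ge0_integralZl_EFin; [|exact: mF|by move=> x _; rewrite lee_fin sqr_ge0|exact: measurable_sqr|exact: exprn_ge0].
    have := hg n n.+1 (leqnSn n); rewrite /n2 => h.
    apply: le_trans (lee_wpmul2l _ h) _; first by rewrite lee_fin exprn_ge0.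
    have E : ((2 : R) ^+ 2) ^+ n * (2^-1 ^+ 3) ^+ n = 2^-1 ^+ n.
      by rewrite -exprMn; congr (_ ^+ _); rewrite !exprS expr0; field.
    rewrite -EFinM lee_fin natrX mulrCA E le_eqVlt; apply/orP; left; apply/eqP.
    have p0 : (2 : R) ^+ n != 0 by rewrite expf_neq0.
    by rewrite exprVn exprS; field.
  apply: le_lt_trans (epsilon_trick0 _ _) (ltry _); lra.
pose A := F `&` [set x | (S x < +oo)%E].
have mA : measurable A.
  apply: measurableI => //; rewrite -[X in measurable X]setTI.
  exact: emeasurable_fun_infty_o.
have aeA : {ae mu, forall x, F x -> A x}.
  have iS' : mu.-integrable F S.
    apply/integrableP; split; first exact: measurable_funTS.
    by under eq_integral do rewrite gee0_abs //.
  have := integrable_ae mF iS'; apply: filterS => x h Fx; split => //=.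
  by have := h Fx; rewrite ge0_fin_numE.
(* Cutting off outside the good set makes the sequence converge at every point, so that the limit is
   measurable. *)
pose g' n x := g n x * \1_A x.
have mg' n : measurable_fun [set: T] (g' n).
  by apply: measurable_funM => //; exact: measurable_indic.
have cg' x : cvgn (g' ^~ x).
  have [Ax|nAx] := pselect (A x); last first.
    rewrite /g' indicE memNset //.
    by under [X in cvgn X]eq_fun do rewrite mulr0; exact: is_cvg_cst.
  have sfin : S x \is a fin_num by rewrite ge0_fin_numE //; exact: Ax.2.
  apply: (@fast_cvgn _ (fine (S x) + 1)); first by rewrite addr_ge0 // fine_ge0.
  move=> n; rewrite /g' indicE mem_set // !mulr1.
  have : (f n x <= S x)%E.
    rewrite /S (@nneseriesD1 _ (f ^~ x) n xpredT) //= leeDl //; exact: nneseries_ge0.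
  rewrite -(fineK sfin) lee_fin -exprM mulnC exprM -exprMn.
  set y := _ * _ => hy.
  have hy1 : `|y| <= fine (S x) + 1.
    rewrite -real_normK ?num_real // in hy.
    by have := sqr_ge0 (`|y| - 1); nra.
  have p0 : 0 < (2 : R) ^+ n by rewrite exprn_gt0.
  rewrite /y normrM ger0_norm ?(ltW p0) // in hy1.
  by rewrite exprVn ler_pdivlMr // mulrC.
pose W x := limn (g' ^~ x).
have mW : measurable_fun [set: T] W by exact: measurable_fun_cvg mg' (fun x _ => cg' x).
exists W => // n.
(* Fatou's lemma along [n + m] carries the rate over to the limit. *)
apply: (@fatou_bound (fun m x => ((g n x - g' (n + m)%N x) ^+ 2)%:E)).
- move=> m; apply: measurable_sqr => //; exact: measurable_funB.
- by move=> m x _; rewrite lee_fin sqr_ge0.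
- move=> x Fx; apply: cvg_EFin; first exact: nearW.
  rewrite /comp /=; under eq_fun do rewrite expr2; rewrite expr2.
  have c : (fun m => g n x - g' (n + m)%N x) @ \oo --> g n x - W x.
    apply: cvgB; first exact: cvg_cst.
    have := cg' x; rewrite -(cvg_shiftn n) /=.
    by under eq_fun do rewrite addnC.
  exact: (cvgM c c).
- move=> m; apply: le_trans (hg n (n + m)%N (leq_addr _ _)).
  rewrite le_eqVlt; apply/orP; left; apply/eqP.
  apply: ge0_ae_eq_integral => //.
  + by apply: measurable_sqr => //; exact: measurable_funB.
  + by apply: measurable_sqr => //; exact: measurable_funB.
  + by move=> x _; rewrite lee_fin sqr_ge0.
  + by move=> x _; rewrite lee_fin sqr_ge0.
  apply: filterS aeA => x hA Fx; congr EFin.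
  rewrite /g' indicE mem_set; last exact: hA.
  by rewrite mulr1 -sqrrN opprB.
Qed.

Lemma n2_eq0_ae (f : T -> R) : measurable_fun [set: T] f -> n2 mu F f = 0%E ->
  {ae mu, forall x, F x -> f x = 0}.
Proof.
move=> mf f0.
have [h _] := ae_eq_integral_abs mu mF (measurable_sqr (F := F) mf).
have : ae_eq mu F (fun x => (f x ^+ 2)%:E) (cst 0%E).
  apply: h; rewrite -[RHS]f0; apply: eq_integral => x _.
  by rewrite gee0_abs // lee_fin sqr_ge0.
by apply: filterS => x h' Fx; have /eqP := h' Fx; rewrite eqe sqrf_eq0 => /eqP.
Qed.

End L2Complete.

(** * Capacity and exceptional sets *)

Section Capacity.
Context {R : realType} {H : completeNormedModType R}.
Variables (mu : probability (borel H) R) (F : set H).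
Hypothesis mF : measurable (F : set (borel H)).
Variable E : (H -> R) -> (H -> R) -> R.
Hypothesis hE : energy_form mu F E.
Implicit Types (u v w g : H -> R) (un vn : nat -> H -> R) (K : set H).

Let N2 (u : H -> R) : \bar R := @n2 _ (borel H) R mu F u.

Definition Q1 u : R := E u u + l2sq mu F u.

Lemma Q1D u v : Cb1 u -> Cb1 v -> Q1 (u \+ v) <= 2 * Q1 u + 2 * Q1 v.
Proof.
by move=> hu hv; have := en_D hE hu hv; have := l2sqD mu mF hu hv; rewrite /Q1; lra.
Qed.

(** The weights are the price of peeling off one summand at a time with [Q1D]; the functions summed
    below decay fast enough to pay it. *)
Lemma Q1_sum n (a : nat -> H -> R) : (forall i, Cb1 (a i)) ->
  Q1 (fun x => \sum_(i < n) a i x) <= \sum_(i < n) 2 ^+ i.+1 * Q1 (a i).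
Proof.
elim: n a => [|n ih] a ha.
  rewrite big_ord0; under eq_fun do rewrite big_ord0.
  rewrite /Q1 (en_cst hE) add0r /l2sq Rintegral_cst ?expr0n ?mul0r //.
rewrite big_ord_recl; under eq_fun do rewrite big_ord_recl.
have hs : Cb1 (fun x => \sum_(i < n) a i.+1 x).
  by apply: (@Cb1_sum R H _ (index_enum _) (fun i : 'I_n => a i.+1)).
apply: le_trans (Q1D (ha 0%N) hs) _; rewrite expr1 lerD2l.
have p2 : 0 <= 2 :> R by [].
apply: (le_trans (ler_wpM2l p2 (ih (fun i => a i.+1) (fun i => ha i.+1)))).
by rewrite mulr_sumr; apply: ler_sum => i _; rewrite lift0 (exprS 2 i.+1) mulrA.
Qed.

Lemma Q1_chi u : Cb1 u -> Q1 (fun x => chi (u x)) <= 4 * Q1 u.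
Proof.
move=> hu; have h1 := en_chi hE hu.
have h2 : l2sq mu F (fun x => chi (u x)) <= 4 * l2sq mu F u + 0 * l2sq mu F u.
  apply: (@Rintegral_lin2 _ (borel H)) => //.
  - exact: (bmfunX2 (bmfun_Cb1 hu)).
  - exact: (bmfunX2 (bmfun_Cb1 hu)).
  - exact: (bmfunX2 (bmfun_Cb1 (Cb1_chi hu))).
  - move=> x _; rewrite mul0r addr0 (le_trans (ler_sqr_norm (chi_bound _))) //.
    by rewrite exprMn real_normK ?num_real // -natrX.
by rewrite /Q1; lra.
Qed.

(** [energy_form] records no homogeneity; reading [u - v] as [0 - (v - u)] replaces it at the cost
    of a factor 2. *)
Lemma energy_sym u v : Cb1 u -> Cb1 v -> E (u \- v) (u \- v) <= 2 * E (v \- u) (v \- u).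
Proof.
move=> hu hv; have h := en_B hE (Cb1_cst 0) (Cb1B hv hu).
have e : (fun _ : H => 0) \- (fun x => v x - u x) = u \- v.
  by apply/funext => x /=; rewrite sub0r opprB.
by move: h; rewrite e (en_cst hE) mulr0 add0r.
Qed.

Lemma app_Q1_cauchy un u (eps : R) : app mu F E un u -> 0 < eps ->
  exists N, forall n m, (N <= n)%N -> (N <= m)%N -> Q1 (un n \- un m) < eps.
Proof.
move=> hu e0; have e2 : 0 < eps / 2 by rewrite divr_gt0.
have [N1 h1] := app_cauchy hu e2; have [N2' h2] := app_l2sq_cauchy mF hu e2.
exists (maxn N1 N2') => n m; rewrite !geq_max => /andP[n1 n2] /andP[m1 m2].
by have := h1 _ _ n1 m1; have := h2 _ _ n2 m2; rewrite /Q1; lra.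
Qed.

Lemma app_shift un u N : app mu F E un u -> app mu F E (fun n => un (N + n)%N) u.
Proof.
move=> h; split; last exact: h.2.
split.
- by move=> n; exact: (app_Cb1 _ h).
- move=> eps e0; have [M hM] := app_cauchy h e0; exists M => n m Mn Mm.
  by apply: hM; rewrite (leq_trans _ (leq_addl _ _)).
- have := app_n2 h; rewrite -(cvg_shiftn N) /=.
  by under eq_fun do rewrite addnC.
Qed.

(* A bound eps on the E_1-capacity of F \ K. *)
Definition capsmall (eps : R) K : Prop :=
  exists w un, [/\ app mu F E un w, forall n, Q1 (un n) < eps &
    {ae mu, forall x, (F `\` K) x -> 1 <= w x}].

Lemma capsmall_le eps eps' K K' : eps <= eps' -> K `<=` K' ->
  capsmall eps K -> capsmall eps' K'.
Proof.
move=> ee KK [w [un [h1 h2 h3]]]; exists w, un; split=> //.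
  by move=> n; rewrite (lt_le_trans (h2 n)).
by move: h3; apply: ae_imp => x h [Fx nKx]; apply: h; split=> // /KK.
Qed.

(** Countable subadditivity of the capacity, with an L2 limit of diagonal sums of cut-off functions
    as test function. The weights of [Q1_sum] consume a factor 2^-m of the rate 2^-(5m); what is
    left, 8^-m 2^-m, provides a summable factor and the rate asked by [L2_complete]. The total is at
    most 16 [eps], and 17 makes the inequality strict. *)
Lemma capsmall_bigcap (K : nat -> set H) (eps : R) : 0 < eps ->
  (forall m, capsmall (eps * (2^-1 ^+ 5) ^+ m) (K m)) -> capsmall (17 * eps) (\bigcap_m K m).
Proof.
move=> e0 hK.
have [w hw] := choice hK; have {hw}[wn hwn] := choice hw.
(* The cutoff makes the functions nonnegative, so that each summand is below the sum, and equal to 1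
   wherever the original is at least 1. *)
pose h m n := fun x => chi (wn m n x).
pose hl m := fun x => chi (w m x).
have ha m : app mu F E (h m) (hl m) by have [a _ _] := hwn m; exact: (app_chi mF hE a).
have hC m n : Cb1 (h m n) := app_Cb1 n (ha m).
have hQ m n : Q1 (h m n) <= 4 * (eps * (2^-1 ^+ 5) ^+ m).
  have [a b _] := hwn m.
  by apply: le_trans (Q1_chi (app_Cb1 n a)) _; have := b n; lra.
have hN1 m n : exists N, forall i j, (N <= i)%N -> (N <= j)%N ->
    Q1 (h m i \- h m j) < (2^-1 ^+ 2) ^+ m * (2^-1 ^+ 3) ^+ n.
  by apply: (app_Q1_cauchy (ha m)); rewrite mulr_gt0 // !exprn_gt0.
pose N m := projT1 (choice (hN1 m)).
have hN m := projT2 (choice (hN1 m)).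
(* The maximum makes the index good for all tolerances up to [n] at once; the added [n] makes it
   tend to infinity. *)
pose nu m n := (n + \max_(k < n.+1) N m k)%N.
have hnu m n n' : (n <= n')%N -> (N m n <= nu m n')%N.
  move=> nn; rewrite (leq_trans _ (leq_addl _ _)) //.
  by have := @leq_bigmax _ (fun k : 'I_n'.+1 => N m k) (Ordinal (nn : n < n'.+1)%N).
pose G n := fun x => \sum_(m < n) h m (nu m n) x.
have GC n : Cb1 (G n).
  by apply: (@Cb1_sum R H _ (index_enum _) (fun i : 'I_n => h i (nu i n))).
(* In [G n' - G n], the 2 accounts for the summands whose index [nu] has changed, and [8 * eps] for
   the new ones. *)
pose D := 2 + 8 * eps.
have D0 : 0 < D by rewrite /D; lra.
have p4 m : (2 : R) ^+ m.+1 * (2^-1 ^+ 2) ^+ m = 2 * 2^-1 ^+ m.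
  have p0 : 2 * 2^-1 ^+ 2 = (2 : R)^-1 by rewrite expr2; field.
  by rewrite exprS -mulrA -exprMn p0.
have p32 m : (2 : R) ^+ m.+1 * (4 * (eps * (2^-1 ^+ 5) ^+ m)) =
    8 * eps * ((2^-1 ^+ 3) ^+ m * 2^-1 ^+ m).
  rewrite exprS -exprMn.
  have -> : (2 : R)^-1 ^+ 3 * 2^-1 = 2 * 2^-1 ^+ 5 by rewrite !exprS expr0; field.
  by rewrite [in RHS]exprMn; move: ((2 : R) ^+ m) (((2 : R)^-1 ^+ 5) ^+ m) => a b; ring.
have GD n n' : (n <= n')%N -> Q1 (G n' \- G n) <= 2 * D * (2^-1 ^+ 3) ^+ n.
  move=> nn.
  pose a m := if (m < n)%N then h m (nu m n') \- h m (nu m n) else h m (nu m n').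
  have aC m : Cb1 (a m) by rewrite /a; case: ifP => _; [exact: Cb1B|exact: hC].
  have -> : G n' \- G n = fun x => \sum_(m < n') a m x.
    apply/funext => x /=; rewrite /G (big_ord_widen n' (fun m => h m (nu m n) x) nn).
    rewrite [X in _ - X]big_mkcond /= -sumrB; apply: eq_bigr => i _.
    by rewrite /a; case: ifP => _ //; rewrite subr0.
  apply: le_trans (Q1_sum n' aC) _.
  apply: (@le_trans _ _ (\sum_(m < n') (D * (2^-1 ^+ 3) ^+ n) * 2^-1 ^+ m)).
    apply: ler_sum => m _.
    have p2 : 0 <= (2 : R) ^+ m.+1 by rewrite exprn_ge0.
    have q8 : 0 <= ((2 : R)^-1 ^+ 3) ^+ n by rewrite !exprn_ge0.
    have q2 : 0 <= (2 : R)^-1 ^+ m by rewrite exprn_ge0.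
    have q82 := mulr_ge0 q8 q2.
    rewrite /a; case: ifPn => mn.
      have le1 := ltW (hN m n _ _ (hnu m n n' nn) (hnu m n n (leqnn n))).
      apply: le_trans (ler_wpM2l p2 le1) _; rewrite mulrA p4 /D.
      by have := mulr_ge0 (ltW e0) q82; lra.
    apply: le_trans (ler_wpM2l p2 (hQ m _)) _; rewrite p32 /D.
    have le8 : ((2 : R)^-1 ^+ 3) ^+ m <= (2^-1 ^+ 3) ^+ n.
      rewrite -leqNgt in mn; rewrite ler_wiXn2l ?exprn_ge0 // exprn_ile1 //; lra.
    have := ler_wpM2l (mulr_ge0 (ltW e0) q2) le8; lra.
  rewrite -mulr_sumr; have := geometric_half_sum (R := R) n'.
  have q8 : 0 <= D * (2^-1 ^+ 3) ^+ n by rewrite mulr_ge0 ?(ltW D0) // !exprn_ge0.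
  by move=> /(ler_wpM2l q8); lra.
have GQ n : Q1 (G n) < 17 * eps.
  apply: (@le_lt_trans _ _ (\sum_(m < n) (8 * eps) * 2^-1 ^+ m)).
    apply: le_trans (Q1_sum n (fun m => hC m (nu m n))) _.
    apply: ler_sum => m _; have p2 : 0 <= (2 : R) ^+ m.+1 by rewrite exprn_ge0.
    apply: le_trans (ler_wpM2l p2 (hQ m _)) _; rewrite p32.
    have q2 : 0 <= (2 : R)^-1 ^+ m by rewrite exprn_ge0.
    have le8 : ((2 : R)^-1 ^+ 3) ^+ m <= 1 by rewrite exprn_ile1 ?exprn_ge0 // exprn_ile1 //; lra.
    have := ler_wpM2l (mulr_ge0 (ltW e0) q2) le8; lra.
  rewrite -mulr_sumr; have e8 : 0 <= 8 * eps by lra.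
  by have := geometric_half_sum (R := R) n; move=> /(ler_wpM2l e8); lra.
have GN2 n n' : (n <= n')%N -> (N2 (fun x => G n' x - G n x)%R <= (2 * D * (2^-1 ^+ 3) ^+ n)%:E)%E.
  move=> nn; have hB := Cb1B (GC n') (GC n).
  rewrite /N2 (n2_Cb1 mu mF hB) lee_fin (le_trans _ (GD _ _ nn)) // lerDr.
  exact: (en_ge0 hE hB).
have [W mW hW] := @L2_complete R _ (borel H) mu F mF G (2 * D) (fun n => measurable_Cb1 (GC n)) GN2.
have tol0 : (fun n => 2 * D * ((2 : R)^-1 ^+ 3) ^+ n) @ \oo --> 0.
  have q1 : `|(2 : R)^-1 ^+ 3| < 1.
    by rewrite ger0_norm ?exprn_ge0 // exprn_ilt1 //; lra.
  exact: (cvg_geometric (2 * D) q1).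
have GW : (fun n => N2 (fun x => G n x - W x)) @ \oo --> 0%E.
  have tol0E : (fun n => (2 * D * ((2 : R)^-1 ^+ 3) ^+ n)%:E) @ \oo --> 0%E.
    by apply: cvg_EFin; [exact: nearW|exact: tol0].
  apply: squeeze_cvge (cvg_cst 0%E) tol0E; apply: nearW => n.
  by rewrite n2_ge0 /=; exact: hW.
exists W, G; split=> //.
  split=> //; split=> //.
  move=> del del0; have d2 : 0 < del / 2 by rewrite divr_gt0.
  have /cvgrPdist_lt /(_ _ d2)[N0 _ hN0] := tol0.
  have key n m : (N0 <= n)%N -> (n <= m)%N -> E (G m \- G n) (G m \- G n) < del / 2.
    move=> Nn nm; have := hN0 n Nn; rewrite /= sub0r normrN.
    move=> /(le_lt_trans (ler_norm _)); apply: le_lt_trans.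
    by apply: le_trans (GD _ _ nm); rewrite lerDl l2sq_ge0.
  exists N0 => n m Nn Nm; have [nm|/ltnW mn] := leqP n m.
    have := energy_sym (GC n) (GC m); have := key _ _ Nn nm; lra.
  by have := key _ _ Nm mn; lra.
(* The inequality passes to the limit through the positive part of [hl m - W]: its L2 norm is
   constant in [n] and is dominated by errors that vanish. *)
have hlW m : {ae mu, forall x, F x -> hl m x <= W x}.
  pose f x := Num.max (hl m x - W x) 0.
  have mhl : measurable_fun [set: borel H] (hl m) by have [] := ha m.
  have mf : measurable_fun [set: borel H] (f : borel H -> R).
    apply: measurable_maxr; last exact: measurable_cst.
    exact: measurable_funB.
  have mB n : measurable_fun [set: borel H] (fun x => h m n x - hl m x).
    by apply: measurable_funB => //; exact: (measurable_Cb1 (hC m n)).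
  have mC n : measurable_fun [set: borel H] (fun x => G n x - W x).
    by apply: measurable_funB => //; exact: (measurable_Cb1 (GC n)).
  have c1 : (fun n => N2 (fun x => h m (nu m n) x - hl m x)) @ \oo --> 0%E.
    have := app_n2 (ha m) => c; apply: (cvg_comp _ _ _ c).
    move=> A [M _ hM]; exists M => // n /= Mn; apply: hM => /=.
    by rewrite (leq_trans Mn) // leq_addr.
  have c2 : (fun n => 2%:E * N2 (fun x => h m (nu m n) x - hl m x)%R
      + 2%:E * N2 (fun x => G n x - W x)%R)%E @ \oo --> 0%E.
    rewrite -[X in _ --> X](_ : 2%:E * 0 + 2%:E * 0 = 0)%E; last by rewrite !mule0 adde0.
    by apply: cvgeD; [rewrite !mule0|exact: cvgeZl|exact: cvgeZl].
  have c3 : (fun _ : nat => N2 f) @ \oo --> 0%E.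
    apply: (squeeze_cvge _ (cvg_cst 0%E) c2); exists m.+1 => // n /= mn.
    rewrite n2_ge0 /=; apply: n2_lin2 => //.
    move=> x _.
    have hG : h m (nu m n) x <= G n x.
      rewrite /G (bigD1 (Ordinal mn)) //= lerDl sumr_ge0 // => i _; exact: chi_ge0.
    have := sqrD_split (hl m x - h m (nu m n) x) (G n x - W x) ltr01; rewrite invr1.
    rewrite (_ : (h m (nu m n) x - hl m x) ^+ 2 = (hl m x - h m (nu m n) x) ^+ 2); last by ring.
    apply: le_trans; rewrite /f; case: (leP (hl m x - W x) 0) => [_|hWl]; first by rewrite expr0n sqr_ge0.
    rewrite ler_pXn2r ?nnegrE ?(ltW hWl) //; lra.
  have f0 : N2 f = 0%E by apply: (cvg_unique _ (cvg_cst _) c3).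
  have := n2_eq0_ae mF mf f0; apply: ae_imp => x hx Fx.
  have := hx Fx; rewrite /f; case: (leP (hl m x - W x) 0) => [|h1 h2]; first by rewrite subr_le0.
  by move: h1; rewrite h2 ltxx.
have h1 : {ae mu, forall x, forall m, (F `\` K m) x -> 1 <= w m x}.
  by apply: ae_all => m; have [] := hwn m.
have h2 : {ae mu, forall x, forall m, F x -> hl m x <= W x} by exact: ae_all.
move: h1 h2; apply: ae_imp2 => x h1 h2 [Fx /existsNP[m /not_implyP[_ nKx]]].
by have := h2 m Fx; rewrite /hl chi1 //; apply: h1.
Qed.

End Capacity.

(* A form with the diagonal of E, satisfying the sector condition in
   AM-GM form, and annihilated by constants in its second argument. *)
Record sector_form {R : realType} {H : completeNormedModType R}
    (E E' : (H -> R) -> (H -> R) -> R) : Prop := {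
  sf_diag : forall u, Cb1 u -> E' u u = E u u ;
  sf_add : forall u v w, Cb1 u -> Cb1 v -> Cb1 w -> E' u (v \+ w) = E' u v + E' u w ;
  sf_bound : exists2 C, 0 <= C & forall u v (l : R), Cb1 u -> Cb1 v -> 0 < l ->
    `|E' u v| <= C * (l * E u u + l^-1 * E v v) ;
  sf_cst : forall u (c : R), Cb1 u -> E' u (fun=> c) = 0 }.

(** * Closures of two forms with a common diagonal *)

Section Nests.
Context {R : realType} {H : completeNormedModType R}.
Variables (mu : probability (borel H) R) (F : set H).
Hypothesis mF : measurable (F : set (borel H)).
Variables E E' : (H -> R) -> (H -> R) -> R.
Hypothesis hE : energy_form mu F E.
Hypothesis hE' : sector_form E E'.
Implicit Types (u v w g : H -> R) (un vn : nat -> H -> R) (K : set H).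

Let N2 (u : H -> R) : \bar R := @n2 _ (borel H) R mu F u.

(** This replaces Cauchy-Schwarz for a nonsymmetric form: [a] is bounded because it converges, so
    [l] can be fixed small before [d] is used. *)
Lemma amgm_cvg0 (a d b : nat -> R) (C : R) : 0 <= C -> (forall n, 0 <= a n) ->
  (forall n, 0 <= d n) -> cvgn a -> d @ \oo --> 0 ->
  (forall n l, 0 < l -> `|b n| <= C * (l * a n + l^-1 * d n)) -> b @ \oo --> 0.
Proof.
move=> C0 a0 d0 cva /cvgrPdist_lt cd h; have /cvgrPdist_lt ca := cva; apply/cvgrPdist_lt => eps e0.
pose M := limn a + 1.
have M0 : 0 < M.
  have : 0 <= limn a by apply: (limr_ge cva); exact: nearW.
  by rewrite /M; lra.
pose l := eps / (2 * (C + 1) * M).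
have C1 : 0 < C + 1 by lra.
have l0 : 0 < l by rewrite divr_gt0 // !mulr_gt0.
have := cd (l * (eps / (2 * (C + 1)))) (mulr_gt0 l0 _); rewrite divr_gt0 ?mulr_gt0 //.
move=> /(_ isT); apply: filterS2 (ca 1 ltr01) => n; rewrite !sub0r !normrN.
move=> an; rewrite ger0_norm // => dn.
have aM : a n <= M by move: an; rewrite ltr_norml /M => /andP[]; lra.
apply: (le_lt_trans (h n l l0)).
have h1 : l * a n <= eps / (2 * (C + 1)).
  have -> : eps / (2 * (C + 1)) = l * M by rewrite /l; field; rewrite !gt_eqF.
  by rewrite ler_wpM2l // ltW.
have h2 : l^-1 * d n < eps / (2 * (C + 1)) by rewrite mulrC ltr_pdivrMr // mulrC.
have h3 : l * a n + l^-1 * d n < eps / (C + 1).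
  have -> : eps / (C + 1) = eps / (2 * (C + 1)) + eps / (2 * (C + 1)) by field; rewrite gt_eqF.
  by rewrite ler_ltD.
apply: (@le_lt_trans _ _ (C * (eps / (C + 1)))); first by rewrite ler_wpM2l // ltW.
by rewrite mulrA ltr_pdivrMr // mulrC ltr_pM2l //; lra.
Qed.

Lemma sector_Cauchy un : (forall n, Cb1 (un n)) -> form_Cauchy E' un <-> form_Cauchy E un.
Proof.
move=> hu; have e n m : E' (un n \- un m) (un n \- un m) = E (un n \- un m) (un n \- un m).
  exact: (sf_diag hE' (Cb1B (hu n) (hu m))).
by split=> h eps e0; have [N hN] := h eps e0; exists N => n m Nn Nm; have := hN n m Nn Nm; rewrite e.
Qed.

Lemma sector_approximates un u : approximates mu F E' un u <-> approximates mu F E un u.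
Proof. by split=> -[h1 h2 h3]; split=> //; apply/(sector_Cauchy h1). Qed.

Lemma sector_dom u : dom mu F E' u <-> dom mu F E u.
Proof. by split=> -[h1 [un h2]]; split=> //; exists un; apply/sector_approximates. Qed.

Lemma app_dom un u : app mu F E un u -> dom mu F E u.
Proof.
move=> h; split; last by exists un; exact: h.1.
by split; [exact: h.2|exact: (app_n2_lty mF h)].
Qed.

Lemma dom_app u : dom mu F E u -> exists un, app mu F E un u.
Proof. by move=> [[mu' _] [un h]]; exists un. Qed.

Hypothesis cE' : closable mu F E'.

Lemma closable_null un : app mu F E un (fun=> 0) -> (fun n => E (un n) (un n)) @ \oo --> 0.
Proof.
move=> h; have hC n := app_Cb1 n h.
have c1 : form_Cauchy E' un by apply/(sector_Cauchy hC); exact: (app_cauchy h).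
have c2 : L2_cvg mu F un (fun=> 0) by case: h => [[]].
have := cE' hC c1 c2; apply: cvg_trans; apply: near_eq_cvg; apply: nearW => n.
by rewrite (sf_diag hE' (hC n)).
Qed.

Lemma app_diff0 un vn u : app mu F E un u -> app mu F E vn u ->
  app mu F E (fun n => vn n \- un n) (fun=> 0).
Proof.
move=> hu hv; have := app_sub mF hE hv hu.
by have -> : u \- u = (fun=> 0) by apply/funext => x /=; rewrite subrr.
Qed.

Lemma form_val_diag u (a : R) : form_val mu F E' u u a ->
  exists2 un, app mu F E un u & (fun n => E (un n) (un n)) @ \oo --> a.
Proof.
move=> [[[mu' _] _] _ [un [vn [/sector_approximates au /sector_approximates av c]]]].
have hu : app mu F E un u by [].
have hv : app mu F E vn u by [].
exists un => //.
have hd := app_diff0 hu hv.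
have hun n := app_Cb1 n hu; have hdn n := app_Cb1 n hd.
have [C C0 hC] := sf_bound hE'.
have c0 : (fun n => E' (un n) (vn n \- un n)) @ \oo --> 0.
  apply: (amgm_cvg0 C0 _ _ (app_E_cvg hE hu) (closable_null hd)).
  - by move=> n; exact: (en_ge0 hE (hun n)).
  - by move=> n; exact: (en_ge0 hE (hdn n)).
  - by move=> n l l0; exact: (hC _ _ _ (hun n) (hdn n) l0).
have c1 : (fun n => E' (un n) (vn n) - E' (un n) (vn n \- un n)) @ \oo --> a.
  by rewrite -[X in _ --> X]subr0; exact: cvgB c c0.
apply: (cvg_trans _ c1); apply: near_eq_cvg; apply: nearW => n /=.
have -> : vn n = un n \+ (vn n \- un n) by apply/funext => x /=; rewrite subrKC.
rewrite (sf_add hE' (hun n) (hun n) (hdn n)) (sf_diag hE' (hun n)).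
have -> : un n \+ (vn n \- un n) \- un n = vn n \- un n by apply/funext => x /=; ring.
by rewrite addrK.
Qed.

(** The approximants of the constant can be replaced by the constant itself. This is where constants
    annihilate the whole closure, which invariance rests on. *)
Lemma form_val_cst u (c a : R) : form_val mu F E' u (fun=> c) a -> a = 0.
Proof.
move=> [[[mu' _] _] _ [un [vn [/sector_approximates au /sector_approximates av ca]]]].
have hu : app mu F E un u by [].
have hv : app mu F E vn (fun=> c) by split=> //; exact: measurable_cst.
have hc := app_const hE (Cb1_cst c).
have hd := app_diff0 hc hv.
have hun n := app_Cb1 n hu; have hdn n := app_Cb1 n hd.
have [C C0 hC] := sf_bound hE'.
have c0 : (fun n => E' (un n) (vn n \- (fun=> c))) @ \oo --> 0.
  apply: (amgm_cvg0 C0 _ _ (app_E_cvg hE hu) (closable_null hd)).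
  - by move=> n; exact: (en_ge0 hE (hun n)).
  - by move=> n; exact: (en_ge0 hE (hdn n)).
  - by move=> n l l0; exact: (hC _ _ _ (hun n) (hdn n) l0).
suff c2 : (fun n => E' (un n) (vn n)) @ \oo --> (0 : R) by exact: (cvg_unique _ ca c2).
apply: (cvg_trans _ c0); apply: near_eq_cvg; apply: nearW => n /=.
have -> : E' (un n) (vn n) = E' (un n) ((fun=> c) \+ (vn n \- (fun=> c))).
  by congr (E' _ _); apply/funext => x /=; rewrite subrKC.
by rewrite (sf_add hE' (hun n) (Cb1_cst c) (hdn n)) (sf_cst hE' c (hun n)) add0r.
Qed.

Lemma L2dot_n2 u : L2dot mu F u u = fine (N2 u).
Proof. by rewrite /L2dot /Rintegral /N2 /n2; congr fine; apply: eq_integral => x _; rewrite expr2. Qed.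

(** The density property of the nest is applied to the constant 1: if [v] vanishes off [Fk k] and is
    close to 1, then [1 - v] is a capacity test function. *)
Lemma nest_capsmall (Fk : nat -> set H) (eps : R) : nest mu F E' Fk -> 0 < eps ->
  exists k, capsmall mu F E eps (Fk k).
Proof.
move=> [_ _ hd] e0.
have d1 : dom mu F E' (fun=> 1).
  by apply/sector_dom; exact: (app_dom (app_const hE (Cb1_cst 1))).
have [k [v [dv v0 [a fa lta]]]] := hd _ d1 _ e0; exists k.
have [un hu cu] := form_val_diag fa.
have c : (fun n => Q1 mu F E (un n)) @ \oo --> a + L2dot mu F ((fun=> 1) \- v) ((fun=> 1) \- v).
  by rewrite L2dot_n2; apply: cvgD => //; exact: (app_l2sq_cvg mF hu).
have [N _ hN] : \forall n \near \oo, Q1 mu F E (un n) < eps.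
  by apply: (cvgr_lt _ c); exact: lta.
(* The sequence is shifted because [capsmall] bounds all of its members, not only the late ones. *)
exists ((fun=> 1) \- v), (fun n => un (N + n)%N); split.
- exact: app_shift.
- by move=> n; apply: hN; rewrite /= leq_addr.
- by move: v0; apply: ae_imp => x h /h /= ->; rewrite subr0.
Qed.

End Nests.

(** * A countable base and the topological support *)

Section CountableBasis.
Context {R : realType} {H : completeNormedModType R} {ip : H -> H -> R} {e : nat -> H}.
Hypotheses (hip : inner_product ip) (he : orthonormal_basis ip e).

(** A countable base of the topology: the centres are rational combinations of the orthonormal
    basis, and integers that encode nothing give the empty set. *)
Definition rat_ball (n : nat) : set H :=
  match unpickle n : option (seq rat * nat) with
  | Some sk => [set x | `|x - \sum_(i < size sk.1) ratr (nth 0 sk.1 i) *: e i| < sk.2.+1%:R^-1]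
  | None => set0
  end.

Lemma open_rat_ball n : open (rat_ball n).
Proof.
rewrite /rat_ball; case: unpickle => [[s k]|]; last exact: open0.
set c := \sum_(i < _) _.
rewrite (_ : [set x | _] = (fun x : H => `|x - c|) @^-1` [set t | t < k.+1%:R^-1]) //.
apply: (@open_comp _ _ (fun x : H => `|x - c|)); last exact: open_lt.
move=> x _; apply: (@continuous_comp _ _ _ (fun x : H => x - c) (fun x => `|x|)).
  by apply: cvgB; [exact: cvg_id|exact: cvg_cst].
exact: norm_continuous.
Qed.

Lemma rat_combination_dense (x : H) (eps : R) : 0 < eps -> exists s : seq rat,
  `|x - \sum_(i < size s) ratr (nth 0 s i) *: e i| < eps.
Proof.
move=> e0; have e2 : 0 < eps / 2 by rewrite divr_gt0.
have /cvgrPdist_lt /(_ _ e2)[n _ hn] := cvg_trunc he x.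
have d0 : 0 < eps / 2 / n.+1%:R by rewrite divr_gt0.
set del := eps / 2 / n.+1%:R in d0.
have hq (i : nat) : exists q : rat, `|ip x (e i) - ratr q| < del.
  have : ip x (e i) < ip x (e i) + del by rewrite ltrDl.
  move=> /rat_in_itvoo[q]; rewrite in_itv /= => /andP[q1 q2]; exists q.
  by rewrite ltr_norml; lra.
have [q {}hq] := choice hq.
exists (mkseq q n); rewrite size_mkseq.
have -> : x - \sum_(i < n) ratr (nth 0 (mkseq q n) i) *: e i =
    (x - trunc n x (e := e) (ip := ip)) + \sum_(i < n) (ip x (e i) - ratr (q i)) *: e i.
  rewrite -addrA; congr (_ + _); rewrite /trunc -sumrN -[in RHS]sumrN -big_split /=.
  by apply: eq_bigr => i _; rewrite nth_mkseq // scalerBl addKr.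
rewrite (le_lt_trans (ler_normD _ _)) // (splitr eps) ltr_leD //.
  exact: (hn n (leqnn n)).
apply: le_trans (ler_norm_sum _ _ _) _.
apply: (@le_trans _ _ (\sum_(i < n) del)).
  apply: ler_sum => i _; rewrite normrZ (norm_basis hip he) mulr1 ltW //; exact: hq.
rewrite sumr_const card_ord -(mulr_natr del) /del mulrAC ler_pdivrMr // ler_pM2l // ler_nat.
exact: leqnSn.
Qed.

Lemma rat_ball_basis (V : set H) x : open V -> V x ->
  exists n, rat_ball n x /\ rat_ball n `<=` V.
Proof.
rewrite openE => oV Vx.
have /nbhs_ballP[r r0 hr] := oV x Vx.
have [k hk] : exists k : nat, k.+1%:R^-1 < r / 2.
  have r2 : 0 < r / 2 by rewrite divr_gt0.
  have /cvgrPdist_lt /(_ _ r2)[k _ hk] := cvg_harmonic (R := R).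
  exists k; have := hk k (leqnn k).
  by rewrite /= /harmonic sub0r normrN ger0_norm // invr_ge0.
have k0 : 0 < k.+1%:R^-1 :> R by rewrite invr_gt0.
have [s hs] := rat_combination_dense x k0.
exists (pickle (s, k)); rewrite /rat_ball pickleK /=; split=> // y hy.
apply: hr; rewrite -ball_normE /ball_ /=.
have -> : x - y = (x - \sum_(i < size s) ratr (nth 0 s i) *: e i) -
   (y - \sum_(i < size s) ratr (nth 0 s i) *: e i) by rewrite opprB addrA subrK.
by rewrite (le_lt_trans (ler_normB _ _)) // (lt_trans (ltrD hs hy)) // [ltRHS]splitr ltrD.
Qed.

Variable mu : probability (borel H) R.

Lemma measurable_openH (U : set H) : open U -> measurable (U : set (borel H)).
Proof. by move=> oU; apply: sub_sigma_algebra. Qed.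

Lemma measurable_closedH (U : set H) : closed U -> measurable (U : set (borel H)).
Proof.
by move=> cU; rewrite -(setCK U); apply: measurableC; apply: measurable_openH; exact: closed_openC.
Qed.

Lemma supp_closed (G : set H) : closed (supp mu G).
Proof.
move=> x hx U oU Ux.
have [y [Sy Uy]] := hx U (open_nbhs_nbhs (conj oU Ux)).
exact: Sy.
Qed.

Lemma supp_sub (G : set H) : closed G -> supp mu G `<=` G.
Proof.
move=> cG x hx; apply: contrapT => nGx.
have := hx (~` G) (closed_openC cG) nGx.
by rewrite setICl measure0 ltxx.
Qed.

(** A Lindelof argument: a point of [G] outside the support has a neighbourhood from the countable
    base that meets [G] in a null set. *)
Lemma supp_null (G : set H) : measurable (G : set (borel H)) -> mu (G `\` supp mu G) = 0%E.
Proof.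
move=> mG.
pose B n := if pselect (mu (rat_ball n `&` G) = 0%E) then rat_ball n `&` G else set0.
have mB n : measurable (B n : set (borel H)).
  rewrite /B; case: (pselect (mu (rat_ball n `&` G) = 0%E)) => h //=; apply: measurableI => //.
  exact: (measurable_openH (open_rat_ball n)).
have B0 n : mu (B n) = 0%E by rewrite /B; case: (pselect (mu (rat_ball n `&` G) = 0%E)) => //= h; rewrite measure0.
have mS : measurable (supp mu G : set (borel H)) := measurable_closedH (@supp_closed G).
apply/eqP; rewrite eq_le measure_ge0 andbT.
have sub : G `\` supp mu G `<=` \bigcup_n B n.
  move=> x [Gx nsx]; have /existsNP[U /not_implyP[oU hU]] := nsx.
  have /not_implyP[Ux hU0] := hU.
  have U0 : (mu (U `&` G) <= 0)%E by rewrite leNgt; apply/negP.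
  have [n [nx nU]] := rat_ball_basis oU Ux.
  exists n => //; rewrite /B; case: (pselect (mu (rat_ball n `&` G) = 0%E)) => /= [h //|[]].
  apply/eqP; rewrite eq_le measure_ge0 andbT (le_trans _ U0) //.
  apply: le_measure; rewrite ?inE //.
  - by apply: measurableI => //; exact: (measurable_openH (open_rat_ball n)).
  - by apply: measurableI => //; exact: measurable_openH.
  - by move=> y [/nU ? ?].
have mU : measurable (\bigcup_n B n : set (borel H)) by exact: bigcupT_measurable.
rewrite (@le_trans _ _ (mu (\bigcup_n B n))) //.
  by apply: le_measure; rewrite ?inE //; exact: measurableD.
apply: le_trans (measure_sigma_subadditive mu mB mU (@subset_refl _ _)) _.
by rewrite eseries0 // => n _ _; exact: B0.
Qed.

End CountableBasis.

(** * Exceptional sets in terms of capacity *)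

Section Exceptional.
Context {R : realType} {H : completeNormedModType R}.
Variables (mu : probability (borel H) R) (F : set H).
Hypothesis mF : measurable (F : set (borel H)).
Variables E E' : (H -> R) -> (H -> R) -> R.
Hypothesis hE : energy_form mu F E.
Implicit Types (u v w g : H -> R) (un vn : nat -> H -> R) (K : set H).

(** Given [u], take a bounded approximant [g] and a capacity function [w]. Then [g - g * chi w]
    vanishes almost everywhere off [Fk k], and differs from [u] by [u - g] and the small product
    [g * chi w]. *)
Lemma capsmall_nest (Fk : nat -> set H) : (forall k, closed (Fk k) /\ Fk k `<=` F) ->
  (forall k, Fk k `<=` Fk k.+1) ->
  (forall eps, 0 < eps -> exists k, capsmall mu F E eps (Fk k)) -> nest mu F E Fk.
Proof.
move=> h1 h2 hc; split=> // u du eps e0.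
have [un hu] := dom_app du; have hun n := app_Cb1 n hu.
have e16 : 0 < eps / 16 by rewrite divr_gt0.
have [N hN] := app_Q1_cauchy mF hu e16.
pose g := un N; have hg : Cb1 g := hun N.
have [C C0 hC] := en_M hE hg; have [[M hM] _ _] := hg.
pose D := C + M ^+ 2 + 1.
have D0 : 0 < D by rewrite /D; have := sqr_ge0 M; lra.
(* The cutoff costs 4, multiplication by [g] costs [D] and the sum costs 2, leaving [eps / 4]; the
   other half costs at most [eps / 8]. *)
have ed : 0 < eps / (32 * D) by rewrite divr_gt0 // mulr_gt0.
have [k [w [wn [hw qw w1]]]] := hc _ ed.
have hwn n := app_Cb1 n hw.
have hchi := app_chi mF hE hw.
have hgc := app_mul mF hE hg hchi.
have hv := app_sub mF hE (app_const hE hg) hgc.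
pose v x := g x - g x * chi (w x).
exists k, v; split.
- exact: (app_dom mF hv).
- move: w1; apply: ae_imp => x h /h wx; rewrite /v chi1 // mulr1 subrr //.
have huv := app_sub mF hE hu hv.
pose dn n : H -> R := un n \- (g \- (fun x => g x * chi (wn n x))).
have hdn n : Cb1 (dn n) := app_Cb1 n huv.
have cE : cvgn (fun n => E (dn n) (dn n)) := app_E_cvg hE huv.
have cL := app_l2sq_cvg mF huv.
exists (limn (fun n => E (dn n) (dn n))).
  split; [exact: (app_dom mF huv)|exact: (app_dom mF huv)|].
  by exists dn, dn; split; [exact: huv.1|exact: huv.1|exact: cE].
rewrite L2dot_n2.
have cQ : (fun n => Q1 mu F E (dn n)) @ \oo -->
    limn (fun n => E (dn n) (dn n)) + fine (@n2 _ (borel H) R mu F (u \- v)).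
  by apply: cvgD.
(* Passing to the limit turns strict bounds into weak ones, hence the margin. *)
apply: (@le_lt_trans _ _ (eps / 2)); last by lra.
rewrite -(cvg_lim _ cQ) //; apply: limr_le; first by apply/cvg_ex; eexists; exact: cQ.
exists N => // n /= Nn.
have hwc : Cb1 (fun x => chi (wn n x)) := Cb1_chi (hwn n).
have hgw : Cb1 (fun x => g x * chi (wn n x)) := Cb1M hg hwc.
have -> : dn n = (un n \- g) \+ (fun x => g x * chi (wn n x)).
  by apply/funext => x /=; rewrite /dn /=; ring.
apply: le_trans (Q1D mF hE (Cb1B (hun n) hg) hgw) _.
have := hN n N Nn (leqnn N).
have q1 := Q1_chi mF hE (hwn n).
have q2 : Q1 mu F E (fun x => g x * chi (wn n x)) <= D * Q1 mu F E (fun x => chi (wn n x)).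
  have a1 := hC _ hwc.
  have a2 : l2sq mu F (fun x => g x * chi (wn n x)) <=
      M ^+ 2 * l2sq mu F (fun x => chi (wn n x)) + 0 * l2sq mu F (fun x => chi (wn n x)).
    apply: (@Rintegral_lin2 _ (borel H)) => //.
    - exact: (bmfunX2 (bmfun_Cb1 hwc)).
    - exact: (bmfunX2 (bmfun_Cb1 hwc)).
    - exact: (bmfunX2 (bmfun_Cb1 hgw)).
    - by move=> x _; rewrite mul0r addr0 exprMn ler_wpM2r ?sqr_ge0 // ler_sqr_norm.
  have b1 := en_ge0 hE hwc; have b2 := l2sq_ge0 mu F (fun x => chi (wn n x)).
  have b3 := mulr_ge0 (sqr_ge0 M) b1.
  by rewrite /Q1 /D; lra.
have q3 : D * Q1 mu F E (fun x => chi (wn n x)) <= eps / 8.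
  apply: (@le_trans _ _ (D * (4 * (eps / (32 * D))))).
    by rewrite ler_wpM2l ?(ltW D0) // (le_trans q1) // ler_wpM2l // ltW.
  by rewrite le_eqVlt; apply/orP; left; apply/eqP; field; rewrite gt_eqF.
by rewrite -/g; lra.
Qed.

Definition capnest (Fk : nat -> set H) : Prop :=
  [/\ forall k, closed (Fk k) /\ Fk k `<=` F, forall k, Fk k `<=` Fk k.+1 &
    forall eps, 0 < eps -> exists k, capsmall mu F E eps (Fk k)].

(** A diagonal nest: the sets [Fm m (kap m j)] have capacity bounds that [capsmall_bigcap] can sum
    over [m]. The factor 1/17 cancels the constant of that lemma, and [kap], a sum of the chosen
    indices, is at least each of them and nondecreasing in [j]. *)
Lemma exceptional_bigcup (N : nat -> set H) (Fm : nat -> nat -> set H) :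
  (forall m, capnest (Fm m)) -> (forall m, N m `<=` F `\` \bigcup_k Fm m k) ->
  exceptional mu F E (\bigcup_m N m).
Proof.
move=> hF hN.
pose eps (j : nat) : R := 17^-1 * j.+1%:R^-1.
have eps0 j : 0 < eps j by rewrite mulr_gt0 // invr_gt0.
have hk m j : exists k, capsmall mu F E (eps j * (2^-1 ^+ 5) ^+ m) (Fm m k).
  by have [_ _ h] := hF m; apply: h; rewrite mulr_gt0 // !exprn_gt0.
pose k0 m j := projT1 (choice (hk m)) j.
have hk0 m j : capsmall mu F E (eps j * (2^-1 ^+ 5) ^+ m) (Fm m (k0 m j)).
  exact: (projT2 (choice (hk m)) j).
pose kap m j := (\sum_(i < j.+1) k0 m i)%N.
have incr m a b : (a <= b)%N -> Fm m a `<=` Fm m b.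
  move=> /subnKC <-; elim: (b - a)%N => [|c ih]; first by rewrite addn0.
  by rewrite addnS; apply: (subset_trans ih); have [_ h _] := hF m; exact: h.
have kapS m j : (k0 m j <= kap m j)%N by rewrite /kap big_ord_recr /= leq_addl.
pose Ej j := \bigcap_m Fm m (kap m j).
exists Ej.
  apply: capsmall_nest => [j|j|d d0].
  - split; first by apply: closed_bigI => m _; have [h _ _] := hF m; exact: (h _).1.
    by move=> x /(_ 0%N I); have [h _ _] := hF 0%N; exact: (h _).2.
  - move=> x hx m _; apply: (incr m (kap m j)); last exact: hx.
    by rewrite /kap [X in (_ <= X)%N]big_ord_recr /= leq_addr.
  - have /cvgrPdist_lt /(_ _ d0)[j _ hj] := cvg_harmonic (R := R).
    exists j; have hle : 17 * eps j <= d.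
      rewrite /eps mulrA divff // mul1r ltW //.
      have := hj j (leqnn j); rewrite /= /harmonic sub0r normrN ger0_norm // invr_ge0 //.
    apply: (capsmall_le hle (@subset_refl _ _)).
    apply: (capsmall_bigcap mF hE (eps0 j)) => m.
    exact: (capsmall_le (lexx _) (incr m _ _ (kapS m j)) (hk0 m j)).
move=> x [m _ Nx]; have [Fx nx] := hN m x Nx; split=> // -[j _ /(_ m I) hj].
by apply: nx; exists (kap m j).
Qed.

Context {ip : H -> H -> R} {e : nat -> H}.
Hypotheses (hip : inner_product ip) (he : orthonormal_basis ip e).
Hypothesis hE' : sector_form E E'.
Hypothesis cE' : closable mu F E'.

Lemma nest_capnest (Fk : nat -> set H) : nest mu F E' Fk -> capnest Fk.
Proof.
move=> hn; have [h1 h2 _] := hn; split=> // eps e0.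
exact: (nest_capsmall mF hE hE' cE' hn e0).
Qed.

(* On the support of the restriction of mu to F_k an almost everywhere zero
   function that is continuous on F_k vanishes everywhere. *)
Lemma quasi_continuous_ae0 (f : H -> R) : quasi_continuous mu F E' f ->
  {ae mu, forall x, F x -> f x = 0} ->
  exists2 Fk, capnest Fk & forall k x, Fk k x -> f x = 0.
Proof.
move=> [Fk hn cf] f0; have [h1 h2 hc] := nest_capnest hn.
have mFk k : measurable (Fk k : set (borel H)) := measurable_closedH (h1 k).1.
exists (fun k => supp mu (Fk k)).
  split.
  - move=> k; split; first exact: supp_closed.
    exact: (subset_trans (supp_sub (h1 k).1) (h1 k).2).
  - move=> k x hx U oU Ux; apply: lt_le_trans (hx U oU Ux) _.
    apply: le_measure; rewrite ?inE; try (apply: measurableI => //; exact: measurable_openH).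
    by move=> y [? /h2].
  (* The capacity condition holds only almost everywhere, so the null part lost in passing to the
     support does not affect it. *)
  - move=> eps e0; have [k [w [un [a b c]]]] := hc _ e0; exists k, w, un; split=> //.
    have := ae_null (measurableD (mFk k) (measurable_closedH (@supp_closed _ _ mu (Fk k))))
      (supp_null hip he mu (mFk k)).
    move: c; apply: ae_imp2 => x hx nx [Fx nsx]; apply: hx; split=> // Fkx.
    by apply: nx.
move=> k x sx; apply: contrapT => fx.
have Fkx : Fk k x := supp_sub (h1 k).1 sx.
have /continuousP cfk := cf k.
have onz : open [set t : R | t <> 0].
  have -> : [set t : R | t <> 0] = [set t | t != 0] by apply/seteqP; split=> t /eqP.
  exact: open_neq.
have /open_subspaceP[V oV VD] := cfk _ onz.
have [Vx _] : (V `&` Fk k) x by rewrite VD.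
have := sx V oV Vx; have [A [mA A0 hA]] := f0.
have VA : V `&` Fk k `<=` A.
  rewrite VD => y [fy Fky]; apply: hA => /= hy; apply: fy.
  exact: hy ((h1 k).2 _ Fky).
have mV : measurable (V `&` Fk k : set (borel H)).
  by apply: measurableI => //; exact: measurable_openH.
by rewrite (subset_measure0 mV mA VA A0) ltxx.
Qed.

End Exceptional.

(** * The matrix field and the two forms *)

Lemma seq_cvg_unique {R : realType} (u : nat -> R) (a b : R) :
  u @ \oo --> a -> u @ \oo --> b -> a = b.
Proof. by move=> h1 h2; rewrite -(cvg_lim (@Rhausdorff R) h1) (cvg_lim (@Rhausdorff R) h2). Qed.

Section BreveMatrix.
Context {R : realType} {H : completeNormedModType R} {ip : H -> H -> R} {e : nat -> H}.
Hypotheses (hip : inner_product ip) (he : orthonormal_basis ip e).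

Section BoundedOperator.
Variable S : H -> H.
Hypothesis bS : bounded_operator S.

Lemma bopD x y : S (x + y) = S x + S y.
Proof. by have := bS.1 1 x y; rewrite !scale1r. Qed.

Lemma bop0 : S 0 = 0.
Proof. by have /eqP := bopD 0 0; rewrite addr0 -subr_eq0 opprD addNKr oppr_eq0 => /eqP. Qed.

Lemma bopZ (a : R) x : S (a *: x) = a *: S x.
Proof. by have := bS.1 a x 0; rewrite bop0 !addr0. Qed.

Lemma bopN x : S (- x) = - S x.
Proof. by rewrite -scaleN1r bopZ scaleN1r. Qed.

Lemma bopB x y : S (x - y) = S x - S y.
Proof. by rewrite bopD bopN. Qed.

Lemma bop_sum I r (P : pred I) (F : I -> H) :
  S (\sum_(i <- r | P i) F i) = \sum_(i <- r | P i) S (F i).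
Proof. by elim/big_rec2: _ => [|i _ y _ <-]; rewrite ?bop0 ?bopD. Qed.

Lemma bop_cvg (u : nat -> H) x : u @ \oo --> x -> (fun n => S (u n)) @ \oo --> S x.
Proof.
move=> /cvgrPdist_lt hu; have [M hM] := bS.2; apply/cvgrPdist_lt => eps e0.
have M0 : 0 < `|M| + 1 by rewrite ltr_wpDl.
have := hu (eps / (`|M| + 1)) (divr_gt0 e0 M0); apply: filterS => n hn.
rewrite -bopB (le_lt_trans (hM _)) //.
rewrite (@le_lt_trans _ _ ((`|M| + 1) * `|x - u n|)) //.
  by rewrite ler_wpM2r // (le_trans (ler_norm M)) // lerDl.
by rewrite mulrC -ltr_pdivlMr.
Qed.

Hypothesis antiS : forall i j, ip (S (e j)) (e i) = - ip (S (e i)) (e j).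

Lemma bop_anti x y : ip (S x) y = - ip x (S y).
Proof.
have key n m : ip (S (trunc n x (e := e) (ip := ip))) (trunc m y (e := e) (ip := ip)) =
    - ip (trunc n x (e := e) (ip := ip)) (S (trunc m y (e := e) (ip := ip))).
  rewrite /trunc !bop_sum !(ip_suml hip) -sumrN; apply: eq_bigr => i _.
  rewrite !(ip_sumr hip) -sumrN; apply: eq_bigr => j _.
  by rewrite !bopZ !(ipZl hip) !(ipZr hip) antiS (ipC hip (S (e j))); ring.
have key2 m : ip (S x) (trunc m y (e := e) (ip := ip)) = - ip x (S (trunc m y (e := e) (ip := ip))).
  have c1 : (fun n => ip (S (trunc n x (e := e) (ip := ip))) (trunc m y (e := e) (ip := ip))) @ \oo
      --> ip (S x) (trunc m y (e := e) (ip := ip)).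
    by apply: (ip_cvg_to hip); apply: bop_cvg; exact: cvg_trunc.
  have c2 : (fun n => - ip (trunc n x (e := e) (ip := ip)) (S (trunc m y (e := e) (ip := ip)))) @ \oo
      --> - ip x (S (trunc m y (e := e) (ip := ip))).
    by apply: cvgN; apply: (ip_cvg_to hip); exact: cvg_trunc.
  have c3 : (fun n => ip (S (trunc n x (e := e) (ip := ip))) (trunc m y (e := e) (ip := ip))) @ \oo
      --> - ip x (S (trunc m y (e := e) (ip := ip))).
    by apply: (cvg_trans _ c2); apply: near_eq_cvg; apply: nearW => n; rewrite key.
  exact: (seq_cvg_unique c1 c3).
have c1 : (fun m => ip (trunc m y (e := e) (ip := ip)) (S x)) @ \oo --> ip y (S x).
  by apply: (ip_cvg_to hip); exact: cvg_trunc.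
have c2 : (fun m => - ip (S (trunc m y (e := e) (ip := ip))) x) @ \oo --> - ip (S y) x.
  by apply: cvgN; apply: (ip_cvg_to hip); apply: bop_cvg; exact: cvg_trunc.
rewrite (ipC hip) (ipC hip x).
have c3 : (fun m => ip (trunc m y (e := e) (ip := ip)) (S x)) @ \oo --> - ip (S y) x.
  apply: (cvg_trans _ c2); apply: near_eq_cvg; apply: nearW => n.
  by rewrite /= (ipC hip _ (S x)) key2 (ipC hip x).
exact: (seq_cvg_unique c1 c3).
Qed.

Lemma bop_adjoint y : adjoint ip S y = - S y.
Proof.
have h : [set z | forall x, ip (S x) y = ip x z] (adjoint ip S y).
  by apply: (@xgetPex _ 0); exists (- S y) => x; rewrite bop_anti (ipNr hip).
by apply: (ip_eq hip) => z; rewrite (ipC hip) -h bop_anti (ipNl hip) (ipC hip z).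
Qed.

(** By antisymmetry the coordinates of [S x] are, up to sign, the products of [x] with [S (e i)],
    and Cauchy-Schwarz applies to each of them. *)
Lemma bop_HS (K : R) : (forall n, \sum_(i < n) `|S (e i)| ^+ 2 <= K) ->
  forall x, `|S x| ^+ 2 <= K * `|x| ^+ 2.
Proof.
move=> hK x; have c := parseval_norm hip he (S x); rewrite -(cvg_lim _ c) //.
apply: limr_le; first by apply/cvg_ex; eexists; exact: c.
apply: nearW => n; apply: (@le_trans _ _ (\sum_(i < n) `|S (e i)| ^+ 2 * `|x| ^+ 2)).
  apply: ler_sum => i _; rewrite bop_anti sqrrN mulrC -exprMn.
  by apply: ler_sqr_norm; exact: (cauchy_schwarz hip).
by rewrite -mulr_suml ler_wpM2r ?sqr_ge0.
Qed.

End BoundedOperator.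

Variables (A : H -> H) (mu : probability (borel H) R) (G : set H).
Variables (Ab : H -> H -> H) (ext : nat -> nat -> H -> R).
Hypothesis hA : breve_matrix ip A e mu G Ab ext.
Hypothesis cG : closed G.

Lemma breve_anti x g h : G x -> ip (Ab x g) h = - ip g (Ab x h).
Proof.
move=> Gx; apply: (bop_anti (bA_op hA Gx)) => i j.
exact: (bA_anti hA i j Gx).
Qed.

Lemma breve_bound : exists2 C : R, 0 <= C & forall x g, G x -> `|Ab x g| <= C * `|g|.
Proof.
have := bA_HS hA; set s := ereal_sup _ => slty.
have hs x : G x -> forall n, ((\sum_(i < n) `|Ab x (e i)| ^+ 2)%:E <= s)%E.
  move=> Gx n.
  apply: (@le_trans _ _ (\sum_(i <oo) \sum_(j <oo) (entry ip e Ab i j x ^+ 2)%:E)%E); last first.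
    by apply: ereal_sup_ubound; exists x.
  (* The bound is given on rows of the matrix, whereas [|Ab x (e i)|] sums a column; antisymmetry
     exchanges them. *)
  have -> : (\sum_(i < n) `|Ab x (e i)| ^+ 2)%:E =
      (\sum_(0 <= i < n) \sum_(j <oo) (entry ip e Ab i j x ^+ 2)%:E)%E.
    rewrite big_mkord -sumEFin; apply: eq_bigr => i _.
    apply/esym/cvg_lim => //; have c := parseval_norm hip he (Ab x (e i)).
    have : (fun n => (\sum_(i0 < n) ip (Ab x (e i)) (e i0) ^+ 2)%:E) @ \oo --> (`|Ab x (e i)| ^+ 2)%:E.
      by apply: cvg_EFin; [exact: nearW|exact: c].
    apply: cvg_trans; apply: near_eq_cvg; apply: nearW => m /=.
    rewrite big_mkord -sumEFin; apply: eq_bigr => j _; congr EFin.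
    by rewrite (bA_anti hA i j Gx) sqrrN.
  apply: nneseries_lim_ge => i _ _; apply: nneseries_ge0 => j _ _.
  by rewrite lee_fin sqr_ge0.
pose C := Num.max (fine s) 0.
have C0 : 0 <= C by rewrite le_max lexx orbT.
exists (Num.sqrt C); first exact: sqrtr_ge0.
move=> x g Gx; rewrite -(@ler_pXn2r _ 2) ?nnegrE ?mulr_ge0 ?sqrtr_ge0 //.
rewrite exprMn sqr_sqrtr //; apply: (bop_HS (bA_op hA Gx)) => [i j|n].
  exact: (bA_anti hA i j Gx).
have h := hs x Gx n; have sfin : s \is a fin_num.
  rewrite fin_numElt slty andbT; apply: (lt_le_trans _ h); exact: ltNyr.
by move: h; rewrite -(fineK sfin) lee_fin => h; rewrite /C le_max h.
Qed.

Lemma measurable_ip_borel (f : H -> H) (h : H) :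
  measurable_fun [set: borel H] (f : borel H -> borel H) ->
  measurable_fun [set: borel H] (fun x => ip (f x) h).
Proof.
move=> mf; apply: (@measurableT_comp _ _ _ (borel H) (borel H) _ (fun y => ip y h)) => //.
apply: measurable_continuous; exact: (ip_continuous hip).
Qed.

Lemma measurable_entry i j : measurable_fun (G : set (borel H)) (fun x => ip (Ab x (e j)) (e i)).
Proof.
have [hC hext] := bA_Cb1 hA i j.
apply: (@eq_measurable_fun _ _ (borel H) _ G (ext i j)).
  by move=> x; rewrite inE => Gx; rewrite hext.
by apply: measurable_funTS; exact: (measurable_Cb1 hC).
Qed.

(** Antisymmetry moves [Ab x] from the varying vector [g x] to the fixed [e i], after which Parseval
    involves only entries. *)
Lemma measurable_breve_ip (g : H -> H) i :
  (forall h : H, measurable_fun (G : set (borel H)) (fun x => ip (g x) h)) ->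
  measurable_fun (G : set (borel H)) (fun x => ip (Ab x (g x)) (e i)).
Proof.
move=> mg; apply: (@measurable_fun_cvg _ (borel H) _ G
  (fun n x => - \sum_(j < n) ip (g x) (e j) * ip (Ab x (e i)) (e j))).
  move=> n; apply: measurable_funN; apply: measurable_sum => j.
  by apply: measurable_funM; [exact: mg|exact: measurable_entry].
by move=> x Gx; rewrite (breve_anti _ _ Gx); apply: cvgN; exact: (parseval hip he).
Qed.

Lemma measurable_breve (g h : H -> H) :
  (forall k : H, measurable_fun (G : set (borel H)) (fun x => ip (g x) k)) ->
  (forall k : H, measurable_fun (G : set (borel H)) (fun x => ip (h x) k)) ->
  measurable_fun (G : set (borel H)) (fun x => ip (Ab x (g x)) (h x)).
Proof.
move=> mg mh; apply: (@measurable_fun_cvg _ (borel H) _ G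
  (fun n x => \sum_(i < n) ip (Ab x (g x)) (e i) * ip (h x) (e i))).
  move=> n; apply: measurable_sum => i.
  by apply: measurable_funM; [exact: measurable_breve_ip|exact: mh].
by move=> x Gx; exact: (parseval hip he).
Qed.

Section ReflectionField.
Variable eta : H -> H.
Hypothesis meta : measurable_fun [set: borel H] (eta : borel H -> borel H).

Lemma Abar_star_nuE x : G x -> Abar_star_nu ip Ab eta x = Ab x (eta x) - eta x.
Proof.
move=> Gx; rewrite /Abar_star_nu (bop_adjoint (bA_op hA Gx)).
  by rewrite (bopN (bA_op hA Gx)) opprK.
by move=> i j; exact: (bA_anti hA i j Gx).
Qed.

Lemma Abar_star_nu_bound : exists2 C : R, 0 <= C &
  forall x, G x -> `|Abar_star_nu ip Ab eta x| <= C * `|eta x|.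
Proof.
have [C C0 hC] := breve_bound; exists (C + 1); first by rewrite addr_ge0.
move=> x Gx; rewrite Abar_star_nuE // (le_trans (ler_normB _ _)) //.
by rewrite mulrDl mul1r lerD // hC.
Qed.

Lemma measurable_Abar_star_nu (l : H) :
  measurable_fun (G : set (borel H)) (fun x => ip l (Abar_star_nu ip Ab eta x)).
Proof.
apply: (@eq_measurable_fun _ _ (borel H) _ G (fun x => ip (Ab x (eta x)) l - ip (eta x) l)).
  by move=> x; rewrite inE => Gx; rewrite Abar_star_nuE // (ipBr hip) !(ipC hip l).
have me k : measurable_fun (G : set (borel H)) (fun x => ip (eta x) k).
  by apply: measurable_funTS; exact: measurable_ip_borel.
apply: measurable_funB => //; exact: (@measurable_breve eta (fun=> l)).
Qed.

End ReflectionField.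

Section Forms.
Variable F : set H.
Hypothesis FE : F = supp mu G.

Let mG : measurable (G : set (borel H)) := measurable_closedH cG.
Let FG : F `<=` G. Proof. by rewrite FE; exact: supp_sub. Qed.
Let mF : measurable (F : set (borel H)).
Proof. by rewrite FE; apply: measurable_closedH; exact: supp_closed. Qed.
Let GF0 : mu (G `\` F) = 0%E. Proof. by rewrite FE; exact: (supp_null hip he mu mG). Qed.

Lemma energy_form_Gamma : energy_form mu F (form_Gamma ip mu G).
Proof.
apply: (@energy_form_Dg R H ip hip mu F G mF mG FG GF0 (grad ip)).
- by move=> u v x; exact: (gradD hip he).
- by move=> u v x; exact: (gradB hip he).
- by move=> u v x; exact: (gradM hip he).
- by move=> u x; exact: (grad_chi hip he).
- by move=> c x; exact: (grad_cst hip).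
- by move=> u; exact: (grad_bound hip he).
- by move=> u v; exact: (measurable_grad_ip hip he).
Qed.

Section SectorForm.
Variable Dg : (H -> R) -> H -> H.
Hypothesis DgD : forall u v x, Cb1 u -> Cb1 v ->
  Dg (fun x => u x + v x) x = Dg u x + Dg v x.
Hypothesis Dgcst : forall (c : R) x, Dg (fun=> c) x = 0.
Hypothesis Dgbound : forall u, Cb1 u -> exists2 M, 0 <= M & forall x, `|Dg u x| <= M.
Variable M : H -> H -> H.
Hypothesis MDg : forall u v, Cb1 u -> Cb1 v ->
  measurable_fun (G : set (borel H)) (fun x => ip (M x (Dg u x)) (Dg v x)).
Hypothesis Mdiag : forall x g, G x -> ip (M x g) g = ip g g.
Hypothesis Mbound : exists2 C, 0 <= C & forall x g, G x -> `|M x g| <= C * `|g|.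

Let E (u v : H -> R) : R := 1 / 2 * \int[mu]_(x in G) ip (Dg u x) (Dg v x).
Let E' (u v : H -> R) : R := 1 / 2 * \int[mu]_(x in G) ip (M x (Dg u x)) (Dg v x).

Lemma sector_integrable u v : Cb1 u -> Cb1 v ->
  mu.-integrable (G : set (borel H)) (EFin \o (fun x => ip (M x (Dg u x)) (Dg v x))).
Proof.
move=> hu hv; apply: measurable_bounded_integrable => //.
- by rewrite ltey_eq fin_num_measure.
- exact: MDg.
have [C C0 hC] := Mbound; have [N N0 hN] := Dgbound hu; have [N' N'0 hN'] := Dgbound hv.
exists (C * N * N'); split; first exact: num_real.
move=> t ht x Gx /=; rewrite (le_trans (cauchy_schwarz hip _ _)) // (le_trans _ (ltW ht)) //.
by rewrite ler_pM // (le_trans (hC _ _ Gx)) // ler_wpM2l.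
Qed.

Lemma sector_form_Dg : (forall u, Cb1 u -> @bounded_mfun _ (borel H) R (fun x => ip (Dg u x) (Dg u x))) ->
  sector_form E E'.
Proof.
move=> bm; split.
- move=> u hu; rewrite /E /E'; congr (_ * _); apply: eq_Rintegral => x; rewrite inE => Gx.
  exact: Mdiag.
- move=> u v w hu hv hw; rewrite /E' -mulrDr; congr (_ * _).
  rewrite -RintegralD //; [|exact: sector_integrable..].
  by apply: eq_Rintegral => x _; rewrite [Dg (v \+ w) x]DgD // (ipDr hip).
- have [C C0 hC] := Mbound; exists C => // u v l hu hv l0.
  have hnn w : Cb1 w -> mu.-integrable (G : set (borel H)) (EFin \o (fun x => ip (Dg w x) (Dg w x))).
    by move=> hw; apply: (bmfun_integrable mu mG (bm w hw)).
  have h1 : `|\int[mu]_(x in G) ip (M x (Dg u x)) (Dg v x)| <=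
     \int[mu]_(x in G) (C * (l * ip (Dg u x) (Dg u x) + l^-1 * ip (Dg v x) (Dg v x))).
    apply: le_trans (le_normr_Rintegral mG (sector_integrable hu hv)) _.
    apply: le_Rintegral => //.
    + by have := integrable_norm (sector_integrable hu hv).
    + apply: (bmfun_integrable mu mG); apply: bmfunZ.
      by apply: bmfunD; apply: bmfunZ; exact: bm.
    move=> x Gx; rewrite (le_trans (cauchy_schwarz hip _ _)) //.
    rewrite (le_trans (ler_wpM2r (normr_ge0 _) (hC x (Dg u x) Gx))) //.
    rewrite -mulrA ler_wpM2l // !(ipE hip).
    have := sqrD_split (l * `|Dg u x|) (- `|Dg v x|) l0.
    move: (normr_ge0 (Dg u x)) (normr_ge0 (Dg v x)).
    move: `|Dg u x| `|Dg v x| => a b a0 b0 _.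
    have : 0 <= l^-1 * (l * a - b) ^+ 2 by rewrite mulr_ge0 ?sqr_ge0 // invr_ge0 ltW.
    have -> : l^-1 * (l * a - b) ^+ 2 = l * a ^+ 2 - 2 * (a * b) + l^-1 * b ^+ 2.
      by field; rewrite gt_eqF.
    have := mulr_ge0 a0 b0; move: (a * b) (l * a ^+ 2) (l^-1 * b ^+ 2) => p q r; lra.
  rewrite /E' /E normrM ger0_norm; last by lra.
  have h0 : 0 <= 1 / 2 :> R by lra.
  apply: (le_trans (ler_wpM2l h0 h1)).
  have b1 := bm u hu; have b2 := bm v hv.
  rewrite Rintegral_bmfunZ //; last by apply: bmfunD; exact: bmfunZ.
  rewrite Rintegral_bmfunD //; [|exact: bmfunZ..].
  rewrite !Rintegral_bmfunZ // le_eqVlt; apply/orP; left; apply/eqP; ring.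
- move=> u c hu; rewrite /E' (_ : \int[mu]_(x in G) _ = 0) ?mulr0 //.
  under eq_Rintegral do rewrite Dgcst (ip0r hip).
  by rewrite Rintegral_cst // mul0r.
Qed.

End SectorForm.

Let bm_grad u : Cb1 u -> @bounded_mfun _ (borel H) R (fun x => ip (grad ip u x) (grad ip u x)).
Proof.
move=> hu; split; first exact: (measurable_grad_ip hip he).
have [M M0 hM] := grad_bound hip he hu; exists (M * M) => x.
by rewrite (le_trans (cauchy_schwarz hip _ _)) // ler_pM.
Qed.

Lemma sector_form_Gamma : sector_form (form_Gamma ip mu G) (form_Gamma ip mu G).
Proof.
apply: (@sector_form_Dg (grad ip) _ _ _ (fun x g => g)).
- by move=> u v x; exact: (gradD hip he).
- by move=> c x; exact: (grad_cst hip).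
- by move=> u; exact: (grad_bound hip he).
- by move=> u v hu hv; apply: measurable_funTS; exact: (measurable_grad_ip hip he).
- by [].
- by exists 1 => // x g _; rewrite mul1r.
- exact: bm_grad.
Qed.

Lemma sector_form_Abar : sector_form (form_Gamma ip mu G) (form_Abar ip mu G Ab).
Proof.
have mp u : Cb1 u -> forall h : H, measurable_fun (G : set (borel H)) (fun x => ip (grad ip u x) h).
  by move=> hu h; apply: measurable_funTS; exact: (measurable_partial hip he).
apply: (@sector_form_Dg (grad ip) _ _ _ (fun x g => Ab x g + g)).
- by move=> u v x; exact: (gradD hip he).
- by move=> c x; exact: (grad_cst hip).
- by move=> u; exact: (grad_bound hip he).
- move=> u v hu hv.
  apply: (@eq_measurable_fun _ _ (borel H) _ G (fun x => ip (Ab x (grad ip u x)) (grad ip v x) +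
    ip (grad ip u x) (grad ip v x))); first by move=> x _; rewrite (ipDl hip).
  apply: measurable_funD; first by apply: measurable_breve; exact: mp.
  by apply: measurable_funTS; exact: (measurable_grad_ip hip he).
(* The antisymmetric part vanishes on the diagonal, so both forms share their energy. *)
- move=> x g Gx; rewrite (ipDl hip); have := breve_anti g g Gx.
  by rewrite (ipC hip g (Ab x g)); lra.
- have [C C0 hC] := breve_bound; exists (C + 1); first by rewrite addr_ge0.
  by move=> x g Gx; rewrite (le_trans (ler_normD _ _)) // mulrDl mul1r lerD // hC.
- exact: bm_grad.
Qed.

End Forms.
End BreveMatrix.

(** * Invariance under the semigroup *)

Section ExponentialAverage.
Context {R : realType}.
Notation leb := (@lebesgue_measure R).

Lemma integral_shift_itvy (g : R -> R) (s : R) : continuous g -> (forall x, 0 <= g x) ->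
  (\int[leb]_(x in `[s, +oo[) (g x)%:E = \int[leb]_(x in `[0%R, +oo[) (g (x + s)%R)%:E)%E.
Proof.
move=> cg g0.
have dF x : is_derive x (1 : R) (fun x : R => x + s) 1.
  by rewrite -[X in is_derive _ _ _ X]addr0; apply: is_deriveD.
have F1 : derive1 (fun x : R => x + s) = cst 1.
  by apply/funext => x; rewrite derive1E; exact: (@derive_val _ _ _ _ _ _ _ (dF x)).
have cF x : {for x, continuous (fun x : R => x + s)}.
  by apply: cvgD; [exact: cvg_id|exact: cvg_cst].
have := @increasing_ge0_integration_by_substitutiony R (fun x => x + s) g 0.
rewrite add0r => ->.
- by apply: eq_integral => x _; rewrite F1 /= /cst [in LHS]mulr1.
- by move=> x y _ _ xy; rewrite ltrD2r.
- by rewrite F1 => x _; exact: cst_continuous.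
- by rewrite F1; exact: is_cvg_cst.
- by rewrite F1; exact: is_cvg_cst.
- split.
    by move=> x _; exact: (@ex_derive _ _ _ _ _ _ _ (dF x)).
  by apply: cvg_at_right_filter; exact: cF.
- by apply/cvgryPge => M; near=> x; rewrite -lerBlDr; near: x; apply: nbhs_pinfty_ge; rewrite num_real.
- exact: continuous_subspaceT.
- by move=> x _; exact: g0.
Unshelve. all: by end_near. Qed.

(* y(s) = exp(-s) r(s) satisfies y(s) = int_s^oo y, hence y' = - y. *)
Lemma exp_average_const (r : R -> R) : continuous r -> (forall x, 0 <= r x) ->
  (forall s, 0 <= s ->
     (\int[leb]_(t in `[0%R, +oo[) (expR (- t) * r (t + s))%:E = (r s)%:E)%E) ->
  forall s, 0 <= s -> r s = r 0.
Proof.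
move=> cr r0 hr.
pose y v := expR (- v) * r v.
have cexpN : continuous (fun v : R => expR (- v)).
  move=> v; apply: (@continuous_comp _ _ _ (fun v : R => - v) expR); last exact: continuous_expR.
  by apply: cvgN; exact: cvg_id.
have cy : continuous y by move=> v; apply: cvgM; [exact: cexpN|exact: cr].
have y0 v : 0 <= y v by rewrite mulr_ge0 // expR_ge0.
have my : measurable_fun [set: R] y by exact: continuous_measurable_fun.
have Y s : 0 <= s -> (\int[leb]_(x in `[s, +oo[) (y x)%:E = (y s)%:E)%E.
  move=> s0; rewrite integral_shift_itvy //.
  have -> : (\int[leb]_(x in `[0%R, +oo[) (y (x + s)%R)%:E =
      \int[leb]_(x in `[0%R, +oo[) ((expR (- s))%:E * (expR (- x) * r (x + s))%:E))%E.
    apply: eq_integral => x _; rewrite /y -EFinM; congr EFin.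
    by rewrite opprD expRD; ring.
  rewrite ge0_integralZl_EFin; [by rewrite hr|by []| | |exact: expR_ge0].
    by move=> x _; rewrite lee_fin mulr_ge0 // expR_ge0.
  apply: measurable_funTS; apply/measurable_EFinP; apply: continuous_measurable_fun => x.
  apply: cvgM; first exact: cexpN.
  apply: (@continuous_comp _ _ _ (fun x => x + s) r); last exact: cr.
  by apply: cvgD; [exact: cvg_id|exact: cvg_cst].
have iy a : 0 <= a -> leb.-integrable `[a, +oo[ (EFin \o y).
  move=> a0; apply/integrableP; split; first by apply: measurable_funTS; exact/measurable_EFinP.
  under eq_integral => x _ do rewrite /= ger0_norm //.
  by rewrite Y // ltry.
pose F s := \int[leb]_(t in `[0, s]) y t.
have FE s : 0 <= s -> F s = y 0 - y s.
  move=> s0; have := @Rintegral_itvB R y (BLeft 0) (BInfty _ false) s (iy 0 (lexx 0)).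
  rewrite bnd_simp => /(_ s0 isT).
  rewrite Rintegral_itv_obnd_cbnd.
    rewrite /Rintegral !Y //= => h; rewrite /F /Rintegral; lra.
  by apply: integrableS (iy s s0) => //; apply: subset_itvr; rewrite bnd_simp.
have dF (x : R) : 0 < x -> is_derive x (1 : R) F (y x).
  move=> x0.
  have xx : x < x + 1 by rewrite ltrDl.
  have iyx : leb.-integrable `[0, x + 1] (EFin \o y).
    by apply: integrableS (iy 0 (lexx _)) => //; apply: subset_itvl; rewrite bnd_simp.
  have [dFx Fx] := continuous_FTC1_closed xx iyx x0 (cy x).
  apply: DeriveDef; first exact: dFx.
  by rewrite -derive1E; exact: Fx.
(* For nonnegative times this is [r] again, in a form whose derivative is visibly 0. *)
pose w v := expR v * (y 0 - F v).
have wE s : 0 <= s -> w s = r s.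
  by move=> s0; rewrite /w FE // opprB addrC subrK /y mulrA -expRD subrr expR0 mul1r.
have dw (x : R) : 0 < x -> is_derive x (1 : R) w 0.
  move=> x0; have d1 := dF x x0.
  have -> : 0 = expR x *: (0 - y x) + (y 0 - F x) *: expR x.
    by rewrite FE ?ltW // /GRing.scale /=; ring.
  apply: is_deriveM.
have rconst (a b : R) : 0 < a -> a < b -> r a = r b.
  move=> a0 ab; have b0 := lt_trans a0 ab.
  have [| |c _ h] := @MVT R w (fun=> 0) a b ab.
  - by move=> x; rewrite in_itv /= => /andP[ax _]; apply: dw; exact: lt_trans ax.
  - apply: derivable_within_continuous => x; rewrite in_itv /= => /andP[ax _].
    exact: (@ex_derive _ _ _ _ _ _ _ (dw x (lt_le_trans a0 ax))).
  - by move: h; rewrite mul0r => /eqP; rewrite subr_eq0 !wE ?ltW // => /eqP.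
(* The derivative is available only at positive times; continuity of [r] extends the constancy to
   0. *)
move=> s; rewrite le_eqVlt => /predU1P[<- //|s0].
apply/eqP/negPn/negP => ne.
have d0 : 0 < `|r 0 - r s| by rewrite normr_gt0 subr_eq0 eq_sym.
have /cvgrPdist_lt /(_ _ d0)/nbhs_ballP[del del0 hd] := cr 0.
pose a := Num.min (del / 2) (s / 2).
have a0 : 0 < a by rewrite lt_min !divr_gt0.
have as' : a < s by rewrite gt_min; apply/orP; right; lra.
have : `|r 0 - r a| < `|r 0 - r s|.
  apply: hd; rewrite -ball_normE /ball_ /= sub0r normrN gtr0_norm // gt_min.
  by apply/orP; left; have : 0 < del := del0; lra.
by rewrite (rconst a s a0 as') ltxx.
Qed.

Lemma integral_expN1 : (\int[leb]_(t in `[0%R, +oo[) (expR (- t))%:E = 1)%E.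
Proof.
rewrite integral_mkcond -(@integral_exponential_pdf R 1 ltr01).
apply: eq_integral => t _; rewrite /exponential_pdf !patchE; case: ifP => _ //.
by rewrite mul1r mulN1r.
Qed.

End ExponentialAverage.

Section Invariance.
Context {R : realType} {H : completeNormedModType R}.
Variables (mu : probability (borel H) R) (F : set H).
Hypothesis mF : measurable (F : set (borel H)).
Variables E E' : (H -> R) -> (H -> R) -> R.
Hypotheses (hE : energy_form mu F E) (hE' : sector_form E E') (cE' : closable mu F E').
Notation leb := (@lebesgue_measure R).
Implicit Types f g h : H -> R.

Lemma L2_sqr_integrable f : L2 mu F f -> mu.-integrable (F : set (borel H)) (EFin \o (fun x => f x * f x)).
Proof.
move=> [mf f2]; apply/integrableP; split.
  by apply/measurable_EFinP; apply: measurable_funTS; exact: measurable_funM.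
under eq_integral do rewrite /= ger0_norm -?expr2 ?sqr_ge0 //.
exact: f2.
Qed.

Lemma L2_integrable f : L2 mu F f -> mu.-integrable (F : set (borel H)) (EFin \o f).
Proof.
move=> hf; have i1 := L2_sqr_integrable hf.
have ic : mu.-integrable (F : set (borel H)) (EFin \o (fun=> 1)).
  exact: (bmfun_integrable mu mF (bmfun_cst 1)).
apply: (le_integrable mF _ _ (integrableD mF ic i1)).
  by apply/measurable_EFinP; apply: measurable_funTS; exact: hf.1.
move=> x _ /=; rewrite lee_fin; have h := sqr_ge0 (`|f x| - 1).
rewrite [leRHS]ger0_norm; last by rewrite addr_ge0 // -expr2 sqr_ge0.
have e1 : f x * f x = `|f x| ^+ 2 by rewrite -expr2 real_normK // num_real.
by rewrite e1; have := sqr_ge0 `|f x|; have := normr_ge0 (f x); lra.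
Qed.

Lemma L2lin (a : R) f g : L2 mu F f -> L2 mu F g -> L2 mu F (fun x => a * f x + g x).
Proof.
move=> [mf f2] [mg g2].
have m1 : measurable_fun [set: borel H] (fun x => a * f x + g x).
  by apply: measurable_funD => //; apply: measurable_funM.
split=> //; have : (n2 mu F (fun x : borel H => a * f x + g x)%R <=
    (2 * a ^+ 2)%:E * n2 mu F (f : borel H -> R) + 2%:E * n2 mu F (g : borel H -> R))%E.
  apply: n2_lin2 => //; first by rewrite mulr_ge0 // sqr_ge0.
  move=> x _; have := sqrD_split (a * f x) (g x) ltr01; rewrite invr1 exprMn.
  by move: (f x ^+ 2) (g x ^+ 2) => p q; lra.
move/le_lt_trans; apply.
have f2' : n2 mu F (f : borel H -> R) \is a fin_num by rewrite ge0_fin_numE ?n2_ge0.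
have g2' : n2 mu F (g : borel H -> R) \is a fin_num by rewrite ge0_fin_numE ?n2_ge0.
by rewrite -(fineK f2') -(fineK g2') -!EFinM -EFinD ltry.
Qed.

Lemma L2_cst (c : R) : L2 mu F (fun=> c).
Proof.
split; first exact: measurable_cst.
by rewrite (@integral_cst _ (borel H)) // lte_mul_pinfty // ?lee_fin ?sqr_ge0 // ltey_eq fin_num_measure.
Qed.

Lemma L2dot1 f : L2dot mu F f (fun=> 1) = \int[mu]_(x in F) f x.
Proof. by rewrite /L2dot; apply: eq_Rintegral => x _; rewrite mulr1. Qed.

(** Expand the integral of [(f - c) ^+ 2], with [c] the integral of [f] itself, and use that [mu F]
    is at most 1. *)
Lemma sqr_Rintegral_le f : L2 mu F f -> (\int[mu]_(x in F) f x) ^+ 2 <= L2dot mu F f f.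
Proof.
move=> hf; set c := \int[mu]_(x in F) f x.
have i1 := L2_sqr_integrable hf; have i2 := L2_integrable hf.
have ic : mu.-integrable (F : set (borel H)) (EFin \o (fun=> c ^+ 2)).
  exact: (bmfun_integrable mu mF (bmfun_cst (c ^+ 2))).
have i3 : mu.-integrable (F : set (borel H)) (EFin \o (fun x => (- 2 * c) * f x)).
  by have := @integrableZl _ _ _ mu F mF (- 2 * c) _ i2.
have : 0 <= \int[mu]_(x in F) (f x * f x + ((- 2 * c) * f x + c ^+ 2)).
  apply: Rintegral_ge0 => x _; have := sqr_ge0 (f x - c).
  by have -> : (f x - c) ^+ 2 = f x * f x + (- 2 * c * f x + c ^+ 2) by ring.
rewrite RintegralD //; last by have := integrableD mF i3 ic.
rewrite RintegralD // RintegralZl // Rintegral_cst // -/c -/(L2dot mu F f f).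
have : fine (mu F) <= 1.
  by rewrite -[leRHS]/(fine 1%E) fine_le ?fin_num_measure // probability_le1.
move=> h; have := ler_wpM2l (sqr_ge0 c) h; lra.
Qed.

Variable Tt : R -> (H -> R) -> H -> R.
Hypothesis hT : form_semigroup mu F E' Tt.

Lemma ae_eq_Rintegral f g : L2 mu F f -> L2 mu F g ->
  {ae mu, forall x, F x -> f x = g x} -> \int[mu]_(x in F) f x = \int[mu]_(x in F) g x.
Proof.
move=> [mf _] [mg _] h; congr fine; apply: ae_eq_integral => //.
- by apply/measurable_EFinP; apply: measurable_funTS.
- by apply/measurable_EFinP; apply: measurable_funTS.
- by move: h; apply: ae_imp => x hx Fx; rewrite hx.
Qed.

(** Constant to the left of 0, so that it can be continuous on the whole line. *)
Let psi f (t : R) : R := \int[mu]_(x in F) Tt (Num.max t 0) f x.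

Lemma psi_bound f t : L2 mu F f -> `|psi f t| <= L2dot mu F f f + 1.
Proof.
move=> hf; have t0 : 0 <= Num.max t 0 by rewrite le_max lexx orbT.
have := le_trans (sqr_Rintegral_le (fs_L2 hT t0 hf)) (fs_contr hT t0 hf).
rewrite -/(psi f t); move: (L2dot _ _ _ _) (psi f t) => a b.
rewrite -(real_normK (num_real b)); have := sqr_ge0 (`|b| - 1).
by have := normr_ge0 b; nra.
Qed.

(** By contraction an increment after time [t] is no larger than the one after time 0, so strong
    continuity at 0 gives a uniform modulus. *)
Lemma psi_modulus f s t : L2 mu F f -> 0 <= s -> 0 <= t ->
  (psi f (t + s) - psi f t) ^+ 2 <= L2dot mu F (Tt s f \- f) (Tt s f \- f).
Proof.
move=> hf s0 t0; rewrite /psi !max_l ?addr_ge0 //.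
have hs := fs_L2 hT s0 hf; have ht := fs_L2 hT t0 hf.
have hts := fs_L2 hT t0 hs; have h1 := fs_L2 hT (addr_ge0 t0 s0) hf.
have hd := L2lin (-1) hf hs.
have htd := fs_L2 hT t0 hd.
have -> : \int[mu]_(x in F) Tt (t + s) f x - \int[mu]_(x in F) Tt t f x =
    \int[mu]_(x in F) Tt t (fun y => -1 * f y + Tt s f y) x.
  rewrite (ae_eq_Rintegral htd (L2lin (-1) ht hts) (fs_lin hT (-1) t0 hf hs)).
  rewrite (ae_eq_Rintegral h1 hts (fs_add hT t0 s0 hf)).
  have i1 : mu.-integrable (F : set (borel H)) (EFin \o (fun x => -1 * Tt t f x)).
    by have := @integrableZl _ _ _ mu F mF (-1) _ (L2_integrable ht).
  rewrite RintegralD //; last exact: L2_integrable.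
  by rewrite RintegralZl //; [ring|exact: L2_integrable].
apply: le_trans (sqr_Rintegral_le htd) _.
apply: le_trans (fs_contr hT t0 hd) _.
have -> : (fun y => -1 * f y + Tt s f y) = Tt s f \- f by apply/funext => x /=; ring.
exact: lexx.
Qed.

Lemma psi_continuous f : L2 mu F f -> continuous (psi f).
Proof.
move=> hf t; apply/cvgrPdist_lt => eps e0.
have e20 : 0 < eps ^+ 2 by rewrite exprn_gt0.
have /cvgrPdist_lt /(_ _ e20) := fs_cont hT hf.
rewrite near_withinE /= => /nbhs_ballP[del del0 hd].
have key a b : 0 <= a -> a < b -> b - a < del -> `|psi f a - psi f b| < eps.
  move=> a0 ab bad; rewrite -(@ltr_pXn2r _ 2) ?nnegrE ?(ltW e0) //.
  have s0 : 0 < b - a by rewrite subr_gt0.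
  have := hd (b - a); rewrite -ball_normE /ball_ /= sub0r normrN gtr0_norm // => /(_ bad s0).
  rewrite sub0r normrN => /(le_lt_trans (ler_norm _)); apply: le_lt_trans.
  have := psi_modulus hf (ltW s0) a0; rewrite (addrC a) subrK.
  by rewrite real_normK ?num_real // -sqrrN opprB.
near=> u.
have ut : `|Num.max t 0 - Num.max u 0| < del.
  have : `|t - u| < del.
    by near: u; exact: (nbhs_ball_norm t (PosNum del0)).
  by apply: le_lt_trans; exact: max_lip.
have psiE v : psi f v = psi f (Num.max v 0) by rewrite /psi -maxA maxxx.
rewrite (psiE t) (psiE u); have m0 (v : R) : 0 <= Num.max v 0 by rewrite le_max lexx orbT.
move: ut; have [ut|ut|->] := ltgtP (Num.max t 0) (Num.max u 0).
- by rewrite distrC gtr0_norm ?subr_gt0 // => h; exact: key.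
- by rewrite gtr0_norm ?subr_gt0 // distrC => h; rewrite key.
- by move=> _; rewrite subrr normr0.
Unshelve. all: by end_near. Qed.

Lemma psi0 f : L2 mu F f -> psi f 0 = L2dot mu F f (fun=> 1).
Proof.
move=> hf; rewrite /psi maxxx L2dot1; apply: ae_eq_Rintegral => //.
  exact: (fs_L2 hT (lexx _) hf).
exact: (fs_zero hT hf).
Qed.

(** Test the resolvent equation at parameter 1 against the constant 1: the form term vanishes, so
    [f] and its resolvent have the same integral. *)
Lemma psi_resolvent f : L2 mu F f ->
  psi f 0 = \int[leb]_(t in `[0, +oo[) (expR (- t) * psi f t).
Proof.
move=> hf; have [g [dg hg] hgh] := fs_res hT ltr01 hf.
have d1 : dom mu F E' (fun=> 1).
  by apply/(sector_dom mu F hE'); exact: (app_dom mF (app_const hE (Cb1_cst 1))).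
have := form_val_cst mF hE hE' cE' (hg _ d1); rewrite mul1r => /eqP.
rewrite subr_eq0 => /eqP e1; rewrite psi0 // e1 (hgh _ (L2_cst 1)).
apply: eq_Rintegral => t; rewrite inE /= in_itv /= andbT => t0.
by rewrite mulN1r L2dot1 /psi max_l.
Qed.

(** No Laplace transform is inverted: the resolvent identity at the single parameter 1, applied to
    every [Tt s f], says that [psi] is its own exponential average over the future. Adding [K] makes
    it nonnegative, as [exp_average_const] requires. *)
Theorem semigroup_invariant f t : L2 mu F f -> 0 <= t ->
  \int[mu]_(x in F) Tt t f x = \int[mu]_(x in F) f x.
Proof.
move=> hf t0.
pose K := L2dot mu F f f + 1.
pose r s := psi f s + K.
have cr : continuous r.
  by move=> s; apply: cvgD; [exact: psi_continuous|exact: cvg_cst].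
have r0 s : 0 <= r s.
  by have := psi_bound s hf; rewrite -/K ler_norml /r => /andP[]; lra.
have rK s : r s <= 2 * K.
  by have := psi_bound s hf; rewrite -/K ler_norml /r => /andP[]; lra.
have psi_shift s u : 0 <= s -> 0 <= u -> psi (Tt s f) u = psi f (u + s).
  move=> s0 u0; rewrite /psi !max_l ?addr_ge0 //; have hs := fs_L2 hT s0 hf.
  apply: ae_eq_Rintegral; [exact: (fs_L2 hT u0 hs)|exact: (fs_L2 hT (addr_ge0 u0 s0) hf)|].
  by have := fs_add hT u0 s0 hf; apply: ae_imp => x h Fx; rewrite h.
have hr s : 0 <= s ->
    (\int[leb]_(t in `[0%R, +oo[) (expR (- t) * r (t + s))%:E = (r s)%:E)%E.
  move=> s0; have hs := fs_L2 hT s0 hf.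
  have cexpN : continuous (fun v : R => expR (- v)).
    move=> v; apply: (@continuous_comp _ _ _ (fun v : R => - v) expR); last exact: continuous_expR.
    by apply: cvgN; exact: cvg_id.
  have i1 : leb.-integrable `[0, +oo[ (EFin \o (fun v => expR (- v))).
    apply/integrableP; split.
      apply: measurable_funTS; apply/measurable_EFinP; exact: continuous_measurable_fun.
    under eq_integral => x _ do rewrite /= ger0_norm ?expR_ge0 //.
    by rewrite integral_expN1 ltry.
  have mpsi : measurable_fun [set: R] (fun v => expR (- v) * psi (Tt s f) v).
    apply: continuous_measurable_fun => v; apply: cvgM; first exact: cexpN.
    exact: psi_continuous.
  have i2 : leb.-integrable `[0, +oo[ (EFin \o (fun v => expR (- v) * psi (Tt s f) v)).
    have iK := @integrableZl _ _ _ leb `[0, +oo[%classic (measurable_itv _)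
      (L2dot mu F (Tt s f) (Tt s f) + 1) _ i1.
    apply: (le_integrable _ _ _ iK) => //.
      by apply/measurable_EFinP; exact: measurable_funTS.
    move=> v _ /=; rewrite lee_fin normrM mulrC [leRHS]normrM; apply: ler_wpM2r => //.
    exact: le_trans (psi_bound _ hs) (ler_norm _).
  have e1 := psi_resolvent hs.
  transitivity (\int[leb]_(t in `[0%R, +oo[)
      ((expR (- t) * psi (Tt s f) t)%:E + (K%:E * (expR (- t))%:E)))%E.
    apply: eq_integral => v; rewrite inE /= in_itv /= andbT => v0.
    by rewrite psi_shift // /r -EFinM -EFinD; congr EFin; ring.
  rewrite integralD //; last exact: integrableZl.
  rewrite integralZl // integral_expN1 mule1.
  have -> : (\int[leb]_(t in `[0%R, +oo[) (expR (- t) * psi (Tt s f) t)%:E = (psi (Tt s f) 0)%:E)%E.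
    by rewrite e1 /Rintegral fineK //; exact: integrable_fin_num.
  by rewrite -EFinD psi_shift // add0r.
have := exp_average_const cr r0 hr t0; rewrite /r => /addIr.
by rewrite psi0 // L2dot1 /psi max_l.
Qed.

End Invariance.

(** * The Markov property for the natural filtration *)

Section Mixture.
Context {R : realType} d1 d2 (T1 : measurableType d1) (T2 : measurableType d2).
Local Open Scope ereal_scope.

(** The kernel is measurable only on [D]; outside it is replaced by the zero measure, the [point] of
    the Giry space. *)
Lemma mixture (m : giry T1 R) (D : set T1) (k : T1 -> giry T2 R) : measurable D ->
  (forall B, measurable B -> measurable_fun D (fun t => k t B)) ->
  exists q : giry T2 R,
    (forall B, measurable B -> q B = \int[m]_(t in D) k t B) /\
    (forall h : T2 -> \bar R, measurable_fun setT h -> (forall x, 0 <= h x) ->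
       \int[q]_x h x = \int[m]_(t in D) \int[k t]_x h x).
Proof.
move=> mD mk.
pose k' t : giry T2 R := if pselect (D t) then k t else point.
have k'E t (h : giry T2 R -> \bar R) : h point = 0 ->
    h (k' t) = ((fun t => h (k t)) \_ D) t.
  move=> h0; rewrite /k' patchE; case: (pselect (D t)) => Dt /=.
    by rewrite mem_set.
  by rewrite memNset.
have mk' : measurable_fun [set: T1] k'.
  apply: measurable_giry_codensity => // B mB.
  rewrite (_ : (fun _ => _) = ((fun t => k t B) \_ D)).
    by apply/(measurable_restrictT _ mD); exact: mk.
  by apply/funext => t; exact: (k'E t (fun q => q B)).
exists (giry_bind m mk').
have I h : measurable_fun setT h -> (forall x, 0 <= h x) ->
    \int[giry_bind m mk']_x h x = \int[m]_(t in D) \int[k t]_x h x.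
  move=> mh h0; rewrite [LHS](giry_int_bind m mk' mh h0) integral_mkcond.
  apply: eq_integral => t _.
  by rewrite (k'E t (fun q => giry_int q h)) //; exact: integral_measure_zero.
split=> // B mB; have := I (EFin \o \1_B).
rewrite integral_indic // setIT => ->.
- by apply: eq_integral => t _; rewrite integral_indic // setIT.
- by apply/measurable_EFinP; exact: measurable_indic.
- by move=> x; rewrite lee_fin.
Qed.

End Mixture.

Section NaturalMarkov.
Context {R : realType} {H : completeNormedModType R} {d : measure_display} {W : measurableType d}.
Variables (F : set H) (Mf : R -> set (set W)) (X : R -> W -> H) (th : R -> W -> W)
  (P : H -> probability W R).
Hypothesis hd : diffusion F Mf X th P.
Local Open Scope ereal_scope.

Definition natural_gen : set (set W) := [set S | exists s (B : set (borel H)),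
  [/\ `[0%R, +oo[%classic s, measurable B & S = X s @^-1` B] ].

(** The paths carry the natural sigma-algebra here because [P z S] is Borel in [z] only for its
    events; for other measurable events it is merely universally measurable. *)
Definition natural_space := g_sigma_algebraType natural_gen.

Lemma natural_measurable (S : set W) : natural_sigma X `[0%R, +oo[ S -> measurable S.
Proof.
move=> nS; apply: nS; split; first exact: sigma_algebra_measurable.
move=> _ [s [B [s0 mB ->]]]; rewrite /= in_itv /= andbT in s0.
by apply: (fl_sub (df_filt hd) s0); exact: (df_adapted hd s0).
Qed.

Lemma measurable_to_natural : measurable_fun [set: W] (id : W -> natural_space).
Proof. by move=> _ S mS; rewrite setTI; exact: natural_measurable. Qed.

Lemma measurable_shift_natural s : (0 <= s)%R ->
  measurable_fun [set: natural_space] (th s : natural_space -> natural_space).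
Proof.
move=> s0; apply: (@measurability _ _ _ natural_space _ _ natural_gen) => //.
move=> _ [_ [r [B [r0 mB ->]]] <-]; rewrite setTI; apply: sub_sigma_algebra.
rewrite /= in_itv /= andbT in r0.
exists (s + r)%R, B; split=> //; first by rewrite /= in_itv /= addr_ge0.
by apply/seteqP; split=> w /=; rewrite (df_shift hd _ r0 s0) addrC.
Qed.

Lemma measurable_X s : (0 <= s)%R -> measurable_fun [set: W] (X s : W -> borel H).
Proof.
by move=> s0 _ B mB; rewrite setTI; apply: (fl_sub (df_filt hd) s0); exact: (df_adapted hd s0).
Qed.

Lemma measurable_X_natural s : (0 <= s)%R ->
  measurable_fun [set: natural_space] (X s : natural_space -> borel H).
Proof.
move=> s0 _ B mB; rewrite setTI; apply: sub_sigma_algebra; exists s, B; split=> //.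
by rewrite /= in_itv /= s0.
Qed.

Hypothesis mF : measurable (F : set (borel H)).

Lemma measurable_P_X s S : (0 <= s)%R -> natural_sigma X `[0%R, +oo[ S ->
  measurable_fun [set: W] (fun w => P (X s w) S).
Proof.
move=> s0 nS; apply: (measurable_comp mF _ (df_meas hd nS) (measurable_X s0)).
by move=> _ [w _ <-]; exact: (df_state hd).
Qed.

(** The strong Markov property at the constant stopping time [s]; each of its sublevel events is
    everything or empty. *)
Lemma markov_step z s r C (B : set (borel H)) : F z -> (0 <= s)%R -> (0 <= r)%R -> Mf s C ->
  measurable B ->
  P z (C `&` [set w | B (X (s + r)%R w)]) = \int[P z]_(w in C) P (X s w) (X r @^-1` B).
Proof.
move=> Fz s0 r0 MC mB.
have hT : [set w : W | s%:E < +oo] = setT by apply/seteqP; split=> w //= _; rewrite ltry.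
have := @df_markov _ _ _ _ _ _ _ _ _ hd z (fun=> s%:E) C r B Fz; rewrite hT setIT /=; apply => //.
  split=> [w|t t0]; first by rewrite lee_fin.
  have [st|st] := leP s t.
    rewrite (_ : [set w | _] = setT).
      have [_ + _] := fl_sigma (df_filt hd) t0 => /(_ set0).
      by rewrite setD0; apply; have [] := fl_sigma (df_filt hd) t0.
    by apply/seteqP; split=> w //= _; rewrite lee_fin.
  rewrite (_ : [set w | _] = set0); first by have [] := fl_sigma (df_filt hd) t0.
  by apply/seteqP; split=> w //=; rewrite lee_fin leNgt st.
split; first exact: (fl_sub (df_filt hd) s0).
move=> t t0; have [st|st] := leP s t.
  rewrite (_ : [set w | _] = setT) ?setIT; first exact: (fl_incr (df_filt hd) s0 st).
  by apply/seteqP; split=> w //= _; rewrite lee_fin.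
rewrite (_ : [set w | _] = set0) ?setI0; first by have [] := fl_sigma (df_filt hd) t0.
by apply/seteqP; split=> w //=; rewrite lee_fin leNgt st.
Qed.

(** Both sides integrate [h] against a mixture of laws on [H], and the two mixtures agree on Borel
    sets by [markov_step]. *)
Lemma markov_step_fun z s r C (h : borel H -> \bar R) : F z -> (0 <= s)%R -> (0 <= r)%R -> Mf s C ->
  measurable_fun setT h -> (forall x, 0 <= h x) ->
  \int[P z]_(w in C) h (X (s + r)%R w) = \int[P z]_(w in C) \int[P (X s w)]_v h (X r v).
Proof.
move=> Fz s0 r0 MC mh h0; have sr0 : (0 <= s + r)%R by rewrite addr_ge0.
have mC : measurable C := fl_sub (df_filt hd) s0 MC.
have nX B : measurable (B : set (borel H)) -> natural_sigma X `[0%R, +oo[ (X r @^-1` B).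
  by move=> mB; apply: sub_sigma_algebra; exists r, B; split=> //; rewrite /= in_itv /= r0.
have [|q1 [q1B q1h]] := @mixture _ _ _ W (borel H) (P z : giry W R) C
    (fun w => giry_ret (X (s + r)%R w : borel H)) mC.
  move=> B mB; apply: measurable_funTS.
  exact: (measurableT_comp (measurable_fun_dirac (U := B : set (borel H)) mB) (measurable_X sr0)).
have [|q2 [q2B q2h]] := @mixture _ _ _ W (borel H) (P z : giry W R) C
    (fun w => giry_map (measurable_X r0) (P (X s w) : giry W R)) mC.
  by move=> B mB; apply: measurable_funTS; exact: (measurable_P_X s0 (nX B mB)).
have -> : \int[P z]_(w in C) h (X (s + r)%R w) = \int[q1]_x h x.
  by rewrite q1h //; apply: eq_integral => w _; rewrite [RHS]giry_int_ret.
have -> : \int[P z]_(w in C) \int[P (X s w)]_v h (X r v) = \int[q2]_x h x.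
  by rewrite q2h //; apply: eq_integral => w _; rewrite [RHS]giry_int_map.
apply: eq_measure_integral => B mB _; rewrite [LHS]q1B // [RHS]q2B //.
rewrite -[RHS](markov_step Fz s0 r0 MC mB).
transitivity (\int[P z]_(w in C) (\1_(X (s + r)%R @^-1` B) w)%:E).
  by apply: eq_integral => w _.
by rewrite integral_indic // 1?setIC // -[X in measurable X]setTI; exact: measurable_X.
Qed.

(* Times in the list are increments, so that the Markov property peels off
   one constraint at a time; rcyl_insert shows that these cylinders are stable
   under intersection. *)
Fixpoint rcyl (s : R) (l : seq (R * set (borel H))) : set W :=
  if l is rB :: l' then (X (s + rB.1)%R @^-1` rB.2) `&` rcyl (s + rB.1)%R l' else setT.

Fixpoint rcyl_wf (l : seq (R * set (borel H))) : Prop :=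
  if l is rB :: l' then [/\ (0 <= rB.1)%R, measurable rB.2 & rcyl_wf l'] else True.

Lemma rcyl_natural l : rcyl_wf l -> forall s, (0 <= s)%R -> natural_sigma X `[0%R, +oo[ (rcyl s l).
Proof.
elim: l => [_|[r B] l ih [/= r0 mB hl]] s s0; first exact: (@measurableT _ natural_space).
have sr0 : (0 <= s + r)%R by rewrite addr_ge0.
apply: (@measurableI _ natural_space); last exact: ih.
by rewrite -[X in measurable X]setTI; exact: measurable_X_natural.
Qed.

Lemma rcyl_shift l : rcyl_wf l -> forall s r, (0 <= s)%R -> (0 <= r)%R ->
  th s @^-1` rcyl r l = rcyl (s + r)%R l.
Proof.
elim: l => [_|[r B] l ih [/= r0 mB hl]] s r' s0 r'0; first exact: preimage_setT.
rewrite preimage_setI ih ?addr_ge0 // addrA; congr (_ `&` _).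
by apply/seteqP; split=> w /=; rewrite (df_shift hd) ?addr_ge0 // (addrC (r' + r)%R) addrA.
Qed.

Lemma filtrationI t (C D : set W) : (0 <= t)%R -> Mf t C -> Mf t D -> Mf t (C `&` D).
Proof.
move=> t0; have := measurable_g_measurableTypeE (fl_sigma (df_filt hd) t0).
by move=> <-; exact: measurableI.
Qed.

(** The induction hypothesis is used twice: at time [s + r] to integrate out the tail, and from the
    starting point [X s w] to restore it; [markov_step_fun] links the two. *)
Lemma markov_rcyl l : rcyl_wf l -> forall z s C, F z -> (0 <= s)%R -> Mf s C ->
  P z (C `&` rcyl s l) = \int[P z]_(w in C) P (X s w) (rcyl 0 l).
Proof.
elim: l => [_|[r B] l ih [/= r0 mB hl]] z s C Fz s0 MC.
  have mC : measurable C := fl_sub (df_filt hd) s0 MC.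
  rewrite setIT; under eq_integral do rewrite [P _ _]probability_setT.
  by rewrite integral_cst // mul1e.
have sr0 : (0 <= s + r)%R by rewrite addr_ge0.
have mC : measurable C := fl_sub (df_filt hd) s0 MC.
have Madapt t : (0 <= t)%R -> Mf t (X t @^-1` B) by move=> t0; exact: (df_adapted hd t0).
have nl := rcyl_natural hl (lexx 0%R).
(* The restriction to [F] is needed because [P x] is measurable in [x] only there. *)
pose h : borel H -> \bar R := (fun x => P x (rcyl 0 l)) \_ (F `&` B).
have mFB : measurable (F `&` B : set (borel H)) by exact: measurableI.
have mh : measurable_fun setT h.
  apply/(measurable_restrictT _ mFB).
  by apply: (measurable_funS mF _ (df_meas hd nl)) => x [].
have hE t w : (0 <= t)%R -> h (X t w) = ((fun w => P (X t w) (rcyl 0 l)) \_ (X t @^-1` B)) w.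
  move=> t0; rewrite /h !patchE; congr (if _ then _ else _).
  apply/idP/idP; rewrite !inE; first by case.
  by move=> Bw; split=> //; exact: (df_state hd).
have h0 x : 0 <= h x by rewrite /h patchE; case: ifP.
have nr : natural_sigma X `[0%R, +oo[ (rcyl 0 ((r, B) :: l)) by apply: rcyl_natural => //=.
rewrite setIA ih //; last by apply: (filtrationI sr0 _ (Madapt _ sr0)); apply: (fl_incr (df_filt hd) s0 _ MC); rewrite lerDl.
rewrite integral_mkcondr.
transitivity (\int[P z]_(w in C) h (X (s + r)%R w)).
  by apply: eq_integral => w _; rewrite hE.
rewrite (markov_step_fun Fz s0 r0 MC mh h0); apply: eq_integral => w _.
have Fx : F (X s w) := df_state hd w s0.
rewrite /rcyl -/rcyl add0r (ih hl _ _ (X r @^-1` B) Fx r0 (Madapt _ r0)).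
by rewrite [RHS]integral_mkcond; apply: eq_integral => v _; rewrite hE.
Qed.

Fixpoint rcyl_insert (t : R) (B : set (borel H)) (l : seq (R * set (borel H))) :=
  if l is rB :: l' then
    if (t <= rB.1)%R then (t, B) :: ((rB.1 - t)%R, rB.2) :: l'
    else rB :: rcyl_insert (t - rB.1)%R B l'
  else [:: (t, B)].

Lemma rcyl_insert_wf l t B : (0 <= t)%R -> measurable B -> rcyl_wf l -> rcyl_wf (rcyl_insert t B l).
Proof.
elim: l t => [|[r C] l ih] t t0 mB; first by move=> _; split.
move=> [/= r0 mC hl]; case: (leP t r) => tr /=; split=> //; first by split=> //=; rewrite subr_ge0.
by apply: ih => //; rewrite subr_ge0 ltW.
Qed.

Lemma rcyl_insertE l t B s : rcyl s (rcyl_insert t B l) = X (s + t)%R @^-1` B `&` rcyl s l.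
Proof.
elim: l t s => [//|[r C] l ih] t s; rewrite /rcyl_insert -/rcyl_insert.
case: (leP t r) => tr; rewrite /rcyl -/rcyl /=.
  by rewrite -addrA subrKC.
by rewrite ih -addrA subrKC setICA.
Qed.

Lemma rcyl_cat l l' : rcyl_wf l -> rcyl_wf l' -> exists2 l'', rcyl_wf l'' &
  rcyl 0 l `&` rcyl 0 l' = rcyl 0 l''.
Proof.
suff h : forall s, (0 <= s)%R -> rcyl_wf l -> rcyl_wf l' -> exists2 l'', rcyl_wf l'' &
    rcyl s l `&` rcyl 0 l' = rcyl 0 l'' by apply: h.
elim: l => [|[r B] l ih] s s0 /=; first by move=> _ hl'; exists l' => //; rewrite setTI.
move=> [r0 mB hl] hl'; have sr0 : (0 <= s + r)%R by rewrite addr_ge0.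
have [l'' wl'' e] := ih _ sr0 hl hl'.
exists (rcyl_insert (s + r)%R B l''); first exact: rcyl_insert_wf.
by rewrite rcyl_insertE add0r -setIA e.
Qed.

Definition cylinders : set (set W) := [set rcyl 0 l | l in rcyl_wf].

Lemma natural_cylinders : natural_sigma X `[0%R, +oo[ = <<s cylinders >>.
Proof.
apply/seteqP; split; apply: smallest_sub; try exact: smallest_sigma_algebra.
  move=> _ [s [B [s0 mB ->]]]; apply: sub_sigma_algebra; exists [:: (s, B)].
    by move: s0; rewrite /= in_itv /= andbT.
  by rewrite /= add0r setIT.
by move=> _ [l hl <-]; exact: rcyl_natural.
Qed.

(** Both sides are finite measures in [S], and they agree on the intersection-stable cylinders. *)
Theorem markov_natural z s S : F z -> (0 <= s)%R -> natural_sigma X `[0%R, +oo[ S ->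
  P z (th s @^-1` S) = \int[P z]_w P (X s w) S.
Proof.
move=> Fz s0 nS.
have [|q [qB qh]] := @mixture _ _ _ W natural_space (P z : giry W R) setT
    (fun w => giry_map measurable_to_natural (P (X s w) : giry W R)) measurableT.
  by move=> B nB; exact: measurable_P_X.
have mth : measurable_fun [set: W] (th s : W -> natural_space).
  exact: (measurableT_comp (measurable_shift_natural s0) measurable_to_natural).
rewrite -(qB S nS) -[LHS]/(giry_map mth (P z : giry W R) S).
apply: (@measure_unique _ _ natural_space cylinders (fun=> setT)) => //.
- exact: natural_cylinders.
- by move=> _ _ [l hl <-] [l' hl' <-]; have [l'' h e] := rcyl_cat hl hl'; exists l''.
- by move=> _; exists [::].
- by rewrite bigcup_const.
- move=> _ [l hl <-]; have nl := rcyl_natural hl (lexx 0%R).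
  rewrite [RHS](qB _ nl) /= -[LHS]/(P z (th s @^-1` rcyl 0 l)).
  rewrite rcyl_shift // addr0 -[X in P z X]setTI.
  rewrite (markov_rcyl hl Fz s0) //.
  have [+ _ _] := fl_sigma (df_filt hd) s0.
  by have [_ + _] := fl_sigma (df_filt hd) s0 => /[apply]; rewrite setD0.
- by move=> _; exact: le_lt_trans (probability_le1 (P z) measurableT) (ltry _).
Qed.

End NaturalMarkov.

(** * Stationarity of the diffusion *)

Section Stationarity.
Context {R : realType} {H : completeNormedModType R} {d : measure_display} {W : measurableType d}.
Variables (F : set H) (Mf : R -> set (set W)) (X : R -> W -> H) (th : R -> W -> W)
  (P : H -> probability W R).
Hypothesis hd : diffusion F Mf X th P.
Hypothesis mF : measurable (F : set (borel H)).

(** Extended by 0 so as to be a bounded Borel function on [H], the kind that [associated] can be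
    tested with. *)
Definition prob_of (S : set W) : H -> R := (fun x => fine (P x S)) \_ F.

Lemma prob_ofE S x : measurable S -> F x -> (prob_of S x)%:E = P x S.
Proof.
by move=> mS Fx; rewrite /prob_of patchE mem_set // fineK // fin_num_measure.
Qed.

Lemma measurable_prob_of S : natural_sigma X `[0, +oo[ S ->
  measurable_fun [set: borel H] (prob_of S).
Proof.
move=> nS; apply/(measurable_restrictT _ mF).
apply: (measurableT_comp (f := fine)); [exact: fine_measurable|exact: (df_meas hd nS)].
Qed.

Lemma prob_of_ge0 S x : 0 <= prob_of S x.
Proof. by rewrite /prob_of patchE; case: ifP => // _; exact: fine_ge0. Qed.

Lemma prob_of_le1 S x : measurable S -> `|prob_of S x| <= 1.
Proof.
move=> mS; rewrite ger0_norm ?prob_of_ge0 // /prob_of patchE; case: ifP => // _.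
by rewrite -lee_fin fineK ?fin_num_measure // probability_le1.
Qed.

Lemma natural_shift s S : 0 <= s -> natural_sigma X `[0, +oo[ S ->
  natural_sigma X `[0, +oo[ (th s @^-1` S).
Proof.
move=> s0 nS; rewrite -[X in natural_sigma _ _ X]setTI.
exact: (measurable_shift_natural hd s0 measurableT nS).
Qed.

Lemma transition_prob_of s S z : F z -> 0 <= s -> natural_sigma X `[0, +oo[ S ->
  (transition X P s (prob_of S) z)%:E = P z (th s @^-1` S).
Proof.
move=> Fz s0 nS; have mS := natural_measurable hd nS.
rewrite (markov_natural hd mF Fz s0 nS) /transition /Rintegral.
have -> : (\int[P z]_w (prob_of S (X s w))%:E = \int[P z]_w P (X s w) S)%E.
  by apply: eq_integral => w _; rewrite prob_ofE //; exact: (df_state hd w s0).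
rewrite fineK // -(markov_natural hd mF Fz s0 nS) fin_num_measure //; exact: (natural_measurable hd (natural_shift s0 nS)).
Qed.

Variables (mu : probability (borel H) R) (E E' : (H -> R) -> (H -> R) -> R).
Hypotheses (hE : energy_form mu F E) (hE' : sector_form E E') (cE' : closable mu F E').
Hypothesis hA : associated mu F E' X P.

(** The Markov property rewrites the left side as the integral of the transition function applied to
    [prob_of S]; association replaces it by the semigroup, which preserves integrals. *)
Theorem stationary s S : 0 < s -> natural_sigma X `[0, +oo[ S ->
  (\int[mu]_(x in F) P x (th s @^-1` S) = \int[mu]_(x in F) P x S)%E.
Proof.
move=> s0 nS; have [Tt hT hq] := hA; have mS := natural_measurable hd nS.
have mv := measurable_prob_of nS.
have [|_ aeT] := hq s (prob_of S) s0 mv; first by exists 1 => x; exact: prob_of_le1.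
have bv : @bounded_mfun _ (borel H) R (prob_of S).
  by split=> //; exists 1 => x; exact: prob_of_le1.
have Lv : L2 mu F (prob_of S).
  split=> //; have := bmfun_integrable mu mF (bmfunX2 bv).
  move=> /integrableP[_]; under eq_integral do rewrite /= ger0_norm ?sqr_ge0 //.
  by [].
have LT := fs_L2 hT (ltW s0) Lv.
have inv := semigroup_invariant mF hE hE' cE' hT Lv (ltW s0).
transitivity (\int[mu]_(x in F) (Tt s (prob_of S) x)%:E)%E.
  transitivity (\int[mu]_(x in F) (transition X P s (prob_of S) x)%:E)%E.
    by apply: eq_integral => x; rewrite inE => Fx; rewrite transition_prob_of ?ltW.
  apply: ae_eq_integral => //.
  - have mS' := natural_shift (ltW s0) nS.
    apply: (@eq_measurable_fun _ _ (borel H) _ (F : set (borel H)) (fun x => P x (th s @^-1` S))); last exact: (df_meas hd mS').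
    by move=> x; rewrite inE => Fx; rewrite transition_prob_of ?ltW.
  - by apply/measurable_EFinP; apply: measurable_funTS; exact: LT.1.
  - by move: aeT; apply: ae_imp => x h Fx; rewrite h.
transitivity (\int[mu]_(x in F) (prob_of S x)%:E)%E.
  have f1 := integrable_fin_num mF (L2_integrable mF LT).
  have f2 := integrable_fin_num mF (L2_integrable mF Lv).
  by rewrite -[LHS](fineK f1) -[RHS](fineK f2); congr EFin.
by apply: eq_integral => x; rewrite inE => Fx; rewrite prob_ofE.
Qed.

Lemma transition_ae0 s S : 0 < s -> natural_sigma X `[0, +oo[ S ->
  (\int[mu]_(x in F) P x S = 0)%E ->
  {ae mu, forall x, F x -> transition X P s (prob_of S) x = 0}.
Proof.
move=> s0 nS S0; have mS' := natural_shift (ltW s0) nS.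
have := stationary s0 nS; rewrite S0 => h.
have /ae_eq_integral_abs : measurable_fun (F : set (borel H)) (fun x => P x (th s @^-1` S)).
  exact: (df_meas hd mS').
move=> /(_ mu mF) [hh _]; have : ae_eq mu F (fun x => P x (th s @^-1` S)) (cst 0%E).
  by apply: hh; under eq_integral do rewrite gee0_abs //.
apply: ae_imp => x hx Fx; apply: EFin_inj; rewrite transition_prob_of ?ltW //.
exact: hx.
Qed.

End Stationarity.

(** * Stieltjes measures and measurability of the local time *)

Section Stieltjes.
Context {R : realType}.
Implicit Types g : R -> R.

Definition clock g : Prop :=
  [/\ g 0 = 0, (forall s t, 0 <= s -> s <= t -> g s <= g t) &
      {within `[0, +oo[, continuous g}].

(** This excludes the fallback of [stieltjes] to the zero measure. *)
Lemma clock_cumulative g : clock g ->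
  exists c : cumulative R R, forall t : R, c t = g (Num.max t 0).
Proof.
move=> [g0 gm gc]; pose f t := g (Num.max t 0).
have fm : nondecreasing f.
  move=> s t st; apply: gm; first by rewrite le_max lexx orbT.
  by rewrite ge_max !le_max st lexx orbT.
have fc : continuous f.
  move=> t; apply/cvgrPdist_lt => eps e0.
  have t0 : `[0, +oo[%classic (Num.max t 0) by rewrite /= in_itv /= andbT le_max lexx orbT.
  have := gc (Num.max t 0); rewrite /continuous_at -/(f t) => /cvgrPdist_lt /(_ _ e0).
  rewrite /nbhs /= /nbhs_subspace mem_set // /= near_withinE => /nbhs_ballP[del del0 hd].
  apply/nbhs_ballP; exists del => // u /= tu; apply: hd; last first.
    by rewrite /= in_itv /= andbT le_max lexx orbT.
  rewrite -ball_normE /ball_ /=; apply: (@le_lt_trans _ _ `|t - u|); first exact: max_lip.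
  exact: tu.
pose c : cumulative R R := HB.pack f (isCumulative.Build R _ R f fm (right_continuousW fc)).
by exists c.
Qed.

Variable g : R -> R.
Hypothesis hg : clock g.

Lemma stieltjes_itvoc (a b : R) : a <= b ->
  stieltjes g `]a, b]%classic = (g (Num.max b 0) - g (Num.max a 0))%:E.
Proof.
move=> ab; rewrite /stieltjes; case: pselect => [h|/(_ (clock_cumulative hg)) //].
have hc := projT2 (cid h); move: (projT1 (cid h)) hc => c hc.
transitivity (wlength c `]a, b]%classic); last by rewrite wlength_itv_bnd // -!hc EFinB.
exact: (measurable_mu_extE (wlength c) (is_ocitv a b)).
Qed.

Lemma stieltjes_itvNy0 : stieltjes g `]-oo, 0%R]%classic = 0%E.
Proof.
rewrite (_ : `]-oo, 0]%classic = \bigcup_n `](- n%:R), 0]%classic); last first.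
  apply/seteqP; split=> x; rewrite /= in_itv /=.
    move=> x0; exists (Num.bound (- x)).+1 => //; rewrite /= in_itv /= x0 andbT ltrNl.
    apply: (@lt_trans _ _ (Num.bound (- x))%:R); last by rewrite ltr_nat.
    by apply: archi_boundP; rewrite oppr_ge0.  by move=> [n _]; rewrite /= in_itv /= => /andP[].
apply/eqP; rewrite eq_le measure_ge0 andbT.
apply: le_trans (measure_sigma_subadditive _ _ _ (@subset_refl _ _)) _ => //.
  exact: bigcupT_measurable.
rewrite eseries0 // => n _ _; rewrite stieltjes_itvoc ?oppr_le0 //.
by rewrite maxxx max_r ?oppr_le0 // subrr.
Qed.

(** The point 0 carries no mass: the closed interval lies between []0, t]] and []-1, t]], which have
    the same mass. *)
Lemma stieltjes_itvcc t : 0 <= t -> stieltjes g `[0, t]%classic = (g t)%:E.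
Proof.
move=> t0; have [g0 _ _] := hg.
apply/eqP; rewrite eq_le; apply/andP; split.
  have -> : (g t)%:E = stieltjes g `](-1)%R, t]%classic.
    by rewrite stieltjes_itvoc ?(le_trans _ t0) // max_l // max_r // g0 subr0.
  by apply: le_measure; rewrite ?inE // => x; rewrite /= !in_itv /= => /andP[x0 ->]; rewrite andbT; lra.
have -> : (g t)%:E = stieltjes g `]0, t]%classic.
  by rewrite stieltjes_itvoc // max_l // max_r // g0 subr0.
by apply: le_measure; rewrite ?inE // => x; rewrite /= !in_itv /= => /andP[/ltW -> ->].
Qed.

Lemma stieltjes_itvNyc t : 0 <= t -> stieltjes g `]-oo, t]%classic = (g t)%:E.
Proof.
move=> t0; rewrite -(stieltjes_itvcc t0); apply/eqP; rewrite eq_le; apply/andP; split.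
  rewrite -[leRHS]add0e -stieltjes_itvNy0.
  apply: le_trans (measureU2 _ _ _) => //; apply: le_measure; rewrite ?inE //; first exact: measurableU.
  move=> x; rewrite /= !in_itv /= => xt; rewrite xt andbT.
  by have [x0|/ltW x0] := leP x 0; [left|right].
by apply: le_measure; rewrite ?inE // => x; rewrite /= !in_itv /= => /andP[].
Qed.

End Stieltjes.

Section StieltjesShift.
Context {R : realType}.
Variables (g h : R -> R) (t : R).
Hypotheses (hg : clock g) (hh : clock h) (t0 : 0 <= t).
Hypothesis gh : forall s, 0 <= s -> h s = g (t + s) - g t.

(** The measure form of additivity: the clock of the shifted path is the part of the original clock
    after [t], translated back. Half-open intervals determine it. *)
Lemma stieltjes_shift (D : set R) : measurable D ->
  stieltjes h D = stieltjes g (`]t, +oo[ `&` [set s | D (s - t)]).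
Proof.
have mshift : measurable_fun [set: R] (fun s : R => s - t).
  by apply: continuous_measurable_fun => s; apply: cvgB; [exact: cvg_id|exact: cvg_cst].
move=> mD.
pose phi (s : measurableTypeR R) : measurableTypeR R := s - t.
pose q' : {measure set (measurableTypeR R) -> \bar R} :=
  pushforward (mrestr (stieltjes g) (measurable_itv `]t, +oo[)) phi.
pose q := q' mshift.
have key (a b : R) : a <= b -> stieltjes h `]a, b]%classic = q `]a, b]%classic.
  move=> ab; rewrite stieltjes_itvoc // /q /= /pushforward /mrestr.
  have m0 (x : R) : 0 <= Num.max x 0 by rewrite le_max lexx orbT.
  have mab : Num.max a 0 <= Num.max b 0 by rewrite ge_max !le_max ab lexx orbT.
  rewrite (_ : _ `&` _ = `](t + Num.max a 0), (t + Num.max b 0)]%classic).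
    by rewrite stieltjes_itvoc ?lerD2l // !gh // (max_l (addr_ge0 t0 (m0 b))) (max_l (addr_ge0 t0 (m0 a))); congr EFin; ring.
  apply/seteqP; split=> x; rewrite /= !in_itv /= andbT.
    move=> [/andP[x1 x2] x3]; apply/andP; split; first by rewrite -ltrBrDl gt_max x1 subr_gt0.
    by rewrite -lerBlDl le_max x2.
  move=> /andP[x1 x2].
  have tx : t < x by apply: le_lt_trans x1; rewrite lerDl.
  split=> //; apply/andP; split.
    by move: x1; rewrite -ltrBrDl gt_max => /andP[].
  by move: x2; rewrite -lerBlDl le_max subr_le0 => /orP[//|]; rewrite leNgt tx.
have key' C : ocitv C -> stieltjes h C = q C.
  move=> /ocitvP[->|[[a b] /= ab ->]]; first by rewrite !measure0.
  exact: (key _ _ (ltW ab)).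
have -> : stieltjes h D = q D.
  move: key'; rewrite /stieltjes; case: pselect => [c|/(_ (clock_cumulative hh)) //] key'.
  exact: (lebesgue_stieltjes_measure_unique key').
by rewrite /q /= /pushforward /mrestr setIC.
Qed.

End StieltjesShift.

(** * Measurable families of measures, completions and joint measurability *)

Section SectionMeasurable.
Context {R : realType} d (Y : measurableType d).
Notation RR := (measurableTypeR R).
Variable k : Y -> {measure set RR -> \bar R}.
Hypothesis kfin : forall y, (k y setT < +oo)%E.
Local Open Scope ereal_scope.

Let kC (S : set RR) y : measurable S -> k y (~` S) = k y setT - k y S.
Proof. by move=> mS; rewrite -setTD measureD ?setTI //; exact: kfin. Qed.

Lemma measurable_family : measurable_fun [set: Y] (fun y => k y setT) ->
  (forall a b : R, measurable_fun [set: Y] (fun y => k y `]a, b]%classic)) ->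
  forall B : set RR, measurable B -> measurable_fun [set: Y] (fun y => k y B).
Proof.
move=> kT kI B mB.
apply: (@dynkin_induction _ RR (@ocitv R) (fun B => measurable_fun [set: Y] (fun y => k y B))) => //.
- exact: ocitvI.
- by move=> _ [ab _ <-]; exact: kI.
- move=> S mS kS; rewrite (_ : (fun y => _) = (fun y => k y setT - k y S)).
    exact: emeasurable_funB.
  by apply/funext => y; exact: kC.
- move=> S mS tS kS; rewrite (_ : (fun y => _) = (fun y => \sum_(0 <= n <oo) k y (S n))).
    by apply: ge0_emeasurable_sum.
  apply/funext => y; apply/esym/cvg_lim => //.
  by apply: measure_semi_sigma_additive => //; exact: bigcupT_measurable.
Qed.

(** A Dynkin class argument from rectangles, needed because the set of times to be measured depends
    on the path as well as the measure does. *)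
Lemma measurable_section : (forall B : set RR, measurable B -> measurable_fun [set: Y] (fun y => k y B)) ->
  forall Q : set (Y * RR), measurable Q -> measurable_fun [set: Y] (fun y => k y (xsection Q y)).
Proof.
move=> kB Q mQ.
apply: (@dynkin_induction _ (Y * RR)%type [set A `*` B | A in measurable & B in measurable]
  (fun Q => measurable_fun [set: Y] (fun y => k y (xsection Q y)))); last by rewrite -measurable_prod_measurableType.
- exact: measurable_prod_measurableType.
- move=> _ _ [A1 mA1 [B1 mB1 <-]] [A2 mA2 [B2 mB2 <-]]; exists (A1 `&` A2); first exact: measurableI.
  by exists (B1 `&` B2); [exact: measurableI|rewrite setXI].
- rewrite (_ : (fun y => _) = (fun y => k y setT)); first exact: kB.
  by apply/funext => y; congr (k y _); apply/seteqP; split=> x // _; rewrite /xsection /= inE.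
- move=> _ [A mA [B mB <-]].
  rewrite (_ : (fun y => _) = (fun y => k y B * (\1_A y)%:E)).
    apply: emeasurable_funM; first exact: kB.
    by apply/measurable_EFinP; exact: measurable_indic.
  apply/funext => y; rewrite indicE.
  have [yA|yA] := boolP (y \in A); first by rewrite mule1 in_xsectionX.
  by rewrite mule0 notin_xsectionX // measure0.
- move=> S mS kS; rewrite (_ : (fun y => _) = (fun y => k y setT - k y (xsection S y))).
    by apply: emeasurable_funB => //; exact: kB.
  apply/funext => y; rewrite -kC; last exact: measurable_xsection.
  by congr (k y _); apply/seteqP; split=> x; rewrite !/xsection /= !inE.
- move=> S mS tS kS; rewrite (_ : (fun y => _) = (fun y => \sum_(0 <= n <oo) k y (xsection (S n) y))).
    by apply: ge0_emeasurable_sum.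
  apply/funext => y; rewrite xsection_bigcup; apply/esym/cvg_lim => //.
  apply: measure_semi_sigma_additive => //.
  - by move=> n; exact: measurable_xsection.
  - exact: trivIset_xsection.
  - by apply: bigcupT_measurable => n; exact: measurable_xsection.
Qed.

End SectionMeasurable.

Section Completion.
Context {R : realType} d (T : measurableType d) (q : {measure set T -> \bar R}).
Local Open Scope ereal_scope.

Definition completion : set (set T) := [set S | exists S' Z,
  [/\ measurable S', measurable Z, q Z = 0 & (S `\` S') `|` (S' `\` S) `<=` Z] ].

Lemma null_bigcup (Z : nat -> set T) : (forall n, measurable (Z n)) -> (forall n, q (Z n) = 0) ->
  q (\bigcup_n Z n) = 0.
Proof.
move=> mZ Z0; apply/eqP; rewrite eq_le measure_ge0 andbT.
apply: le_trans (measure_sigma_subadditive q mZ _ (@subset_refl _ _)) _.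
  exact: bigcupT_measurable.
by rewrite eseries0.
Qed.

Lemma completion_sigma_algebra : sigma_algebra setT completion.
Proof.
split.
- by exists set0, set0; split=> //; rewrite !setD0 setU0.
- move=> S [S' [Z [mS' mZ Z0 hS]]]; exists (~` S'), Z; split=> //; first exact: measurableC.
  move=> x [[[_ nS] /contrapT S'x]|[nS' nSx]]; first by apply: hS; right.
  by apply: hS; left; split=> //; apply: contrapT => nS; apply: nSx.
- move=> S hS; have [S' {}hS] := choice hS; have [Z {}hS] := choice hS.
  have mZ n : measurable (Z n) by have [] := hS n.
  have Z0 n : q (Z n) = 0 by have [] := hS n.
  exists (\bigcup_n S' n), (\bigcup_n Z n); split.
  + by apply: bigcupT_measurable => n; have [] := hS n.
  + exact: bigcupT_measurable.
  + exact: null_bigcup.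
  + move=> x [[[n _ Sx] nS]|[[n _ Sx] nS]]; exists n => //; have [_ _ _ h] := hS n.
      by apply: h; left; split=> // S'x; apply: nS; exists n.
    by apply: h; right; split=> // S'x; apply: nS; exists n.
Qed.

Lemma measurable_completion (S : set T) : measurable S -> completion S.
Proof. by move=> mS; exists S, set0; split=> //; rewrite setDv setU0. Qed.

Lemma completion_measurableE : @measurable _ (g_sigma_algebraType completion) = completion.
Proof. exact: measurable_g_measurableTypeE completion_sigma_algebra. Qed.

(** Each rational level set is replaced by a measurable one, and the function is rebuilt from these
    levels off the union of the null errors. It stays below [Y] everywhere, so integrals can later
    be compared without measurability of [Y]. *)
Lemma measurable_version (Y : T -> R) :
  measurable_fun [set: g_sigma_algebraType completion] (Y : g_sigma_algebraType completion -> R) ->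
  (forall w, (0 <= Y w)%R) ->
  exists (Y' : T -> \bar R) (Z : set T), [/\ measurable_fun [set: T] Y', measurable Z, q Z = 0,
    forall w, 0 <= Y' w <= (Y w)%:E & forall w, ~ Z w -> Y' w = (Y w)%:E].
Proof.
move=> mY Y0.
pose r n : R := if unpickle n is Some x then ratr x else 0%R.
have hS n : exists SZ : set T * set T, [/\ measurable SZ.1, measurable SZ.2, q SZ.2 = 0 &
    ([set w | (r n < Y w)%R] `\` SZ.1) `|` (SZ.1 `\` [set w | (r n < Y w)%R]) `<=` SZ.2].
  have : completion [set w | (r n < Y w)%R].
    rewrite -completion_measurableE.
    rewrite (_ : [set w | _] = Y @^-1` `]r n, +oo[).
      by rewrite -[X in measurable X]setTI; exact: mY.
    by apply/seteqP; split=> w /=; rewrite in_itv /= andbT.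
  by move=> [S' [Z h]]; exists (S', Z).
have {hS}[SZ hS] := choice hS.
pose Z := \bigcup_n (SZ n).2.
have mZ : measurable Z by apply: bigcupT_measurable => n; have [] := hS n.
pose D n := (SZ n).1 `&` [set w | (0 < r n)%R] `\` Z.
have mD n : measurable (D n).
  apply: measurableD => //; apply: measurableI; first by have [] := hS n.
  by case: (ltP 0%R (r n)) => h; [rewrite (_ : [set w | _] = setT)|rewrite (_ : [set w | _] = set0)] => //;
    apply/seteqP; split.
pose f n w : \bar R := (r n * \1_(D n) w)%:E.
have mf n : measurable_fun [set: T] (f n).
  by apply/measurable_EFinP; apply: measurable_funM => //; exact: measurable_indic.
have fY n w : f n w <= (Y w)%:E.
  rewrite /f indicE; case: (boolP (w \in D n)); last by rewrite mulr0 lee_fin.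
  rewrite inE mulr1 lee_fin => -[[S'w _] nZ]; apply/ltW/negPn/negP => h.
  by apply: nZ; exists n => //; have [_ _ _ hh] := hS n; apply: hh; right; split=> // /(negP h).
exists (fun w => maxe 0 (esups (f ^~ w) 0%N)), Z; split=> //.
- by apply: measurable_maxe => //; exact: measurable_fun_esups.
- by apply: null_bigcup => n; have [] := hS n.
- move=> w; rewrite le_max lexx /= ge_max lee_fin Y0 /=.
  by apply: ge_ereal_sup => _ [n _ <-]; exact: fY.
move=> w nZ; apply/eqP; rewrite eq_le; apply/andP; split.
  rewrite ge_max lee_fin Y0 /=.
  by apply: ge_ereal_sup => _ [n _ <-]; exact: fY.
rewrite leNgt; apply/negP => h.
set a := maxe _ _ in h; have a0 : 0 <= a by rewrite le_max lexx.
have fa : a \is a fin_num by rewrite ge0_fin_numE // (lt_trans h) // ltry.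
have : (fine a < Y w)%R by rewrite -lte_fin fineK.
move=> /rat_in_itvoo[x]; rewrite in_itv /= => /andP[ax xY].
pose n := pickle x; have rn : r n = ratr x by rewrite /r /n pickleK.
have r0 : (0 < r n)%R by rewrite rn; apply: le_lt_trans ax; exact: fine_ge0.
have Dw : D n w.
  split=> //; split=> //; apply: contrapT => nS; apply: nZ; exists n => //.
  by have [_ _ _ hh] := hS n; apply: hh; left; split=> //=; rewrite rn.
have : f n w <= a.
  by rewrite /a le_max; apply/orP; right; apply: ereal_sup_ubound; exists n.
by rewrite /f indicE mem_set // mulr1 -(fineK fa) lee_fin leNgt rn ax.
Qed.

End Completion.

Section JointMeasurability.
Context {R : realType} {H : completeNormedModType R} {ip : H -> H -> R} {e : nat -> H}.
Hypotheses (hip : inner_product ip) (he : orthonormal_basis ip e).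

(** By the countable base, balls generate the Borel sets. *)
Lemma measurable_from_norm d (T : measurableType d) (f : T -> H) :
  (forall c, measurable_fun [set: T] (fun x => `|f x - c|)) ->
  measurable_fun [set: T] (f : T -> borel H).
Proof.
move=> mf; apply: (@measurability _ _ _ (borel H) _ _ (@open H)) => // _ [U oU <-].
rewrite setTI.
have -> : f @^-1` U = \bigcup_(n in [set n | rat_ball (e := e) n `<=` U]) f @^-1` rat_ball (e := e) n.
  apply/seteqP; split=> x; last by move=> [n nU /nU].
  by move=> Ux; have [n [nx nU]] := rat_ball_basis hip he oU Ux; exists n.
apply: bigcup_measurable => n _; rewrite /rat_ball; case: unpickle => [[s k]|]; last first.
  by rewrite preimage_set0.
set c := \sum_(i < _) _.
rewrite (_ : _ @^-1` _ = (fun x => `|f x - c|) @^-1` `]-oo, k.+1%:R^-1[).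
  by rewrite -[X in measurable X]setTI; exact: mf.
by apply/seteqP; split=> x; rewrite /= in_itv.
Qed.

Context {d : measure_display} {W : measurableType d}.
Variable Y : R -> W -> H.
Hypothesis mY : forall s, 0 <= s -> measurable_fun [set: W] (Y s : W -> borel H).
Hypothesis cY : forall t w, 0 <= t -> (fun s => Y s w) @ t^'+ --> Y t w.

(** [tau n s] is the next grid point strictly to the right of [s], since paths are only known to be
    right-continuous. *)
Let grid (n : nat) (s : R) : nat := Num.truncn (n.+1%:R * Num.max s 0).
Let tau (n : nat) (s : R) : R := (grid n s).+1%:R / n.+1%:R.

Let max0 (s : R) : 0 <= Num.max s 0.
Proof. by rewrite le_max lexx orbT. Qed.

Let tau_bound n s : Num.max s 0 < tau n s <= Num.max s 0 + n.+1%:R^-1.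
Proof.
have /truncn_itv/andP[h1 h2] : 0 <= n.+1%:R * Num.max s 0 by rewrite mulr_ge0.
rewrite /tau ltr_pdivlMr // mulrC h2 /= ler_pdivrMr // mulrDl mulVf // mulrC -natr1 lerD2r.
exact: h1.
Qed.

Let measurable_grid n k : measurable [set s : measurableTypeR R | grid n s = k].
Proof.
have mg : measurable_fun [set: R] (fun s : R => n.+1%:R * Num.max s 0).
  by apply: measurable_funM => //; apply: measurable_maxr.
rewrite (_ : [set _ | _] = (fun s : R => n.+1%:R * Num.max s 0) @^-1` `[k%:R, k.+1%:R[).
  by rewrite -[X in measurable X]setTI; exact: mg.
apply/seteqP; split=> s; rewrite /= in_itv /=.
  by move=> <-; apply: truncn_itv; rewrite mulr_ge0.
exact: truncn_def.
Qed.

Theorem measurable_joint :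
  measurable_fun [set: W * measurableTypeR R] (fun ws => Y (Num.max ws.2 0) ws.1 : borel H).
Proof.
apply: measurable_from_norm => c.
have mYc s : 0 <= s -> measurable_fun [set: W] (fun w => `|Y s w - c|).
  move=> s0; apply: (measurableT_comp (f := fun x : borel H => `|x - c|)); last exact: mY.
  apply: measurable_continuous => x; apply: (@continuous_comp _ _ _ (fun x : H => x - c) (fun x => `|x|)).
    by apply: cvgB; [exact: cvg_id|exact: cvg_cst].
  exact: norm_continuous.
apply: (@measurable_fun_cvg _ _ _ _ (fun n ws => `|Y (tau n ws.2) ws.1 - c|)).
- move=> n _ B mB; rewrite setTI.
  rewrite (_ : _ @^-1` _ = \bigcup_k
      (((fun w => `|Y (k.+1%:R / n.+1%:R) w - c|) @^-1` B) `*` [set s | grid n s = k])).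
    apply: bigcupT_measurable => k; apply: measurableX; last exact: measurable_grid.
    by rewrite -[X in measurable X]setTI; apply: mYc => //; rewrite divr_ge0.
  apply/seteqP; split=> -[w s] /=.
    by move=> h; exists (grid n s).
  by move=> [k _ [/= h hk]]; rewrite /tau hk.
- move=> [w s] _ /=.
  apply: cvg_norm; apply: cvgB; last exact: cvg_cst.
  apply/cvgrPdist_lt => eps e0.
  have /cvgrPdist_lt /(_ _ e0) := @cY _ w (max0 s).
  rewrite near_withinE => /nbhs_ballP[del /= del0 hdel].
  have /cvgrPdist_lt /(_ _ del0)[N _ hN] := cvg_harmonic (R := R).
  exists N => // n /= Nn; have /andP[t1 t2] := tau_bound n s.
  apply: hdel => //; rewrite -ball_normE /ball_ /= distrC gtr0_norm ?subr_gt0 //.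
  have := hN n Nn; rewrite /= /harmonic sub0r normrN gtr0_norm ?invr_gt0 //.
  by apply: le_lt_trans; rewrite lerBlDl.
Qed.

End JointMeasurability.

(** * The path law with initial distribution mu on F *)

Section InitialLaw.
Context {R : realType} {H : completeNormedModType R} {d : measure_display} {W : measurableType d}.
Variables (F : set H) (Mf : R -> set (set W)) (X : R -> W -> H) (th : R -> W -> W)
  (P : H -> probability W R) (mu : probability (borel H) R).
Hypothesis hd : diffusion F Mf X th P.
Hypothesis mF : measurable (F : set (borel H)).
Local Open Scope ereal_scope.

(** The integral of a nonnegative function is a supremum over simple minorants, so monotonicity
    holds without measurability; the integrands in [revuz] are compared this way. *)
Lemma le_integral_ge0 d' (T : measurableType d') (m : {measure set T -> \bar R}) (D : set T)
  (f g : T -> \bar R) : (forall x, D x -> 0 <= f x) -> (forall x, D x -> f x <= g x) ->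
  \int[m]_(x in D) f x <= \int[m]_(x in D) g x.
Proof.
move=> f0 fg; rewrite !ge0_integralE //; last by move=> x Dx; exact: le_trans (f0 x Dx) (fg x Dx).
apply: le_ereal_sup => _ [h hf <-]; exists h => // x.
apply: le_trans (hf x) _; rewrite !patchE; case: ifP => // /set_mem Dx; exact: fg.
Qed.

Lemma initial_law : exists q : giry (natural_space X) R,
  (forall B, natural_sigma X `[0%R, +oo[ B -> q B = \int[mu]_(z in F) P z B) /\
  (forall h : natural_space X -> \bar R, measurable_fun setT h -> (forall x, 0 <= h x) ->
     \int[q]_x h x = \int[mu]_(z in F) \int[P z]_w h w).
Proof.
have [|q [qB qh]] := @mixture _ _ _ (borel H) (natural_space X) (mu : giry (borel H) R) F
    (fun z => giry_map (measurable_to_natural hd) (P z : giry W R)) mF.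
  by move=> B nB; exact: (df_meas hd nB).
exists q; split=> // h mh h0; rewrite qh //; apply: eq_integral => z _.
exact: giry_int_map.
Qed.

Hypothesis F0 : 0 < mu F.

(** [completed_sigma] quantifies over probabilities carried by [F], while [mu] may charge its
    complement; hence the normalisation. *)
Lemma restricted_law : exists2 m : probability (borel H) R, m F = 1 &
  forall A, measurable (A : set (borel H)) -> m A = 0 -> mu (A `&` F) = 0.
Proof.
have Ff : mu F \is a fin_num by rewrite fin_num_measure.
have e1 : mrestr mu mF [set: borel H] = mu F by rewrite /mrestr setTI.
have h (U : set (borel H)) : mnormalize (mrestr mu mF) mu U = mu (U `&` F) * (fine (mu F))^-1%:E.
  rewrite /mnormalize; case: ifPn => [/orP[]/eqP|_].
  - by move/(eq_trans (esym e1)) => e0; move: F0; rewrite e0 ltxx.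
  - by move/(eq_trans (esym e1)) => e0; move: Ff; rewrite e0.
  - by congr (_ * (fine _)^-1%:E).
have f0 : fine (mu F) != 0%R by rewrite fine_eq0 // gt_eqF.
exists (mnormalize (mrestr mu mF) mu).
  by apply: (eq_trans (h F)); rewrite setIid -{1}(fineK Ff) -EFinM divff.
move=> A mA /(eq_trans (esym (h A))) /eqP; rewrite mule_eq0 => /orP[/eqP //|].
by rewrite eqe invr_eq0 (negbTE f0).
Qed.

Variable q : giry (natural_space X) R.
Hypothesis qB : forall B, natural_sigma X `[0%R, +oo[ B -> q B = \int[mu]_(z in F) P z B.

Lemma completed_sigma_completion J S : J `<=` `[0%R, +oo[ -> completed_sigma F X P J S ->
  completion q S.
Proof.
move=> J0 [_ hS]; have [m mF1 mmu] := restricted_law.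
have [S' [Z [nS' nZ Z0 hZ]]] := hS m mF1; exists S', Z; split=> //.
  apply: (sub_smallest2r _ _ nS') => //.
  by move=> _ [s [B [Js mB ->]]]; exists s, B; split=> //; exact: J0.
have mPZ : measurable_fun (F : set (borel H)) (fun z => P z Z) := df_meas hd nZ.
have [h _] := ae_eq_integral_abs m mF mPZ.
have [A [mA A0 hA]] : ae_eq m F (fun z => P z Z) (cst 0).
  by apply: h; under eq_integral do rewrite gee0_abs //.
apply: (eq_trans (qB nZ)); rewrite -(integral0 mu F); apply: ae_eq_integral => //.
exists (A `&` F); split; [exact: measurableI|exact: mmu|].
move=> z /= hz; have Fz : F z by apply: contrapT => nFz; apply: hz => /nFz.
by split=> //; apply: hA => /= hh; apply: hz.
Qed.

End InitialLaw.

(** * The local time does not charge null sets of the boundary measure *)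

Section Occupation.
Context {R : realType} {H : completeNormedModType R} {ip : H -> H -> R} {e : nat -> H}.
Hypotheses (hip : inner_product ip) (he : orthonormal_basis ip e).
Context {d : measure_display} {W : measurableType d}.
Variables (F : set H) (Mf : R -> set (set W)) (X : R -> W -> H) (th : R -> W -> W)
  (P : H -> probability W R).
Hypothesis hd : diffusion F Mf X th P.
Notation RR := (measurableTypeR R).
Variables (L : R -> W -> R) (Lam : set W).
Hypothesis hth : forall t, 0 <= t -> th t @` Lam `<=` Lam.
Hypothesis hL : forall w, Lam w ->
  [/\ L 0 w = 0, forall t, 0 <= t -> 0 <= L t w,
      {within `[0, +oo[, continuous (fun t => L t w)} &
      forall s t, 0 <= s -> 0 <= t -> L (t + s) w = L t w + L s (th t w)].
Variable S : set H.
Hypothesis mS : measurable (S : set (borel H)).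

Lemma clock_pcaf w : Lam w -> clock (fun s => L s w).
Proof.
move=> Lw; have [L0 _ Lc La] := hL Lw; split=> // s t s0 st.
have ts0 : 0 <= t - s by rewrite subr_ge0.
have -> : t = s + (t - s) by rewrite addrC subrK.
have Lth : Lam (th s w) by apply: (hth s0); exists w.
have [_ Lp _ _] := hL Lth.
by rewrite La // lerDl Lp.
Qed.

Local Open Scope ereal_scope.

(* The maximum with 0 keeps the path where its right continuity is known. *)
Definition visits (w : W) : set R := [set s | (0 <= s)%R /\ S (X (Num.max s 0%R) w)].

Definition occ (t : R) (w : W) : \bar R :=
  if pselect (Lam w) then stieltjes (fun s => L s w) (visits w `&` `]-oo, t]%classic) else 0.

Section Measurability.
Context {d' : measure_display} {W' : measurableType d'} (f : W' -> W).
Hypothesis mf : forall r, (0 <= r)%R -> measurable_fun [set: W'] ((X r \o f) : W' -> borel H).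

(** The parameter [f] lets the same argument serve the original path space and the completed one. *)
Lemma measurable_visits : measurable [set ws : W' * RR | visits (f ws.1) ws.2].
Proof.
have mj := measurable_joint hip he (Y := fun t w => X t (f w)) mf (fun t w t0 => @df_right _ _ _ _ _ _ _ _ _ hd t (f w) t0).
rewrite (_ : [set _ | _] = (snd @^-1` `[0%R, +oo[%classic) `&`
   ((fun ws : W' * RR => X (Num.max ws.2 0%R) (f ws.1) : borel H) @^-1` S)).
  apply: measurableI; rewrite -[X in measurable X]setTI; last exact: mj.
  exact: measurable_snd.
by apply/seteqP; split=> -[w s]; rewrite /visits /= in_itv /= andbT.
Qed.

End Measurability.

Lemma measurable_visits_path w : measurable (visits w : set RR).
Proof.
have mX r : (0 <= r)%R -> measurable_fun [set: W] ((X r \o id) : W -> borel H).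
  by move=> r0; exact: (measurable_X hd r0).
have := measurable_xsection w (measurable_visits mX).
by rewrite /xsection; congr measurable; apply/seteqP; split=> s; rewrite /= inE.
Qed.

Lemma occ_ge0 t w : 0 <= occ t w.
Proof. by rewrite /occ; case: (pselect (Lam w)). Qed.

Lemma occ_fin t w : (0 <= t)%R -> occ t w \is a fin_num.
Proof.
move=> t0; rewrite /occ; case: (pselect (Lam w)) => //= Lw.
rewrite ge0_fin_numE //; apply: (@le_lt_trans _ _ (stieltjes (fun s => L s w) `]-oo, t]%classic)).
  apply: le_measure; rewrite ?inE; [|by []|by move=> x []].
  by apply: measurableI => //; exact: measurable_visits_path.
by rewrite (stieltjes_itvNyc (clock_pcaf Lw) t0) ltry.
Qed.

Lemma shift_Lam t w : (0 <= t)%R -> Lam w -> Lam (th t w).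
Proof. by move=> t0 Lw; apply: (hth t0); exists w. Qed.

Lemma shift_clock t w : (0 <= t)%R -> Lam w ->
  forall s, (0 <= s)%R -> L s (th t w) = (L (t + s) w - L t w)%R.
Proof. by move=> t0 Lw s s0; have [_ _ _ La] := hL Lw; rewrite La //; ring. Qed.

Lemma visits_shift t w s : (0 <= t)%R -> (t <= s)%R -> visits (th t w) (s - t)%R <-> visits w s.
Proof.
move=> t0 ts; have st0 : (0 <= s - t)%R by rewrite subr_ge0.
have s0 := le_trans t0 ts.
by rewrite /visits /= !max_l // (df_shift hd) // subrK; split=> -[_ h].
Qed.

Lemma occ_shift t u w : (0 <= t)%R -> Lam w -> occ u (th t w) =
  stieltjes (fun s => L s w) (`]t, +oo[%classic `&` visits w `&` `]-oo, (t + u)%R]%classic).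
Proof.
move=> t0 Lw; rewrite /occ; case: (pselect (Lam (th t w))) => [Lw'|/(_ (shift_Lam t0 Lw)) //] /=.
rewrite (stieltjes_shift (clock_pcaf Lw) (clock_pcaf Lw') t0 (shift_clock t0 Lw)); last first.
  by apply: measurableI => //; exact: measurable_visits_path.
congr (stieltjes _ _); apply/seteqP; split=> s /=; rewrite !in_itv /= andbT.
  by move=> [ts [/visits_shift h su]]; split; [split=> //; exact: (h t0 (ltW ts))|rewrite -lerBlDl].
move=> [[ts vs] su]; split=> //; split; last by rewrite lerBlDl.
exact/(visits_shift _ t0 (ltW ts)).
Qed.

Lemma occ_subadditive t w : (0 <= t)%R -> occ (t + t)%R w <= occ t w + occ t (th t w).
Proof.
move=> t0; case: (pselect (Lam w)) => Lw; last first.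
  by rewrite {1}/occ; case: (pselect (Lam w)) => // ? /=; rewrite adde_ge0 // occ_ge0.
rewrite (occ_shift _ t0 Lw) /occ; case: (pselect (Lam w)) => //= _.
have mv := measurable_visits_path w.
apply: le_trans (measureU2 _ _ _) => //; try (do ?apply: measurableI => //).
apply: le_measure; rewrite ?inE; try (do ?apply: measurableU; do ?apply: measurableI => //).
move=> s [vs] /=; rewrite !in_itv /= => st.
by have [h|h] := leP s t; [left|right; split=> //; split=> //; rewrite andbT].
Qed.

End Occupation.

Section OccupationNull.
Context {R : realType} {H : completeNormedModType R} {ip : H -> H -> R} {e : nat -> H}.
Hypotheses (hip : inner_product ip) (he : orthonormal_basis ip e).
Context {d : measure_display} {W : measurableType d}.
Variables (F : set H) (Mf : R -> set (set W)) (X : R -> W -> H) (th : R -> W -> W)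
  (P : H -> probability W R).
Hypothesis hd : diffusion F Mf X th P.
Notation RR := (measurableTypeR R).
Variables (L : R -> W -> R) (Lam : set W).
Hypothesis hth : forall t, 0 <= t -> th t @` Lam `<=` Lam.
Hypothesis hL : forall w, Lam w ->
  [/\ L 0 w = 0, forall t, 0 <= t -> 0 <= L t w,
      {within `[0, +oo[, continuous (fun t => L t w)} &
      forall s t, 0 <= s -> 0 <= t -> L (t + s) w = L t w + L s (th t w)].
Variable S : set H.
Hypothesis mS : measurable (S : set (borel H)).
Variables (mu : probability (borel H) R) (E E' : (H -> R) -> (H -> R) -> R).
Hypothesis mF : measurable (F : set (borel H)).
Hypotheses (hE : energy_form mu F E) (hE' : sector_form E E') (cE' : closable mu F E').
Hypothesis hA : associated mu F E' X P.
Hypothesis mL : forall t (B : set R), 0 <= t -> measurable B ->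
  completed_sigma F X P `[0, t] (L t @^-1` B).
Hypothesis mLam : completed_sigma F X P `[0, +oo[ Lam.
Hypothesis F0 : (0 < mu F)%E.
Variable q : giry (natural_space X) R.
Hypothesis qB : forall B, natural_sigma X `[0, +oo[ B -> q B = (\int[mu]_(z in F) P z B)%E.
Hypothesis qI : forall h : natural_space X -> \bar R, measurable_fun setT h ->
  (forall x, (0 <= h x)%E) -> (\int[q]_x h x = \int[mu]_(z in F) \int[P z]_w h w)%E.
Local Open Scope ereal_scope.
Notation Wc := (g_sigma_algebraType (completion q)).

Lemma measurable_Lam : measurable (Lam : set Wc).
Proof.
rewrite completion_measurableE.
exact: (completed_sigma_completion hd mF F0 qB (@subset_refl _ _) mLam).
Qed.

Lemma measurable_L t : (0 <= t)%R -> measurable_fun [set: Wc] (L t \_ Lam : Wc -> R).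
Proof.
move=> t0; apply/(measurable_restrictT _ measurable_Lam); apply: measurable_funTS.
move=> _ B mB; rewrite setTI completion_measurableE.
apply: (completed_sigma_completion hd mF F0 qB _ (mL t0 mB)).
by move=> s; rewrite /= !in_itv /= andbT => /andP[].
Qed.

Lemma measurable_natural_completion (B : set W) : natural_sigma X `[0%R, +oo[ B -> measurable (B : set Wc).
Proof. by move=> nB; rewrite completion_measurableE; exact: (@measurable_completion _ _ (natural_space X)). Qed.

(** The occupation is the mass that a path-dependent finite measure gives to a path-dependent
    section, as in [measurable_section]. *)
Lemma measurable_occ t : (0 <= t)%R -> measurable_fun [set: Wc] (occ X L Lam S t : Wc -> \bar R).
Proof.
move=> t0.
pose k1 (w : Wc) : {measure set RR -> \bar R} :=
  mrestr (stieltjes (fun s => L s w)) (measurable_itv `]-oo, t]).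
pose k0 : {measure set RR -> \bar R} := mzero.
pose k (w : Wc) : {measure set RR -> \bar R} := if pselect (Lam w) then k1 w else k0.
have kE w (B : set RR) : k w B = if pselect (Lam w) then stieltjes (fun s => L s w) (B `&` `]-oo, t]%classic) else 0.
  by rewrite /k; case: (pselect (Lam w)).
have kT w : k w setT = (((L t \_ Lam) w)%:E).
  rewrite kE patchE; case: (pselect (Lam w)) => Lw /=; last by rewrite memNset.
  by rewrite mem_set // setTI (stieltjes_itvNyc (clock_pcaf hth hL Lw) t0).
have mX r : (0 <= r)%R -> measurable_fun [set: Wc] ((X r \o id) : Wc -> borel H).
  move=> r0 _ B mB; rewrite setTI; apply: measurable_natural_completion.
  by rewrite -[X in natural_sigma _ _ X]setTI; apply: (measurable_X_natural r0).
have mQ := measurable_visits hip he hd mS mX.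
rewrite (_ : occ X L Lam S t = fun w => k w (xsection [set ws : Wc * RR | visits X S ws.1 ws.2] w)); last first.
  apply/funext => w; rewrite kE /occ (_ : xsection _ w = visits X S w) //.
  by apply/seteqP; split=> s; rewrite /xsection /= inE.
apply: measurable_section => //; first by move=> w; rewrite kT ltry.
apply: measurable_family; first by move=> w; rewrite kT ltry.
  by rewrite (_ : (fun w => _) = EFin \o (L t \_ Lam)); [apply/measurable_EFinP; exact: measurable_L|apply/funext => w; rewrite kT].
(* Both endpoints are clipped at [t]; the second minimum keeps them ordered. *)
move=> a b; set b' := Num.min b t; set a' := Num.min a b'.
rewrite (_ : (fun w => _) = EFin \o (fun w => (L (Num.max b' 0%R) \_ Lam) w - (L (Num.max a' 0%R) \_ Lam) w)%R).
  by apply/measurable_EFinP; apply: measurable_funB; apply: measurable_L; rewrite le_max lexx orbT.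
apply/funext => w; rewrite kE /= !patchE; case: (pselect (Lam w)) => Lw /=; last by rewrite memNset // subrr.
rewrite mem_set // -(stieltjes_itvoc (clock_pcaf hth hL Lw)); last by rewrite /a' ge_min lexx orbT.
congr (stieltjes _ _); apply/seteqP; split=> x; rewrite /= !in_itv /= /a' /b'.
  by move=> [/andP[ax xb] xt]; rewrite gt_min ax le_min xb xt.
rewrite gt_min le_min => /andP[h /andP[xb xt]]; rewrite xb xt; split=> //; rewrite andbT.
by case/orP: h => //; rewrite ltNge le_min xb xt.
Qed.

(* The truncation is integrable and still subadditive. *)
Definition trunc_occ t w : R := fine (mine (occ X L Lam S t w) 1).

Lemma trunc_occE t w : (0 <= t)%R -> (trunc_occ t w)%:E = mine (occ X L Lam S t w) 1.
Proof.
move=> t0; rewrite /trunc_occ fineK //.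
have := occ_fin hip he hd hth hL mS w t0; case: (occ X L Lam S t w) => // r _.
by rewrite -EFin_min.
Qed.

Lemma trunc_occ_ge0 t w : (0 <= trunc_occ t w)%R.
Proof. by apply: fine_ge0; rewrite le_min occ_ge0 lee01. Qed.

Lemma measurable_trunc_occ t : (0 <= t)%R -> measurable_fun [set: Wc] (trunc_occ t : Wc -> R).
Proof.
move=> t0; apply: (measurableT_comp (f := fine)); first exact: fine_measurable.
by apply: measurable_mine; [exact: measurable_occ|exact: measurable_cst].
Qed.

Lemma trunc_occ_subadditive t w : (0 <= t)%R ->
  (trunc_occ (t + t)%R w)%:E <= (trunc_occ t w)%:E + (trunc_occ t (th t w))%:E.
Proof.
move=> t0; have tt0 : (0 <= t + t)%R by rewrite addr_ge0.
rewrite !trunc_occE //.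
have := occ_subadditive hip he hd hth hL mS w t0.
have := occ_ge0 X L Lam S t w; have := occ_ge0 X L Lam S t (th t w).
have := occ_fin hip he hd hth hL mS w t0; have := occ_fin hip he hd hth hL mS (th t w) t0.
have := occ_fin hip he hd hth hL mS w tt0.
case: (occ _ _ _ _ (t + t)%R w) => // a _; case: (occ _ _ _ _ t (th t w)) => // b _.
case: (occ _ _ _ _ t w) => // c _; rewrite -!EFin_min -!EFinD !lee_fin => b0 c0 abc.
by rewrite ge_min; case: (leP b 1%R) => h1; case: (leP c 1%R) => h2; apply/orP; [left|right|right|right]; lra.
Qed.

Lemma invariant_set s B : (0 < s)%R -> natural_sigma X `[0%R, +oo[ B -> q (th s @^-1` B) = q B.
Proof.
move=> s0 nB.
transitivity (\int[mu]_(z in F) P z (th s @^-1` B)); first exact: (qB (natural_shift hd (ltW s0) nB)).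
by rewrite (stationary hd mF hE hE' cE' hA s0 nB); exact: esym (qB nB).
Qed.

Lemma invariant_integral s (h : natural_space X -> \bar R) : (0 < s)%R ->
  measurable_fun setT h -> (forall w, 0 <= h w) -> \int[q]_w h (th s w) = \int[q]_w h w.
Proof.
move=> s0 mh h0; have ms := measurable_shift_natural hd (ltW s0).
transitivity (\int[giry_map ms q]_w h w); first exact: esym (giry_int_map ms q mh h0).
by apply: eq_measure_integral => B nB _; exact: invariant_set.
Qed.

Variables (G : set H) (dG : {finite_measure set (borel H) -> \bar R}).
Hypothesis hR : revuz mu F G X P L dG.
Hypothesis FG : F `<=` G.
Hypothesis dS : dG S = 0.

Let c t := \int[mu]_(x in F)
      ((\int[P x]_w \int[stieltjes (fun s => L s w)]_(s in `[0%R, t]) (\1_S (X s w))%:E) * (\1_G x)%:E).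

Let occ_le_integral t w :
  occ X L Lam S t w <= \int[stieltjes (fun s => L s w)]_(s in `[0%R, t]) (\1_S (X s w))%:E.
Proof.
rewrite /occ; case: (pselect (Lam w)) => Lw /=; last by apply: integral_ge0 => s _; rewrite lee_fin.
have mv := measurable_visits_path hip he hd mS w.
rewrite (_ : _ `&` _ = visits X S w `&` `[0%R, t]%classic); last first.
  apply/seteqP; split=> s /= [vs]; rewrite !in_itv /= => h; split=> //; first by case: vs => ->.
  by case/andP: h.
rewrite -integral_indic //; apply: le_integral_ge0 => s; rewrite /= in_itv /= => /andP[s0 st].
  by rewrite lee_fin.
rewrite lee_fin !indicE; case: (boolP (s \in visits X S w)) => // /set_mem[_].
by rewrite max_l // => h; rewrite mem_set.
Qed.

(** The minorant [Y] sits below the occupation everywhere, which is below the inner integral of the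
    Revuz formula. *)
Let expectation_le t (Y : natural_space X -> \bar R) : (0 <= t)%R -> measurable_fun setT Y ->
  (forall w, 0 <= Y w <= (trunc_occ t w)%:E) -> \int[q]_w Y w <= c t.
Proof.
move=> t0 mY hY; rewrite qI //; last by move=> w; case/andP: (hY w).
apply: le_integral_ge0 => x Fx; first by apply: integral_ge0 => w _; case/andP: (hY w).
rewrite indicE mem_set ?mule1; last exact: FG.
apply: le_integral_ge0 => w _; first by case/andP: (hY w).
apply: le_trans (occ_le_integral t w); case/andP: (hY w) => _ /le_trans; apply.
by rewrite trunc_occE // ge_min lexx.
Qed.

(** The Revuz limit for the indicator of [S] is 0, because [dG] does not charge [S]; so [c t] is
    negligible compared with [t]. *)
Let small_time eps : (0 < eps)%R -> exists2 del, (0 < del)%R & forall t, (0 < t)%R -> (t < del)%R ->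
  c t <= (t * eps)%:E.
Proof.
move=> e0.
have i0 : \int[dG]_(x in F) (\1_S x)%:E = 0.
  rewrite integral_indic //; apply/eqP; rewrite eq_le measure_ge0 andbT -dS.
  by apply: le_measure; rewrite ?inE; [exact: measurableI|exact: mS|move=> x []].
have m1S : measurable_fun [set: borel H] (\1_S : H -> R) by exact: measurable_indic.
have := hR m1S (fun x => ler0n _ _); rewrite i0 => cv.
have nb : nbhs (0 : \bar R) [set x | x < eps%:E].
  by apply: open_nbhs_nbhs; split; [exact: open_ereal_lt_ereal|rewrite /= lte_fin].
have : nbhs (0%R : R) [set t : R | (0 < t)%R -> (t^-1)%:E * c t < eps%:E] := cv _ nb.
move=> /nbhs_ballP[del /= del0 hdel]; exists del => // t t0 td.
have := hdel t; rewrite -ball_normE /ball_ /= sub0r normrN gtr0_norm // => /(_ td t0).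
rewrite -/(c t) => h.
have -> : c t = t%:E * (t^-1%:E * c t) by rewrite muleA -EFinM divff ?gt_eqF // mul1e.
by rewrite EFinM lee_pmul2l ?lte_fin // ltW.
Qed.

(* Subadditivity and invariance give E_q[Y_t] <= 2^k E_q[Y_(t/2^k)] for the
   truncated occupation Y, and the Revuz formula makes the right-hand side
   t * o(1). *)
Theorem occ_null : exists Z : set W, [/\ natural_sigma X `[0%R, +oo[ Z,
  \int[mu]_(x in F) P x Z = 0 & forall w, Lam w -> ~ Z w -> forall n : nat, occ X L Lam S n%:R w = 0].
Proof.
have hv (t : R) : exists YZ : (natural_space X -> \bar R) * set (natural_space X), (0 <= t)%R ->
   [/\ measurable_fun setT YZ.1, measurable YZ.2, q YZ.2 = 0,
    forall w, 0 <= YZ.1 w <= (trunc_occ t w)%:E & forall w, ~ YZ.2 w -> YZ.1 w = (trunc_occ t w)%:E].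
  case: (leP 0%R t) => t0; last by exists (cst 0, set0).
  have [Y [Z [h1 h2 h3 h4 h5]]] := measurable_version (measurable_trunc_occ t0) (trunc_occ_ge0 t).
  by exists (Y, Z).
have {hv}[YZ hv] := choice hv.
pose y t := \int[q]_w (YZ t).1 w.
have y_half t : (0 < t)%R -> y (t + t)%R <= 2%:E * y t.
  move=> t0; have [mY mZ Z0 hY eY] := hv t (ltW t0).
  have [mY2 mZ2 Z02 hY2 eY2] := hv (t + t)%R (addr_ge0 (ltW t0) (ltW t0)).
  have Y0 w : 0 <= (YZ t).1 w by case/andP: (hY w).
  have mth := measurable_shift_natural hd (ltW t0).
  have mYth : measurable_fun setT (fun w : natural_space X => (YZ t).1 (th t w)).
    exact: (measurableT_comp mY mth).
  have -> : 2%:E * y t = \int[q]_w ((YZ t).1 w + (YZ t).1 (th t w)).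
    by rewrite ge0_integralD // invariant_integral // -mule2n mule_natl.
  apply: ae_ge0_le_integral => //.
  - by move=> w _; case/andP: (hY2 w).
  - by move=> w _; rewrite adde_ge0.
  - exact: emeasurable_funD.
  (* The minorants obey subadditivity off their null sets; the shifted null set is null by
     invariance. *)
  - exists ((YZ t).2 `|` th t @^-1` (YZ t).2); split.
    + by apply: measurableU => //; rewrite -[X in measurable X]setTI; exact: mth.
    + have := invariant_set t0 mZ; rewrite Z0 => Zt0.
      apply: (eq_trans (measureU0 _ _ Zt0)) => //.
      by rewrite -[X in measurable X]setTI; exact: mth.
    + move=> w /= hw; apply: contrapT => /not_orP[nZ nZ']; apply: hw => _.
      by rewrite (eY w nZ) (eY _ nZ') (le_trans _ (trunc_occ_subadditive w (ltW t0))) //; case/andP: (hY2 w).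
have y_pow k t : (0 < t)%R -> y t <= (2 ^+ k)%:E * y (t / 2 ^+ k)%R.
  elim: k t => [|k ih] t t0; first by rewrite expr0 divr1 mul1e.
  have tk : (0 < t / 2 ^+ k)%R by rewrite divr_gt0 // exprn_gt0.
  apply: le_trans (ih t t0) _; rewrite exprSr EFinM -muleA.
  apply: lee_wpmul2l; first by rewrite lee_fin exprn_ge0.
  have -> : (t / 2 ^+ k = t / (2 ^+ k * 2) + t / (2 ^+ k * 2))%R.
    by field; rewrite expf_neq0.
  by apply: y_half; rewrite divr_gt0 // mulr_gt0 // exprn_gt0.
have y0 t : (0 < t)%R -> y t = 0.
  move=> t0; apply/eqP; rewrite eq_le; apply/andP; split; last first.
    by apply: integral_ge0 => w _; have [_ _ _ h _] := hv t (ltW t0); case/andP: (h w).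
  apply/lee_addgt0Pr => eps e0; rewrite add0e.
  (* The tolerance is chosen so that 2^k (t / 2^k) (eps / t) is exactly [eps]. *)
  have et0 : (0 < eps / t)%R by rewrite divr_gt0.
  have [del del0 hdel] := small_time et0.
  have [k hk] : exists k : nat, (t / 2 ^+ k < del)%R.
    have td0 : (0 < del / t)%R by rewrite divr_gt0.
    have /cvgrPdist_lt /(_ _ td0)[k _ hk] := @cvg_expr R (2^-1) (ltac:(rewrite ger0_norm ?invr_ge0 // invf_lt1 ?ltr1n //)).
    exists k; have := hk k (leqnn k); rewrite /= sub0r normrN ger0_norm ?exprn_ge0 ?invr_ge0 //.
    by rewrite exprVn ltr_pdivlMr // mulrC.
  have tk : (0 < t / 2 ^+ k)%R by rewrite divr_gt0 // exprn_gt0.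
  apply: le_trans (y_pow k t t0) _.
  have [mY _ _ hY _] := hv _ (ltW tk).
  apply: (@le_trans _ _ ((2 ^+ k)%:E * (t / 2 ^+ k * (eps / t))%:E)).
    apply: lee_wpmul2l; first by rewrite lee_fin exprn_ge0.
    exact: le_trans (expectation_le (ltW tk) mY hY) (hdel _ tk hk).
  rewrite -EFinM lee_fin le_eqVlt; apply/orP; left; apply/eqP; field.
  by rewrite gt_eqF //= expf_neq0.
(* The bad event at horizon n + 1: the minorant may differ from the occupation, or is not zero.
   Integer horizons suffice because the occupation is monotone in time. *)
pose Zn (n : nat) := (YZ n.+1%:R).2 `|` [set w | (YZ n.+1%:R).1 w != 0].
have n0 (n : nat) : (0 < n.+1%:R :> R)%R by [].
have mZn n : measurable (Zn n).
  have [mY mZ _ _ _] := hv n.+1%:R (ltW (n0 n)); apply: measurableU => //.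
  rewrite (_ : [set _ | _] = (YZ n.+1%:R).1 @^-1` (~` [set 0])); last first.
    by apply/seteqP; split=> w /= /eqP.
  by rewrite -[X in measurable X]setTI; apply: mY => //; exact: measurableC.
have Zn0 n : q (Zn n) = 0.
  have [mY mZ Z0 hY _] := hv n.+1%:R (ltW (n0 n)).
  have [h _] := ae_eq_integral_abs q measurableT mY.
  have [A [mA A0 hAA]] : ae_eq q setT (YZ n.+1%:R).1 (cst 0).
    apply: h; rewrite -[RHS](y0 _ (n0 n)); apply: eq_integral => w _.
    by rewrite gee0_abs //; case/andP: (hY w).
  apply: (subset_measure0 (mZn n) (measurableU _ _ mZ mA)).
    move=> w [Zw|/= nz]; [by left|right]; apply: hAA => /= hh; move: nz; rewrite hh //.
    by rewrite eqxx.
  by apply: (eq_trans (measureU0 mZ mA A0)).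
exists (\bigcup_n Zn n); split; first exact: (@bigcupT_measurable _ (natural_space X)).
  have mU : natural_sigma X `[0%R, +oo[ (\bigcup_n Zn n) by exact: (@bigcupT_measurable _ (natural_space X)).
  by rewrite -(qB mU); exact: (null_bigcup mZn Zn0).
have mono w (s t : R) : (0 <= s)%R -> (s <= t)%R -> occ X L Lam S t w = 0 -> occ X L Lam S s w = 0.
  move=> s0 st; rewrite /occ; case: (pselect (Lam w)) => //= Lw h.
  have mv := measurable_visits_path hip he hd mS w.
  apply: (subset_measure0 _ _ _ h); try by apply: measurableI.
  by move=> x [vx]; rewrite /= !in_itv /= => /le_trans h'; split=> //; exact: h'.
move=> w Lw nZ n; apply: (@mono w n%:R n.+1%:R) => //; first by rewrite ler_nat.
have nZn : ~ Zn n w by move=> h; apply: nZ; exists n.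
have [_ _ _ _ eY] := hv n.+1%:R (ltW (n0 n)).
have [nz1 /negP/negPn/eqP nz2] : ~ (YZ n.+1%:R).2 w /\ ~ ((YZ n.+1%:R).1 w != 0) by split=> h; apply: nZn; [left|right].
have := trunc_occE w (ltW (n0 n)); rewrite -(eY w nz1) nz2.
have := occ_ge0 X L Lam S n.+1%:R w; rewrite le_eqVlt => /predU1P[<- //|h].
by rewrite /mine; case: ifP => // _ e01; move: h; rewrite -?e01 ?ltxx // => _; move/eqP: e01; rewrite eq_sym onee_eq0.
Qed.

End OccupationNull.

(** * From almost every to quasi-every starting point *)

Section LocalTime.
Context {R : realType} {H : completeNormedModType R} {ip : H -> H -> R} {e : nat -> H}.
Hypotheses (hip : inner_product ip) (he : orthonormal_basis ip e).
Context {d : measure_display} {W : measurableType d}.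
Variables (F : set H) (Mf : R -> set (set W)) (X : R -> W -> H) (th : R -> W -> W)
  (P : H -> probability W R).
Hypothesis hd : diffusion F Mf X th P.
Variables (L : R -> W -> R) (S : set H).
Hypothesis mS : measurable (S : set (borel H)).
Variables (mu : probability (borel H) R) (E E' : (H -> R) -> (H -> R) -> R).
Hypothesis mF : measurable (F : set (borel H)).
Hypotheses (hE : energy_form mu F E) (hE' : sector_form E E') (cE' : closable mu F E').
Hypothesis hA : associated mu F E' X P.
Hypothesis hpcaf : pcaf mu F E' X th P L.
Hypothesis F0 : (0 < mu F)%E.
Variables (G : set H) (dG : {finite_measure set (borel H) -> \bar R}).
Hypothesis hR : revuz mu F G X P L dG.
Hypothesis FG : F `<=` G.
Hypothesis dS : dG S = 0%E.

(** Positive times are covered by the intervals after 1 / (m + 1), where the shifted path is good,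
    and the clock gives no mass to times up to 0. *)
Lemma visits_null (Lam : set W) (Z : set W) w :
  (forall t, 0 <= t -> th t @` Lam `<=` Lam) ->
  (forall w, Lam w ->
    [/\ L 0 w = 0, forall t, 0 <= t -> 0 <= L t w,
      {within `[0, +oo[, continuous (fun t => L t w)} &
      forall s t, 0 <= s -> 0 <= t -> L (t + s) w = L t w + L s (th t w)]) ->
  (forall w, Lam w -> ~ Z w -> forall n : nat, occ X L Lam S n%:R w = 0%E) ->
  Lam w -> (forall m : nat, ~ Z (th m.+1%:R^-1 w)) ->
  stieltjes (fun s => L s w) (visits X S w) = 0%E.
Proof.
move=> hth hL hZ Lw nZ.
have cl := clock_pcaf hth hL Lw; have mv := measurable_visits_path hip he hd mS w.
pose V (m n : nat) := `]m.+1%:R^-1, +oo[%classic `&` visits X S w `&` `]-oo, m.+1%:R^-1 + n%:R]%classic.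
have mV m n : measurable (V m n) by apply: measurableI => //; exact: measurableI.
have V0 m n : stieltjes (fun s => L s w) (V m n) = 0%E.
  have m0 : 0 <= m.+1%:R^-1 :> R by rewrite invr_ge0.
  rewrite -(occ_shift hip he hd hth hL mS n%:R m0 Lw).
  by apply: hZ => //; apply: (hth _ m0); exists w.
have mVm m : measurable (\bigcup_n V m n) by exact: bigcupT_measurable.
have Vm0 m : stieltjes (fun s => L s w) (\bigcup_n V m n) = 0%E.
  exact: (@null_bigcup _ _ (measurableTypeR R) _ _ (mV m) (V0 m)).
have mU : measurable (\bigcup_m \bigcup_n V m n) by exact: bigcupT_measurable.
have U0 := @null_bigcup _ _ (measurableTypeR R) _ _ mVm Vm0.
have mN : measurable (`]-oo, 0%R]%classic : set (measurableTypeR R)) by exact: measurable_itv.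
have hU := eq_trans (measureU0 mN mU U0) (stieltjes_itvNy0 cl).
apply: (subset_measure0 mv (measurableU _ _ mN mU) _ hU).
move=> s vs; have [s0|s0] := leP s 0; [by left; rewrite /= in_itv|right].
have /cvgrPdist_lt /(_ _ s0)[m _ hm] := cvg_harmonic (R := R).
exists m => //; exists (Num.bound s) => //; split; first split => //.
  rewrite /= in_itv /= andbT; have := hm m (leqnn m).
  by rewrite /= /harmonic sub0r normrN ger0_norm // invr_ge0.
rewrite /= in_itv /=; apply/ltW/(lt_le_trans (archi_boundP (ltW s0))).
by rewrite lerDr invr_ge0.
Qed.

(* The null set of starting points is upgraded to an exceptional one by running
   the process for a short time 1/m: P_(1/m) 1_Z is quasi-continuous and zero
   almost everywhere. *)
Theorem local_time_support : exists (N : nat -> set H) (Fk : nat -> nat -> set H),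
  [/\ forall m, capnest mu F E (Fk m), forall m, N m `<=` F `\` \bigcup_k Fk m k &
   forall z, F z -> (forall m, ~ N m z) -> {ae P z, forall w,
     clock (fun s => L s w) /\ stieltjes (fun s => L s w) (visits X S w) = 0%E} ].
Proof.
have [mL [N1 [Lam [N1x mLam PLam hth hL]]]] := hpcaf.
have [q [qB qI]] := initial_law mu hd mF.
have [Z [nZ Z0 hZ]] := occ_null hip he hd hth hL mS mF hE hE' cE' hA mL mLam F0 qB qI hR FG dS.
have [F1 hF1 N1F] := N1x.
have m0 (m : nat) : 0 < m.+1%:R^-1 :> R by rewrite invr_gt0.
pose v := prob_of F P Z.
have mv := measurable_prob_of hd mF nZ.
have hm (m : nat) : exists Fk : nat -> set H, capnest mu F E Fk /\
    forall k x, Fk k x -> transition X P m.+1%:R^-1 v x = 0.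
  have [Tt _ /(_ m.+1%:R^-1 v (m0 m) mv)[|qc _]] := hA.
    by exists 1 => x; apply: prob_of_le1; exact: (natural_measurable hd nZ).
  have ae0 := transition_ae0 hd mF hE hE' cE' hA (m0 m) nZ Z0.
  have [Fk h1 h2] := quasi_continuous_ae0 mF hE hip he hE' cE' qc ae0.
  by exists Fk.
have [F2 hF2] := choice hm.
(* Index 0 is kept for the exceptional set of the additive functional. *)
exists (fun m => if m is m'.+1 then [set x | F x /\ transition X P m'.+1%:R^-1 v x != 0] else N1).
exists (fun m => if m is m'.+1 then F2 m' else F1); split.
- case=> [|m]; last by have [] := hF2 m.
  exact: (nest_capnest mF hE hE' cE' hF1).
- case=> [|m] //= x [Fx nx]; split=> // -[k _ Fk]; have [_ h] := hF2 m.
  by rewrite (h k x Fk) eqxx in nx.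
move=> z Fz nN.
have mLm : measurable Lam by case: mLam.
have aeL : {ae P z, forall w, Lam w}.
  exists (~` Lam); split=> //; first exact: measurableC.
  by rewrite probability_setC // PLam ?subee //; split=> //; exact: (nN 0%N).
have aeZ : {ae P z, forall w, forall m : nat, ~ Z (th m.+1%:R^-1 w)}.
  apply: ae_all => m; exists (th m.+1%:R^-1 @^-1` Z); split.
  - exact: (natural_measurable hd (natural_shift hd (ltW (m0 m)) nZ)).
  - apply: (eq_trans (esym (transition_prob_of hd mF Fz (ltW (m0 m)) nZ))); congr EFin.
    by apply/eqP/negPn/negP => h; apply: (nN m.+1).
  - by move=> w /= /contrapT.
move: aeL aeZ; apply: ae_imp2 => w Lw nZw; split; first exact: (clock_pcaf hth hL Lw).
exact: (visits_null hth hL hZ Lw nZw).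
Qed.

End LocalTime.

(** * The equation along a path *)

Section WeakIntegral.
Context {R : realType} {H : completeNormedModType R} {ip : H -> H -> R}.
Hypothesis hip : inner_product ip.
Context d (T : measurableType d) (m : {measure set T -> \bar R}).
Variables (D0 : set T) (f : T -> H) (b : T -> R).
Hypothesis mD0 : measurable D0.
Hypothesis mf : forall h, measurable_fun D0 (fun x => ip h (f x)).
Hypothesis ib : m.-integrable D0 (EFin \o b).
Hypothesis fb : {ae m, forall x, D0 x -> `|f x| <= b x}.

Lemma weak_le (h : H) : {ae m, forall x, D0 x -> `|ip h (f x)| <= `|h| * b x}.
Proof.
move: fb; apply: ae_imp => x hx /hx xb; apply: le_trans (cauchy_schwarz hip _ _) _.
by rewrite ler_wpM2l.
Qed.

Lemma weak_integrable (h : H) D : measurable D -> D `<=` D0 ->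
  m.-integrable D (EFin \o (fun x => ip h (f x))).
Proof.
move=> mD DD0; apply: (integrableS mD0 mD DD0); apply/integrableP; split.
  exact/measurable_EFinP.
have iZ := integrableZl mD0 `|h| ib.
have /integrableP[mZ _] := iZ.
apply: (@le_lt_trans _ _ (\int[m]_(x in D0) `|(`|h|%:E * (b x)%:E)|)%E).
  apply: ae_ge0_le_integral => //.
  - by apply: measurableT_comp => //; exact/measurable_EFinP.
  - exact: measurableT_comp.
  - move: (weak_le h); apply: ae_imp => x hx Dx; rewrite -EFinM lee_fin.
    exact: le_trans (hx Dx) (ler_norm _).
by have /integrableP[] := iZ.
Qed.

Lemma weak_sum n (c : nat -> R) (u : nat -> H) D : measurable D -> D `<=` D0 ->
  \sum_(k < n) c k * \int[m]_(x in D) ip (u k) (f x) =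
  \int[m]_(x in D) ip (\sum_(k < n) c k *: u k) (f x).
Proof.
move=> mD DD0; elim: n => [|n ih].
  rewrite !big_ord0; under eq_Rintegral do rewrite (ip0l hip).
  by rewrite Rintegral_cst // mul0r.
rewrite big_ord_recr /= ih big_ord_recr /=.
under [RHS]eq_Rintegral do rewrite (ipDl hip) (ipZl hip).
rewrite RintegralD //; last 2 first.
- exact: weak_integrable.
- exact: (integrableZl mD (c n) (weak_integrable (u n) mD DD0)).
by rewrite RintegralZl //; exact: weak_integrable.
Qed.

Lemma weak_sub (h h' : H) D : measurable D -> D `<=` D0 ->
  \int[m]_(x in D) ip h (f x) - \int[m]_(x in D) ip h' (f x) = \int[m]_(x in D) ip (h - h') (f x).
Proof.
move=> mD DD0; rewrite -RintegralB //; try exact: weak_integrable.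
by apply: eq_Rintegral => x _; rewrite (ipBl hip).
Qed.

(** The bound involves the whole of [D0], hence is the same for all subintervals: this is the source
    of uniformity in time. *)
Lemma weak_bound (h : H) D : measurable D -> D `<=` D0 ->
  `|\int[m]_(x in D) ip h (f x)| <= `|h| * \int[m]_(x in D0) `|b x|.
Proof.
move=> mD DD0; have i1 := weak_integrable h mD DD0.
have inb : m.-integrable D0 (EFin \o (fun x => `|b x|)) := integrable_norm ib.
apply: le_trans (le_normr_Rintegral mD i1) _.
rewrite -RintegralZl //.
have iD : m.-integrable D0 (EFin \o (fun x => `|ip h (f x)|)).
  exact: integrable_norm (weak_integrable h mD0 (@subset_refl _ D0)).
have iZ : m.-integrable D0 (EFin \o (fun x => `|h| * `|b x|)) := integrableZl mD0 `|h| inb.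
have fin1 := integrable_fin_num mD0 iD; have fin2 := integrable_fin_num mD0 iZ.
have fin3 : (\int[m]_(x in D) (`|ip h (f x)|)%:E)%E \is a fin_num.
  by apply: (integrable_fin_num mD); exact: integrable_norm i1.
apply: fine_le => //.
apply: (@le_trans _ _ (\int[m]_(x in D0) (`|ip h (f x)|)%:E)%E).
  apply: ge0_subset_integral => //.
  exact: (measurable_int m iD).
apply: ae_ge0_le_integral => //.
- exact: (measurable_int m iD).
- exact: (measurable_int m iZ).
- move: (weak_le h); apply: ae_imp => x hx Dx; rewrite lee_fin.
  by apply: le_trans (hx Dx) _; rewrite ler_wpM2l // ler_norm.
Qed.

End WeakIntegral.

Lemma integrable_constant {R : realType} d (T : measurableType d) (m : {measure set T -> \bar R})
  (D : set T) (c : R) : measurable D -> (m D < +oo)%E -> m.-integrable D (EFin \o (fun=> c)).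
Proof.
move=> mD fD; apply/integrableP; split; first by apply/measurable_EFinP; exact: measurable_cst.
rewrite (_ : \int[m]_(x in D) _ = \int[m]_(x in D) (`|c|)%:E)%E; last exact: eq_integral.
by rewrite integral_cst // lte_mul_pinfty // lee_fin.
Qed.

(** * Consequences of the Girsanov density and of the Ito integral *)

Section AbsoluteContinuity.
Context {R : realType} {d : measure_display} {W : measurableType d}.

Lemma density_ae (Pz Pt : probability W R) (D : W -> R) (Q : W -> Prop) :
  (forall S, measurable S -> Pt S = (\int[Pz]_(w in S) (expR (D w))%:E)%E) ->
  {ae Pz, forall w, Q w} -> {ae Pt, forall w, Q w}.
Proof.
move=> hD [A [mA A0 hA]]; exists A; split=> //.
apply: (eq_trans (hD A mA)); apply/eqP; rewrite eq_le; apply/andP; split; last first.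
  by apply: integral_ge0 => w _; rewrite lee_fin expR_ge0.
(* Comparing with the constant infinity on a null set dispenses with the measurability of [D]. *)
apply: (@le_trans _ _ (\int[Pz]_(w in A) +oo)%E).
  by apply: le_integral_ge0 => w _; [rewrite lee_fin expR_ge0|rewrite leey].
by rewrite integral_cst // [X in (_ * X)%E](_ : _ = 0%E) ?mule0.
Qed.

Variable Mf : R -> set (set W).
Hypothesis hM : filtration Mf.
Notation RR := (measurableTypeR R).
Notation leb := (@lebesgue_measure R).

Lemma measurable_simple_val (p : simple_process) : simple_wf Mf p ->
  measurable_fun [set: W * RR] (fun ws => simple_val p ws.2 ws.1).
Proof.
move=> [p0 p1 p2 p3].
have t0 j : 0 <= sp_time p j by elim: j => // j ih; exact: le_trans ih (p1 j).
rewrite /simple_val; apply: measurable_sum => j; apply: measurable_funM.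
  apply: (measurableT_comp (f := sp_coef p j)); last exact: measurable_fst.
  by move=> _ B mB; rewrite setTI; apply: (fl_sub hM (t0 j)); exact: p3.
rewrite (_ : (fun ws : W * RR => _) = \1_`](sp_time p j), (sp_time p j.+1)] \o snd).
  by apply: measurableT_comp; [exact: measurable_indic|exact: measurable_snd].
by apply/funext => ws; rewrite /= indicE mem_setE in_itv.
Qed.

(** One simple process at L2 distance less than 1 is enough: by Tonelli almost every path of the
    difference is square integrable, and a simple path is bounded. *)
Lemma ito_integrand_integrable (Q : probability W R) (T : R) (phi V I : R -> W -> R) :
  measurable_fun [set: W * RR] (fun ws => phi (Num.max ws.2 0) ws.1) ->
  ito_integral Q Mf T phi V I ->
  {ae Q, forall w, leb.-integrable `[0, T] (EFin \o (fun s => phi s w))}.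
Proof.
move=> mphi [_ [p [pwf pcvg _]]].
have nb : nbhs (0%E : \bar R) [set x | (x < 1)%E].
  by apply: open_nbhs_nbhs; split; [exact: open_ereal_lt_ereal|rewrite /= lte01].
have [n _ /(_ n (leqnn n)) /= hn] := pcvg _ nb.
have mp := measurable_simple_val (pwf n).
pose D (w : W) (s : R) := simple_val (p n) s w - phi (Num.max s 0) w.
pose f (ws : W * RR) := ((D ws.1 ws.2) ^+ 2 * \1_`[0, T] ws.2)%:E.
have mD : measurable_fun [set: W * RR] (fun ws => D ws.1 ws.2) by exact: measurable_funB.
have m1 : measurable_fun [set: W * RR] ((\1_`[0, T] : RR -> R) \o snd).
  by apply: measurableT_comp; [exact: measurable_indic|exact: measurable_snd].
have mf : measurable_fun [set: W * RR] f.
  by apply/measurable_EFinP; apply: measurable_funM => //; exact: measurable_funX.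
have f0 ws : (0 <= f ws)%E by rewrite /f lee_fin mulr_ge0 // sqr_ge0.
have fE w : (\int[leb]_(s in `[0%R, T]) ((simple_val (p n) s w - phi s w) ^+ 2)%:E =
   \int[leb]_s f (w, s))%E.
  rewrite integral_mkcond; apply: eq_integral => s _; rewrite patchE /f /D /= indicE.
  case: ifP => h; last by rewrite mulr0.
  by rewrite mulr1 max_l //; move: h; rewrite mem_setE in_itv /= => /andP[].
have mI : measurable_fun [set: W] (fun w => \int[leb]_s f (w, s))%E.
  exact: measurable_fun_fubini_tonelli_F.
have iI : Q.-integrable setT (fun w => \int[leb]_s f (w, s))%E.
  apply/integrableP; split=> //.
  have -> : (\int[Q]_w `|\int[leb]_s f (w, s)| = \int[Q]_w
     \int[leb]_(s in `[0%R, T]) ((simple_val (p n) s w - phi s w) ^+ 2)%:E)%E.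
    by apply: eq_integral => w _; rewrite gee0_abs ?fE // integral_ge0.
  exact: lt_trans hn (ltry _).
have := integrable_ae measurableT iI; apply: ae_imp => w /(_ Logic.I) fw.
have msec (g : W * RR -> R) : measurable_fun setT g -> measurable_fun [set: RR] (fun s => g (w, s)).
  exact: measurable_fun_pair2.
have mDw : measurable_fun [set: RR] (D w) := msec _ mD.
have mT : measurable (`[0, T]%classic : set RR) by exact: measurable_itv.
have i1 : leb.-integrable (`[0, T]%classic : set RR) (EFin \o (fun s => (D w s) ^+ 2)).
  apply/integrableP; split.
    by apply/measurable_EFinP; apply: measurable_funTS; exact: measurable_funX.
  have -> : (\int[leb]_(s in `[0%R, T]) `|((D w s) ^+ 2)%:E| = \int[leb]_s f (w, s))%E.
    rewrite -fE; apply: eq_integral => s; rewrite inE /= in_itv /= => /andP[s0 _].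
    by rewrite ger0_norm ?sqr_ge0 // /D max_l.
  by rewrite -ge0_fin_numE // integral_ge0.
have [C hC] : exists C, forall s, `|simple_val (p n) s w| <= C.
  have [_ _ p2 _] := pwf n; have [M hMM] := choice p2.
  exists (\sum_(j < sp_size (p n)) M j) => s; apply: le_trans (ler_norm_sum _ _ _) _.
  apply: ler_sum => j _; rewrite normrM -[leRHS]mulr1; apply: ler_pM => //.
  by case: (_ < _ <= _); rewrite ?normr1 ?normr0.
have fleb : (leb `[0%R, T]%classic < +oo)%E.
  by rewrite lebesgue_measure_itv; case: ifP => // _; rewrite -EFinD ltry.
have iC : leb.-integrable (`[0, T]%classic : set RR) (EFin \o (fun=> 1 + C)).
  exact: integrable_constant.
have iB := integrableD mT i1 iC.
apply: (le_integrable _ _ _ iB) => //.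
  apply/measurable_EFinP.
  apply: (@eq_measurable_fun _ _ RR _ _ (fun s => phi (Num.max s 0) w)).
    by move=> s; rewrite inE /= in_itv /= => /andP[s0 _]; rewrite max_l.
  by apply: measurable_funTS; exact: (msec _ mphi).
move=> s; rewrite /= in_itv /= => /andP[s0 _]; rewrite lee_fin.
have -> : phi s w = simple_val (p n) s w - D w s by rewrite /D max_l // opprB addrC subrK.
apply: le_trans (ler_normB _ _) _; apply: le_trans (ler_norm _).
have := sqr_ge0 (`|D w s| - 1); rewrite -[D w s ^+ 2]real_normK ?num_real //.
by have := hC s; have := normr_ge0 (D w s); nra.
Qed.

End AbsoluteContinuity.

Section BoundaryClock.
Context {R : realType} {H : completeNormedModType R} {d : measure_display} {W : measurableType d}.
Variables (X : R -> W -> H) (L : R -> W -> R) (S K : set H) (w : W).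
Hypothesis clk : clock (fun s => L s w).
Hypothesis mS : measurable (visits X S w : set (measurableTypeR R)).
Hypothesis mK : measurable (visits X K w : set (measurableTypeR R)).
Hypothesis S0 : stieltjes (fun s => L s w) (visits X S w) = 0%E.
Hypothesis SK : ~` K `<=` S.

(** Times spent off [K] are visits to [S], which the clock does not charge; so the indicator
    integrates to the full mass of [[0, t]]. *)
Lemma integral_boundary_clock t : 0 <= t ->
  (\int[stieltjes (fun s => L s w)]_(s in `[0%R, t]) (\1_K (X s w))%:E = (L t w)%:E)%E.
Proof.
move=> t0; set m := stieltjes _.
have mT : measurable (`[0, t]%classic : set (measurableTypeR R)) by exact: measurable_itv.
have -> : (\int[m]_(s in `[0%R, t]) (\1_K (X s w))%:E = m (visits X K w `&` `[0%R, t]%classic))%E.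
  rewrite -integral_indic //; apply: eq_integral => s; rewrite inE /= in_itv /= => /andP[s0 _].
  congr EFin; rewrite !indicE; congr (nat_of_bool _)%:R; apply/idP/idP; rewrite !inE.
    by move=> h; split=> //; rewrite max_l.
  by case=> _; rewrite max_l.
rewrite -(stieltjes_itvcc clk t0) -/m; apply/eqP; rewrite eq_le; apply/andP; split.
  by apply: le_measure; rewrite ?inE; [exact: measurableI|exact: mT|move=> x []].
have mI : measurable (visits X K w `&` `[0, t]%classic : set (measurableTypeR R)) by exact: measurableI.
rewrite -(measureU0 mI mS S0); apply: le_measure; rewrite ?inE; [exact: mT|exact: measurableU|].
move=> s st; have s0 : 0 <= s by move: st; rewrite /= in_itv /= => /andP[].
have [Ks|nKs] := pselect (K (X s w)); [left|right]; last by split=> //; apply: SK; rewrite max_l.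
by split=> //; split=> //; rewrite max_l.
Qed.

End BoundaryClock.

Section Pathwise.
Context {R : realType} {H : completeNormedModType R} {ip : H -> H -> R} {e : nat -> H}.
Hypotheses (hip : inner_product ip) (he : orthonormal_basis ip e).
Notation RR := (measurableTypeR R).
Notation leb := (@lebesgue_measure R).
Variables (A : H -> H) (beta B bnu : H -> H) (x : R -> H) (g : R -> R) (T M C : R).
Hypothesis T0 : 0 <= T.
Hypothesis mB : measurable_fun [set: borel H] (B : borel H -> borel H).
Hypothesis mx : measurable_fun [set: RR] (fun s => x (Num.max s 0) : borel H).
Hypothesis xM : forall s, 0 <= s -> `|x s| <= M.
Hypothesis clk : clock g.
Hypothesis mnu : forall h, measurable_fun (`[0, T]%classic : set RR) (fun s => ip h (bnu (x s))).
Hypothesis nuC : {ae stieltjes g, forall s, `[0, T]%classic s -> `|bnu (x s)| <= C}.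
Hypothesis B2 : (\int[leb]_(s in `[0%R, T]) (`|B (x s)| ^+ 2)%:E < +oo)%E.
Hypothesis ibeta : forall k, leb.-integrable (`[0, T]%classic : set RR)
  (EFin \o (fun s => ip (e k) (B (x s) - beta (x s)))).

Let mT : measurable (`[0, T]%classic : set RR).
Proof. exact: measurable_itv. Qed.

Let mt t : measurable (`[0, t]%classic : set RR).
Proof. exact: measurable_itv. Qed.

Let sub t : t <= T -> (`[0, t]%classic : set RR) `<=` `[0, T]%classic.
Proof. by move=> tT s; rewrite /= !in_itv /= => /andP[-> /le_trans]; exact. Qed.

Let fleb : (leb `[0%R, T]%classic < +oo)%E.
Proof. by rewrite lebesgue_measure_itv; case: ifP => // _; rewrite -EFinD ltry. Qed.

Let mpath (f : H -> R) : measurable_fun [set: borel H] (f : borel H -> R) ->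
  measurable_fun (`[0, T]%classic : set RR) (fun s => f (x s)).
Proof.
move=> mf; apply: (@eq_measurable_fun _ _ RR _ _ (fun s => f (x (Num.max s 0)))).
  by move=> s; rewrite inE /= in_itv /= => /andP[s0 _]; rewrite max_l.
by apply: measurable_funTS; exact: (measurableT_comp mf mx).
Qed.

Let mipB (h : H) : measurable_fun (`[0, T]%classic : set RR) (fun s => ip h (B (x s))).
Proof.
apply: (@eq_measurable_fun _ _ RR _ _ (fun s => ip (B (x s)) h)); first by move=> s _; rewrite (ipC hip).
apply: (mpath (f := fun y => ip (B y) h)).
exact: (measurable_ip_borel hip _ mB).
Qed.

Let mipx (h : H) : measurable_fun (`[0, T]%classic : set RR) (fun s => ip h (x s)).
Proof.
apply: (@eq_measurable_fun _ _ RR _ _ (fun s => ip (x s) h)); first by move=> s _; rewrite (ipC hip).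
apply: (mpath (f := fun y => ip y h)).
apply: measurable_continuous; exact: (ip_continuous hip).
Qed.

Let bB (s : R) : R := 1 + `|B (x s)| ^+ 2.

Let ibB : leb.-integrable (`[0, T]%classic : set RR) (EFin \o bB).
Proof.
have mn : measurable_fun [set: borel H] (fun y : borel H => `|B y| ^+ 2).
  apply: measurable_funX; apply: (@measurableT_comp _ _ _ (borel H) (borel H) _ (fun y : H => `|y|)) => //.
  by apply: measurable_continuous; exact: norm_continuous.
have i2 : leb.-integrable (`[0, T]%classic : set RR) (EFin \o (fun s => `|B (x s)| ^+ 2)).
  apply/integrableP; split; first by apply/measurable_EFinP; exact: (mpath mn).
  by under eq_integral do rewrite /= ger0_norm ?sqr_ge0 //.
exact: (integrableD mT (integrable_constant 1 mT fleb) i2).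
Qed.

Let bBP : {ae leb, forall s, `[0, T]%classic s -> `|B (x s)| <= bB s}.
Proof. by apply: aeW => s _; rewrite /bB; have := sqr_ge0 (`|B (x s)| - 1); have := sqr_ge0 `|B (x s)|; nra. Qed.

Let ibx : leb.-integrable (`[0, T]%classic : set RR) (EFin \o (fun=> M)).
Proof. exact: (integrable_constant M mT fleb). Qed.

Let bxP : {ae leb, forall s, `[0, T]%classic s -> `|x s| <= M}.
Proof. by apply: aeW => s; rewrite /= in_itv /= => /andP[s0 _]; exact: xM. Qed.

Let ibnu : (stieltjes g).-integrable (`[0, T]%classic : set RR) (EFin \o (fun=> C)).
Proof. by apply: (integrable_constant C mT); rewrite (stieltjes_itvcc clk T0) ltry. Qed.

(* The Ito term is obtained by solving the equation for it; the content is the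
   uniform convergence of its coordinate series. *)
Definition path_limit (l : H) (t : R) : R :=
  ip l (x t - x 0) - \int[leb]_(s in `[0, t]) ip l (B (x s))
  + \int[leb]_(s in `[0, t]) ip (A l) (x s)
  - 1 / 2 * \int[stieltjes g]_(s in `[0, t]) ip l (bnu (x s)).

Definition path_noise (k : nat) (t : R) : R :=
  ip (e k) (x t - x 0)
  - \int[leb]_(s in `[0, t]) ip (e k) (beta (x s))
  + \int[leb]_(s in `[0, t]) ip (A (e k)) (x s)
  - 1 / 2 * \int[stieltjes g]_(s in `[0, t]) ip (e k) (bnu (x s))
  - \int[leb]_(s in `[0, t]) ip (e k) (B (x s) - beta (x s)).

(** The drift [beta] cancels between the noise and its Girsanov correction; splitting the integral
    is legitimate because [B] and [B - beta] are both integrable along the path. *)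
Lemma path_noiseE k t : t <= T -> path_noise k t = path_limit (e k) t.
Proof.
move=> tT; rewrite /path_noise /path_limit.
have iB : leb.-integrable (`[0, t]%classic : set RR) (EFin \o (fun s => ip (e k) (B (x s)))).
  exact: (weak_integrable hip mT mipB ibB bBP (e k) (mt t) (sub tT)).
have id := integrableS mT (mt t) (sub tT) (ibeta k).
have -> : \int[leb]_(s in `[0, t]) ip (e k) (beta (x s)) =
    \int[leb]_(s in `[0, t]) ip (e k) (B (x s)) -
    \int[leb]_(s in `[0, t]) ip (e k) (B (x s) - beta (x s)).
  rewrite -(RintegralB (mt t) iB id); apply: eq_Rintegral => s _.
  by rewrite (ipBr hip) subKr.
by rewrite opprB; ring.
Qed.

Variables (l : H) (alpha : nat -> R).
Hypothesis Ae : forall k, A (e k) = alpha k *: e k.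
Hypothesis Al : forall k, ip (A l) (e k) = ip l (e k) * alpha k.

(** Since [A] is diagonal, the partial sums involve truncations of both [l] and [A l]. These
    converge for [l] in the domain, so the unboundedness of [A] does no harm. *)
Lemma path_sum n t : 0 <= t <= T ->
  \sum_(k < n) ip l (e k) * path_noise k t =
  ip (trunc n l (e := e) (ip := ip)) (x t - x 0)
  - \int[leb]_(s in `[0, t]) ip (trunc n l (e := e) (ip := ip)) (B (x s))
  + \int[leb]_(s in `[0, t]) ip (trunc n (A l) (e := e) (ip := ip)) (x s)
  - 1 / 2 * \int[stieltjes g]_(s in `[0, t]) ip (trunc n l (e := e) (ip := ip)) (bnu (x s)).
Proof.
move=> /andP[t0 tT].
have h2 := weak_sum hip mT mipB ibB bBP n (fun k => ip l (e k)) e (mt t) (sub tT).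
have h3 := weak_sum hip mT mipx ibx bxP n (fun k => ip l (e k)) (fun k => A (e k)) (mt t) (sub tT).
have h4 := weak_sum hip mT mnu ibnu nuC n (fun k => ip l (e k)) e (mt t) (sub tT).
have e3 : \sum_(k < n) ip l (e k) *: A (e k) = trunc n (A l) (e := e) (ip := ip).
  by apply: eq_bigr => k _; rewrite Ae Al scalerA.
rewrite e3 in h3; rewrite -/(trunc n l (e := e) (ip := ip)) in h2 h4.
rewrite -h2 -h3 -h4 (ip_suml hip) mulr_sumr -!sumrN -!big_split /=.
apply: eq_bigr => k _; rewrite path_noiseE // /path_limit (ipZl hip); ring.
Qed.

Theorem path_converges (eps : R) : 0 < eps ->
  \forall n \near \oo, forall t, 0 <= t <= T ->
    `|\sum_(k < n) ip l (e k) * path_noise k t - path_limit l t| < eps.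
Proof.
move=> e0; have M0 : 0 <= M := le_trans (normr_ge0 _) (xM (lexx 0)).
pose I1 := \int[leb]_(s in `[0, T]) `|bB s|.
pose I2 := \int[leb]_(s in `[0, T]) `|M|.
pose I3 := \int[stieltjes g]_(s in `[0, T]) `|C|.
have I1p : 0 <= I1 by apply: Rintegral_ge0.
have I2p : 0 <= I2 by apply: Rintegral_ge0.
have I3p : 0 <= I3 by apply: Rintegral_ge0.
(* Each error is at most [eps / (2 * K)] times one of these bounds, all of them independent of time;
   the final 1 keeps [K] positive. *)
pose K := M + M + I1 + I2 + I3 + 1.
have K0 : 0 < K by rewrite /K; lra.
have d0 : 0 < eps / (2 * K) by rewrite divr_gt0 // mulr_gt0.
near=> n.
have n1 : `|l - trunc n l (e := e) (ip := ip)| < eps / (2 * K).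
  by near: n; have /cvgrPdist_lt /(_ _ d0) := cvg_trunc he l; exact.
have n2 : `|A l - trunc n (A l) (e := e) (ip := ip)| < eps / (2 * K).
  by near: n; have /cvgrPdist_lt /(_ _ d0) := cvg_trunc he (A l); exact.
move=> t /andP[t0 tT]; rewrite path_sum ?t0 // /path_limit.
set u := trunc n l (e := e) (ip := ip) in n1 *; set v := trunc n (A l) (e := e) (ip := ip) in n2 *.
have s2 := weak_sub hip mT mipB ibB bBP u l (mt t) (sub tT).
have s3 := weak_sub hip mT mipx ibx bxP v (A l) (mt t) (sub tT).
have s4 := weak_sub hip mT mnu ibnu nuC u l (mt t) (sub tT).
have b2 := weak_bound hip mT mipB ibB bBP (u - l) (mt t) (sub tT).
have b3 := weak_bound hip mT mipx ibx bxP (v - A l) (mt t) (sub tT).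
have b4 := weak_bound hip mT mnu ibnu nuC (u - l) (mt t) (sub tT).
have b1 : `|ip (u - l) (x t - x 0)| <= `|u - l| * (M + M).
  apply: le_trans (cauchy_schwarz hip _ _) _; apply: ler_wpM2l => //.
  by apply: le_trans (ler_normB _ _) _; apply: lerD; exact: xM.
have s1 : ip u (x t - x 0) - ip l (x t - x 0) = ip (u - l) (x t - x 0) by rewrite (ipBl hip).
rewrite -[\int[leb]_(s in `[0, T]) _]/I1 in b2; rewrite -[\int[leb]_(s in `[0, T]) _]/I2 in b3.
rewrite -[\int[stieltjes g]_(s in `[0, T]) _]/I3 in b4.
rewrite distrC in n1; rewrite distrC in n2.
move: s1 s2 s3 s4 b1 b2 b3 b4.
move: (ip u _) (ip l _) (ip (u - l) _) => a1 a2 a3.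
move: (\int[leb]_(s in _) ip u _) (\int[leb]_(s in _) ip l _) (\int[leb]_(s in _) ip (u - l) _) => c1 c2 c3.
move: (\int[leb]_(s in _) ip v _) (\int[leb]_(s in _) ip (A l) _) (\int[leb]_(s in _) ip (v - A l) _) => f1 f2 f3.
move: (\int[stieltjes g]_(s in _) ip u _) (\int[stieltjes g]_(s in _) ip l _) (\int[stieltjes g]_(s in _) ip (u - l) _) => g1 g2 g3.
move=> s1 s2 s3 s4 b1 b2 b3 b4.
have -> : a1 - c1 + f1 - 1 / 2 * g1 - (a2 - c2 + f2 - 1 / 2 * g2) = a3 - c3 + f3 - 1 / 2 * g3 by lra.
have := d0; move: n1 n2; set q := eps / (2 * K) => n1 n2 q0.
have q1 : `|u - l| * (M + M) <= q * (M + M) by apply: ler_wpM2r; [lra|exact: ltW].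
have q2 : `|u - l| * I1 <= q * I1 by apply: ler_wpM2r => //; exact: ltW.
have q3 : `|v - A l| * I2 <= q * I2 by apply: ler_wpM2r => //; exact: ltW.
have q4 : `|u - l| * I3 <= q * I3 by apply: ler_wpM2r => //; exact: ltW.
have qK : q * K = eps / 2 by rewrite /q; field; rewrite gt_eqF.
have qq : q * K = q * (M + M) + q * I1 + q * I2 + q * I3 + q by rewrite /K; ring.
have p3 := mulr_ge0 (ltW q0) I3p.
move: b1 b2 b3 b4; rewrite !ler_norml ltr_norml => /andP[? ?] /andP[? ?] /andP[? ?] /andP[? ?].
by apply/andP; split; lra.
Unshelve. all: by end_near. Qed.

End Pathwise.

Section BoundarySet.
Context {R : realType} {H : completeNormedModType R}.
Variables (ip : H -> H -> R) (DA : set H) (A : H -> H) (mu : probability (borel H) R).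
Variables (G : set H) (dG : {finite_measure set (borel H) -> \bar R}) (eta : H -> H).
Hypothesis hbm : boundary_measure ip DA A mu G dG eta.

Definition off_boundary : set H := ~` (boundary G `&` [set y | `|eta y| = 1]).

Lemma measurable_boundary : measurable (boundary G : set (borel H)).
Proof.
apply: measurableD; first by apply: measurable_closedH; exact: closed_closure.
by apply: measurable_openH; exact: open_interior.
Qed.

Lemma measurable_off_boundary : measurable (off_boundary : set (borel H)).
Proof.
apply: measurableC; apply: measurableI; first exact: measurable_boundary.
have mn : measurable_fun [set: borel H] (fun y : borel H => `|eta y|).
  apply: (@measurableT_comp _ _ _ (borel H) (borel H) _ (fun y : H => `|y|)) => //; last exact: (bm_meas hbm).
  by apply: measurable_continuous; exact: norm_continuous.
by rewrite -[X in measurable X]setTI; exact: (mn measurableT [set 1] (measurable_set1 1)).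
Qed.

Lemma off_boundary_null : dG off_boundary = 0%E.
Proof.
have [N [mN N0 hN]] := bm_unit hbm.
have mC : measurable (~` boundary G : set (borel H)) by apply: measurableC; exact: measurable_boundary.
have U0 := eq_trans (measureU0 mC mN N0) (bm_supp hbm).
apply: (subset_measure0 measurable_off_boundary (measurableU _ _ mC mN) _ U0).
move=> y hy; have [by_|nb] := pselect (boundary G y); [right|by left].
by apply: hN => /= h1; apply: hy.
Qed.

End BoundarySet.

Theorem theorem3p7 (R : realType)
  (* the Hilbert space, A, A^-1 and mu *)
  (H : completeNormedModType R) (ip : H -> H -> R) (e : nat -> H)
  (DA : set H) (A Ainv : H -> H) (delta : R) (alpha : nat -> R)
  (mu : probability (borel H) R)
  (* Gamma, F, ||d Gamma||, eta_Gamma *)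
  (G F : set H) (dG : {finite_measure set (borel H) -> \bar R}) (eta : H -> H)
  (* the matrix, extensions of its entries, and a version of its drift *)
  (Ab : H -> H -> H) (ext : nat -> nat -> H -> R) (beta : H -> H)
  (* the diffusion and its boundary local time *)
  (d : measure_display) (W : measurableType d) (Mf : R -> set (set W))
  (X : R -> W -> H) (th : R -> W -> W) (P : H -> probability W R)
  (L : R -> W -> R)
  (* the Girsanov transformation *)
  (T : R) (B : H -> H) (N0 : set H)
  (Z : H -> R -> W -> R) (Pt : H -> probability W R) :
  inner_product ip ->
  orthonormal_basis ip e ->
  self_adjoint ip DA A ->
  0 < delta -> (forall x, DA x -> delta * `|x| ^+ 2 <= ip (A x) x) ->
  inverse_operator DA A Ainv -> trace_class ip Ainv ->
  (forall j, DA (e j) /\ A (e j) = alpha j *: e j) ->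
  centered_gaussian ip (fun x => 2^-1 *: Ainv x) mu ->
  closed G -> convex_subset G -> bounded_set G ->
  BV ip DA A mu (\1_G) ->
  F = supp mu G ->
  boundary_measure ip DA A mu G dG eta ->
  breve_matrix ip A e mu G Ab ext ->
  is_drift ip A e mu G Ab ext beta ->
  closable mu F (form_Gamma ip mu G) ->
  closable mu F (form_Abar ip mu G Ab) ->
  diffusion F Mf X th P ->
  associated mu F (form_Abar ip mu G Ab) X P ->
  pcaf mu F (form_Abar ip mu G Ab) X th P L ->
  revuz mu F G X P L dG ->
  0 < T ->
  Linfty mu G B ->
  exceptional mu F (form_Gamma ip mu G) N0 ->
  (forall z, (F `\` N0) z ->
    girsanov mu G ip A e beta B (Abar_star_nu ip Ab eta) Mf X L T z
      (P z) (Z z) (Pt z)) ->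
  exists N : set H,
    [/\ exceptional mu F (form_Gamma ip mu G) N, N0 `<=` N &
     forall z, (F `\` N) z ->
      (forall l, DA l -> exists2 I : R -> W -> R,
         uniform_series (Pt z) T (fun k t w => ip l (e k) *
           shifted_noise ip A e beta B (Abar_star_nu ip Ab eta) X L z k t w) I &
         {ae Pt z, forall w, forall t, 0 <= t <= T ->
           ip l (X t w - X 0 w) =
             I t w
             + \int[lebesgue_measure]_(s in `[0, t]) ip l (B (X s w))
             - \int[lebesgue_measure]_(s in `[0, t]) ip (A l) (X s w)
             + 1 / 2 * \int[stieltjes (fun s => L s w)]_(s in `[0, t])
                         ip l (Abar_star_nu ip Ab eta (X s w))})
      /\
      {ae Pt z, forall w, forall t, 0 <= t ->
        (\int[stieltjes (fun s => L s w)]_(s in `[0%R, t])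
            (\1_(boundary G) (X s w))%:E = (L t w)%:E)%E}].
Proof.
move=> hip he hsa _ _ _ _ hAe _ cG _ bG _ FE hbm hbA hdrift clG clA hd hA hpcaf hR T0 hB hN0 hgir.
have mG : measurable (G : set (borel H)) := measurable_closedH cG.
have mF : measurable (F : set (borel H)).
  by rewrite FE; apply: measurable_closedH; exact: supp_closed.
have FG : F `<=` G by rewrite FE; exact: supp_sub.
(* For empty [F] the claim is vacuous. Otherwise a point of the support gives positive mass to [F],
   which the normalisation of the initial law requires. *)
have [[x0 Fx0]|nF] := pselect (exists x, F x); last first.
  by exists N0; split=> // z [Fz _]; case: nF; exists z.
have F0 : (0 < mu F)%E.
  have := Fx0; rewrite {1}FE => /(_ setT openT Logic.I); rewrite setTI => /lt_le_trans; apply.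
  have GF0 : mu (G `\` F) = 0%E by rewrite FE; exact: (supp_null hip he mu mG).
  rewrite -(measureU0 mF (measurableD mG mF) GF0); apply: le_measure; rewrite ?inE //.
    by apply: measurableU => //; exact: measurableD.
  by move=> y Gy; have [Fy|nFy] := pselect (F y); [left|right].
have hE := energy_form_Gamma hip he cG FE.
have hEA := sector_form_Abar hip he hbA cG.
have hEG := sector_form_Gamma hip he mu cG.
have mS := measurable_off_boundary hbm.
have [N [Fk [cN NF hN]]] := local_time_support hip he hd mS mF hE hEA clA hA hpcaf F0 hR FG (off_boundary_null hbm).
have [F1 nF1 N0F] := hN0.
have cF1 := nest_capnest mF hE hEG clG nF1.
(* The sets from the local time come from the form of the diffusion and [N0] from the symmetric
   form; both are covered by capacity nests of the latter, so the union is exceptional for it. *)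
exists (\bigcup_m (if m is m'.+1 then N m' else N0)); split.
- apply: (exceptional_bigcup mF hE (Fm := fun m => if m is m'.+1 then Fk m' else F1)); first by case.
  by case=> [|m] //; exact: NF.
- by move=> z N0z; exists 0%N.
move=> z [Fz nz].
have gz : girsanov mu G ip A e beta B (Abar_star_nu ip Ab eta) Mf X L T z (P z) (Z z) (Pt z).
  by apply: hgir; split=> // N0z; apply: nz; exists 0%N.
have clk := hN z Fz (fun m Nm => nz (ex_intro2 _ _ m.+1 Logic.I Nm)).
split; last first.
  apply: (density_ae (gi_density gz)); move: clk; apply: ae_imp => w [cw S0] t t0.
  have mK := @measurable_boundary R H G.
  apply: (integral_boundary_clock cw _ _ S0 _ t0); try exact: (measurable_visits_path hip he hd).
  by move=> y nb [].
move=> l DAl.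
exists (fun t w => path_limit (ip := ip) A B (Abar_star_nu ip Ab eta) (fun s => X s w) (fun s => L s w) l t);
  last by apply: aeW => w t _; rewrite /path_limit; ring.
apply: (density_ae (gi_density gz)).
have mXj := measurable_joint hip he (fun s s0 => measurable_X hd s0)
  (fun t w t0 => @df_right _ _ _ _ _ _ _ _ _ hd t w t0).
have mBb k : measurable_fun [set: borel H] (fun y : borel H => ip (e k) (B y - beta y)).
  apply: (@eq_measurable_fun _ _ (borel H) _ _ (fun y => ip (B y) (e k) - ip (beta y) (e k))).
    by move=> y _; rewrite -(ipBl hip) (ipC hip).
  apply: measurable_funB; apply: (measurable_ip_borel hip); [exact: hB.1|exact: hdrift.1].
have ibeta : {ae P z, forall w, forall k, (@lebesgue_measure R).-integrable
    (`[0, T]%classic : set (measurableTypeR R)) (EFin \o (fun s => ip (e k) (B (X s w) - beta (X s w))))}.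
  apply: ae_all => k; have [I hI _] := gi_Z gz.
  apply: (ito_integrand_integrable (df_filt hd) _ (hI k)).
  exact: (measurableT_comp (mBb k) mXj).
have [C C0 hC] := Abar_star_nu_bound hip he hbA eta.
have [M M0 hM] := pinfty_ex_gt0 bG.
(* Self-adjointness moves [A] onto the eigenvector. *)
have Al k : ip (A l) (e k) = ip l (e k) * alpha k.
  have [DAk Ak] := hAe k; have [_ /(_ (conj DAk Ak)) h] := sa_adj hsa (e k) (alpha k *: e k).
  by rewrite (h l DAl) (ipZr hip) mulrC.
have B0 : (0 <= Linfty_norm mu G B)%E.
  apply: ess_sup_ger; first by rewrite [X in (_ < X)%E](probability_setT mu) lte01.
  by move=> y; rewrite lee_fin mulr_ge0.
have B2 : (T%:E * Linfty_norm mu G B ^+ 2 < +oo)%E.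
  have fB : Linfty_norm mu G B \is a fin_num by rewrite ge0_fin_numE //; exact: hB.2.
  by rewrite -(fineK fB) -EFin_expe -EFinM ltry.
have aeX := df_normal hd Fz.
move: (ae_imp2 (fun w h1 h2 => conj h1 h2) clk (ae_imp2 (fun w h1 h2 => conj h1 h2) aeX
  (ae_imp2 (fun w h1 h2 => conj h1 h2) ibeta (gi_bound gz)))).
apply: ae_imp => w [[cw S0] [X0 [ibw gb]]] eps e0.
have FX s : 0 <= s -> F (X s w) := @df_state _ _ _ _ _ _ _ _ _ hd s w.
have mx : measurable_fun [set: measurableTypeR R] (fun s => X (Num.max s 0) w : borel H).
  exact: (measurable_fun_pair2 w mXj).
have mnu h : measurable_fun (`[0, T]%classic : set (measurableTypeR R))
    (fun s => ip h (Abar_star_nu ip Ab eta (X s w))).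
  apply: (@eq_measurable_fun _ _ (measurableTypeR R) _ _
    (fun s => ip h (Abar_star_nu ip Ab eta (X (Num.max s 0) w)))).
    by move=> s; rewrite inE /= in_itv /= => /andP[s0 _]; rewrite max_l.
  apply: (measurable_comp mG _ (measurable_Abar_star_nu hip he hbA (bm_meas hbm) h) (measurable_funTS mx)).
  by move=> _ [s _ <-]; apply: FG; apply: FX; rewrite le_max lexx orbT.
(* The operator bound controls the reflection field only where [|eta| = 1]; the remaining times are
   visits to [off_boundary], null for the clock of this path. *)
have nuC : {ae stieltjes (fun s => L s w), forall s, `[0, T]%classic s ->
    `|Abar_star_nu ip Ab eta (X s w)| <= C}.
  exists (visits X (off_boundary G eta) w); split=> //.
    exact: (measurable_visits_path hip he hd mS w).
  move=> s /= hs; have [sT nb] : `[0, T]%classic s /\ ~ `|Abar_star_nu ip Ab eta (X s w)| <= C.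
    by split; [apply: contrapT => h; apply: hs => /h|move=> h; apply: hs].
  move: sT; rewrite /= in_itv /= => /andP[s0 _]; split=> //; rewrite max_l // => -[_ /= h1].
  by apply: nb; rewrite -[leRHS]mulr1 -h1; apply: hC; apply: FG; exact: FX.
have xM s : 0 <= s -> `|X s w| <= M by move=> s0; apply: hM; apply: FG; exact: FX.
have := @path_converges R H ip e hip he A beta B (Abar_star_nu ip Ab eta) (fun s => X s w)
  (fun s => L s w) T M C (ltW T0) hB.1 mx xM cw mnu nuC (le_lt_trans gb B2) ibw l alpha
  (fun k => (hAe k).2) Al eps e0.
apply: filterS => n hn t tT; have := hn t tT.
(* [path_noise] starts from the actual initial value and [shifted_noise] from [z]; they agree almost
   surely. *)
by rewrite -X0.
Qed.
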